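(* Let $\rho$ be the unique real root of $x^3 = x+1$ and let $\lambda^* := \rho^{1/2} + \rho^{-1/2}$ ($\approx 2.01980$). For every real number $\lambda$, the family $\mathcal{G}^\mp(\lambda)$ of signed graphs with largest eigenvalue at most $\lambda$ has a finite forbidden subgraph characterization if and only if $\lambda < \lambda^*$.
   Context: A signed graph is a finite simple undirected graph each of whose edges is labeled $+$ or $-$; signed graphs are considered up to (sign-preserving) isomorphism. The eigenvalues of a signed graph $G^\pm$ are those of its signed adjacency matrix, whose $(i,j)$-th entry is $1$ if $ij$ is a positive edge, $-1$ if $ij$ is a negative edge, and $0$ otherwise. All subgraphs are induced and inherit the edge signs. Given a family $\mathcal{G}$ of signed graphs that is closed under taking (induced) subgraphs, a family $\mathcal{F}$ of signed graphs is a forbidden subgraph characterization of $\mathcal{G}$ if $\mathcal{G}$ consists exactly of the signed graphs that do not contain any member of $\mathcal{F}$ as an (induced) subgraph. *)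

(* Defs.v *)
From HB Require Import structures.
From mathcomp Require Import all_boot all_order all_algebra.
From mathcomp Require Import boolp classical_sets cardinality reals.
From mathcomp Require Import constructive_ereal ereal.
From mathcomp Require Import ring lra.

Set Implicit Arguments.
Unset Strict Implicit.
Unset Printing Implicit Defensive.

Import Order.TTheory GRing.Theory Num.Theory.
Local Open Scope classical_set_scope.
Local Open Scope ring_scope.

(* Graphs matter only up to isomorphism, so the vertex set is 'I_n.
   [sg_edge i j] is [None] for a non-edge, [Some true] for a positive edge and
   [Some false] for a negative edge. *)
Record sgraph := SGraph {
  sg_order : nat;
  sg_edge : 'I_sg_order -> 'I_sg_order -> option bool;
  sg_edge_sym : forall i j, sg_edge i j = sg_edge j i;
  sg_edge_irr : forall i, sg_edge i i = None
}.

(* [H] is isomorphic, signs included, to an induced subgraph of [G]. *)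
Definition induced_subgraph (H G : sgraph) : Prop :=
  exists2 f : 'I_(sg_order H) -> 'I_(sg_order G),
    injective f & forall i j, sg_edge (f i) (f j) = sg_edge i j.

Definition edge_value (R : pzRingType) (e : option bool) : R :=
  match e with
  | Some true => 1
  | Some false => -1
  | None => 0
  end.

Definition signed_adjacency (R : pzRingType) (G : sgraph) : 'M[R]_(sg_order G) :=
  \matrix_(i, j) edge_value R (sg_edge i j).

(* A signed adjacency matrix has finitely many eigenvalues and, being
   symmetric, at least one real eigenvalue if [sg_order G > 0], so that this
   supremum is a maximum; it is -oo for the graph without vertices. *)
Definition largest_eigenvalue (R : realType) (G : sgraph) : \bar R :=
  ereal_sup [set x%:E | x in [set x : R | eigenvalue (signed_adjacency R G) x]].

Definition bounded_spectrum (R : realType) (lambda : R) : set sgraph :=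
  [set G | (largest_eigenvalue R G <= lambda%:E)%E].

Definition forbidden_characterization (F C : set sgraph) : Prop :=
  forall G, C G <-> (forall H, F H -> ~ induced_subgraph H G).

(* Each isomorphism class contains only finitely many elements of [sgraph], so
   finiteness of [F] is the same as finiteness up to isomorphism. *)
Definition has_finite_forbidden_characterization (C : set sgraph) : Prop :=
  exists2 F : set sgraph, finite_set F & forbidden_characterization F C.

Lemma cubic_root_unique (R : realType) :
  exists! rho : R, rho ^+ 3 = rho + 1.
Proof.
pose p : {poly R} := 'X^3 - 'X - 1.
have pE x : p.[x] = x ^+ 3 - x - 1 by rewrite /p !hornerE.
have [||x _ /rootP] := @poly_ivt R p 1 2; first by lra.
  by rewrite !pE; apply/andP; split; lra.
rewrite pE => px; exists x; split; first by lra.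
have gt1 (z : R) : z ^+ 3 = z + 1 -> 1 < z.
  move=> hz; rewrite ltNge; apply/negP => z1.
  have z3 : z ^+ 3 = z * z ^+ 2 by ring.
  have z2 : 0 <= z ^+ 2 := sqr_ge0 z.
  have [z0|z0] := lerP 0 z; first by nra.
  have : z ^+ 3 <= 0 by rewrite z3; nra.
  by nra.
move=> y hy; have hx : x ^+ 3 = x + 1 by lra.
have x1 := gt1 _ hx; have y1 := gt1 _ hy.
have : (x - y) * (x ^+ 2 + x * y + y ^+ 2 - 1) = 0.
  have -> : (x - y) * (x ^+ 2 + x * y + y ^+ 2 - 1)
    = (x ^+ 3 - x) - (y ^+ 3 - y) by ring.
  by rewrite hx hy; ring.
move=> /eqP; rewrite mulf_eq0 => /orP[/eqP|/eqP]; first by lra.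
by move=> h; exfalso; nra.
Qed.

(* Main.v *)
Require Import Defs.
From mathcomp Require Import all_boot all_order all_algebra.
From mathcomp Require Import boolp reals.
From mathcomp Require Import zify ring lra.

(* A signed graph has largest eigenvalue at most lambda iff lambda - A is positive
   semidefinite, so the minimal forbidden graphs are the critical ones: this fails for
   them, but holds on every proper subset of the vertices.

   Let lambda < lambda*, say lambda <= t + 1/t with t^6 < t^2 + 1. A large critical graph
   contains a large negative clique or induced path, because large stars and positive K4
   are themselves forbidden. On such a set 2 - A is the Gram matrix of signed edges
   (vectors +-e_i +-e_j) of a large connected root graph, and this representation extends
   one vertex v at a time: by duality, semidefiniteness near v yields a real potential p on
   the root graph of energy at most t + 1/t whose values on the edges almost are the
   entries of A at v, and p can be rounded to an integer potential of squared norm at most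
   2, which is the edge representing v. If the rounding failed, then sorting the values of
   p would give a long path ending in a half-integral digon or in three vertices near 1,
   and the energy of these exceeds t + 1/t as t^6 < t^2 + 1. So 2 - A is a Gram matrix on
   the whole critical graph, which is absurd if lambda >= 2. If lambda < 2, then the root
   graph has bounded diameter and at most one vertex of large degree; a flow can be pushed
   out of such a vertex at little cost, and this bounds the critical graph.

   Let lambda >= lambda*, and suppose that n0 vertices always suffice to see that
   lambda - A is not semidefinite. In a recursive tree of cliques deeper than n0 the deep
   levels are invisible to any n0 vertices, so arbitrarily many pendant vertices may be
   inserted there; a level full of pendants outweighs one more pendant at the previous
   level, and in this way pendants climb up to the root, where they make the form
   indefinite. At lambda* the initial tree is the star-like tree with arms 1, 2 and
   infinity, which is where the cubic equation comes from. *)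

Set Implicit Arguments.
Unset Strict Implicit.
Unset Printing Implicit Defensive.

Import Order.TTheory GRing.Theory Num.Theory.
Local Open Scope ring_scope.

(** * Quadratic forms of signed graphs and root graphs *)

(** With [lambda = t + 1/t] the excess over 2 is [eps = (t - 1)^2 / t], and the cheapest potential
    on a long path decays by the factor 1/t. The energies of both possible ends exceed [lambda]
    exactly when [t^2 + 1 - t^6] is positive, and this polynomial vanishes at [t^2 = rho]. It also
    decides whether the tree with arms 1, 2 and infinity is within the bound. For [lambda < 2] there
    is no such [t], but semidefiniteness is monotone in [lambda], so that a larger [t + 1/t] serves
    to find the representation.

    The obstacle is that criticality controls proper subsets only, so that duality cannot be applied
    to the whole root graph at once. It is applied to clusters of [n + 1] root vertices: the sorted
    values beyond these are negligible, and on a connected cluster with more than four vertices an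
    integer potential of squared norm at most 2 is unique, so that the local roundings glue. *)

Definition signed_mx (V : finType) (A : V -> V -> int) : Prop :=
  [/\ forall u v, A u v = A v u, forall u, A u u = 0
    & forall u v, -1 <= A u v <= 1].

Definition supp_in (R : realType) (V : finType) (S : {set V}) (x : V -> R) :=
  forall v, v \notin S -> x v = 0.

Lemma sum_delta (R : pzRingType) (V : finType) (k : R) (u : V) (F : V -> R) :
  \sum_v k *+ (u == v) * F v = k * F u.
Proof.
rewrite (bigD1 u) //= eqxx big1 ?addr0 // => v /negPf vu.
by rewrite eq_sym vu mul0r.
Qed.

Section QuadraticForms.
Variables (R : realType) (V : finType) (M : V -> V -> R).
Implicit Types (S T : {set V}) (x y : V -> R).

(** [M] is left general because criticality is needed twice: for [lam - A], and for the Gram matrix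
    of a root graph some of whose vertices are grounded. *)
Definition qform x : R := \sum_u \sum_v M u v * (x u * x v).

Definition form_psd S : Prop := forall x, supp_in S x -> 0 <= qform x.

Definition form_critical S : Prop :=
  ~ form_psd S /\ forall T : {set V}, T \proper S -> form_psd T.

Lemma supp_in_sub S T x : S \subset T -> supp_in S x -> supp_in T x.
Proof. by move=> sST sx v vT; apply: sx; apply: contra vT; apply: subsetP. Qed.

Lemma form_critical_exists S : ~ form_psd S ->
  exists2 T : {set V}, T \subset S & form_critical T.
Proof.
move=> nS; pose P := [pred T : {set V} | `[< ~ form_psd T >]].
have [|T /minsetP [/asboolP nT mT] sTS] := @minset_exists _ P S.
  exact/asboolP.
exists T => //; split=> // U ltU; apply: contrapT => nU.
have PU : P U by apply/asboolP.
by move: (ltU); rewrite (mT U PU (proper_sub ltU)) properxx.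
Qed.

Hypothesis Msym : forall u v, M u v = M v u.

Lemma qformD x y : qform (fun v => x v + y v)
  = qform x + qform y + 2 * \sum_u \sum_v M u v * (x u * y v).
Proof.
rewrite /qform.
have -> : \sum_u \sum_v M u v * ((x u + y u) * (x v + y v))
  = \sum_u \sum_v M u v * (x u * x v) + \sum_u \sum_v M u v * (y u * y v)
  + \sum_u \sum_v M u v * (x u * y v) + \sum_u \sum_v M u v * (y u * x v).
  rewrite -!big_split /=; apply: eq_bigr => u _.
  by rewrite -!big_split /=; apply: eq_bigr => v _; ring.
have -> : \sum_u \sum_v M u v * (y u * x v) = \sum_u \sum_v M u v * (x u * y v).
  rewrite exchange_big /=; apply: eq_bigr => u _; apply: eq_bigr => v _.
  by rewrite Msym; ring.
ring.
Qed.

(** Without such an entry the form would split into its restrictions to [T] and [S :\: T], both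
    semidefinite because both sets are proper subsets of [S]. *)
Lemma form_critical_connected S T : form_critical S ->
  T \subset S -> T != set0 -> T != S ->
  exists u v, [/\ u \in T, v \in S, v \notin T & M u v != 0].
Proof.
move=> [nS mS] sTS T0 TS; apply: contrapT => nex; apply: nS => x sx.
have A0 u v : u \in T -> v \in S -> v \notin T -> M u v = 0.
  by move=> uT vS vT; apply/eqP; apply: contra_notT nex => h; exists u, v.
pose y v := if v \in T then x v else 0; pose z v := if v \in T then 0 else x v.
have -> : x = fun v => y v + z v.
  by apply/funext => v; rewrite /y /z; case: ifP; rewrite ?addr0 ?add0r.
rewrite qformD [X in 2 * X]big1 ?mulr0 ?addr0 => [|u _]; last first.
  rewrite big1 // => v _.
  rewrite /y /z; case: ifPn => uT; last by rewrite mul0r mulr0.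
  case: ifPn => vT; first by rewrite !mulr0.
  have [vS|vS] := boolP (v \in S); first by rewrite A0 // mul0r.
  by rewrite (sx v) // !mulr0.
have h1 : 0 <= qform y.
  apply: (mS T); first by rewrite properEneq TS.
  by move=> v vT; rewrite /y (negPf vT).
have h2 : 0 <= qform z.
  apply: (mS (S :\: T)).
    rewrite properEneq subsetDl andbT; apply: contra T0 => /eqP ST.
    rewrite -subset0; apply/subsetP => v vT.
    by have := subsetP sTS v vT; rewrite -ST inE vT.
  move=> v; rewrite inE negb_and negbK /z; case: ifP => //= _ vS; exact: sx.
exact: addr_ge0.
Qed.

End QuadraticForms.

Definition qf (R : realType) (V : finType) (A : V -> V -> int) (lam : R)
    (x : V -> R) : R :=
  lam * (\sum_v x v ^+ 2) - \sum_u \sum_v (A u v)%:~R * (x u * x v).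

Definition psd (R : realType) (V : finType) (A : V -> V -> int) (lam : R)
    (S : {set V}) : Prop :=
  forall x, supp_in S x -> 0 <= qf A lam x.

Definition critical (R : realType) (V : finType) (A : V -> V -> int) (lam : R)
    (S : {set V}) : Prop :=
  ~ psd A lam S /\ forall T : {set V}, T \proper S -> psd A lam T.

Section Forms.
Variables (R : realType) (V : finType) (A : V -> V -> int).
Implicit Types (S T : {set V}) (x : V -> R) (lam : R).

Lemma psd_sub lam S T : S \subset T -> psd A lam T -> psd A lam S.
Proof. by move=> sST pT x /(supp_in_sub sST) /pT. Qed.

Lemma psd_le lam lam' S : lam <= lam' -> psd A lam S -> psd A lam' S.
Proof.
move=> le_lam pS x /pS; rewrite /qf => h; apply: le_trans h _.
rewrite lerD2r ler_wpM2r //; apply: sumr_ge0 => i _; exact: sqr_ge0.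
Qed.

Lemma qf_form lam x :
  qf A lam x = qform (fun u v => lam *+ (u == v) - (A u v)%:~R) x.
Proof.
rewrite /qf /qform mulr_sumr -sumrB; apply: eq_bigr => u _.
under [RHS]eq_bigr do rewrite mulrBl.
by rewrite sumrB sum_delta -expr2.
Qed.

Lemma qf_lin lam (x y : V -> R) : signed_mx A ->
  qf A lam (fun v => x v + y v) = qf A lam x + qf A lam y
   + 2 * (lam * \sum_v x v * y v - \sum_u \sum_v (A u v)%:~R * (x u * y v)).
Proof.
case=> Asym _ _; rewrite !qf_form qformD => [|u v]; last by rewrite Asym eq_sym.
congr (_ + _ + 2 * _); rewrite mulr_sumr -sumrB; apply: eq_bigr => u _.
under eq_bigr do rewrite mulrBl.
by rewrite sumrB sum_delta.
Qed.

Lemma critical_form lam S : critical A lam S <->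
  form_critical (fun u v => lam *+ (u == v) - (A u v)%:~R) S.
Proof.
have E T : psd A lam T <-> form_psd (fun u v => lam *+ (u == v) - (A u v)%:~R) T.
  by split=> h x /h; rewrite qf_form.
by split=> -[h1 h2]; split=> [/E //|T /h2 /E].
Qed.

Lemma critical_exists lam S : ~ psd A lam S ->
  exists2 T : {set V}, T \subset S & critical A lam T.
Proof.
move=> nS; have [|T sT cT] := @form_critical_exists R V (fun u v => lam *+ (u == v) - (A u v)%:~R) S.
  by move=> h; apply: nS => x /h; rewrite qf_form.
by exists T => //; apply/critical_form.
Qed.

Lemma critical_connected lam S T : signed_mx A -> critical A lam S ->
  T \subset S -> T != set0 -> T != S ->
  exists u v, [/\ u \in T, v \in S, v \notin T & A u v != 0].
Proof.
move=> [Asym _ _] /critical_form cS sT T0 TS.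
have [|u [v [uT vS vT h]]] := form_critical_connected _ cS sT T0 TS.
  by move=> u v; rewrite Asym eq_sym.
exists u, v; split=> //; apply: contraNneq h => ->.
by rewrite subr0 (_ : (u == v) = false) ?mulr0n //; apply: contraNF vT => /eqP <-.
Qed.

End Forms.

Section EdgeVectors.
Variables (V X : finType) (a c : V -> X) (al ga : V -> int).

Definition evec (z : X) (e : V) : int := al e *+ (z == a e) + ga e *+ (z == c e).

(* [2 - A] is on [S] the Gram matrix of the vectors [al e * delta_(a e) + ga e * delta_(c e)]:
   the vertices of [S] are signed edges of a root graph on [X]. *)
Definition line_rep (A : V -> V -> int) (S : {set V}) : Prop :=
  [/\ forall e, e \in S -> a e != c e,
      forall e, e \in S -> (al e == 1) || (al e == -1),
      forall e, e \in S -> (ga e == 1) || (ga e == -1)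
    & forall e f, e \in S -> f \in S -> e != f ->
        \sum_z evec z e * evec z f = - A e f].

Lemma sum_evec (R : pzRingType) (F : X -> R) e :
  \sum_z (evec z e)%:~R * F z = (al e)%:~R * F (a e) + (ga e)%:~R * F (c e).
Proof.
rewrite /evec; under eq_bigr do rewrite rmorphD mulrDl.
rewrite big_split /= (bigD1 (a e)) //= (bigD1 (c e) (P := xpredT)) //= !eqxx !mulr1n.
rewrite big1 ?addr0 ?big1 ?addr0 // => z /negPf ->.
- by rewrite mulr0n rmorph0 mul0r.
- by rewrite mulr0n rmorph0 mul0r.
Qed.

Variable R : realType.
Implicit Types (x : V -> R).

Definition vec x z : R := \sum_e (evec z e)%:~R * x e.

Lemma sum_vec x (p : X -> R) :
  \sum_z vec x z * p z =
  \sum_e x e * ((al e)%:~R * p (a e) + (ga e)%:~R * p (c e)).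
Proof.
rewrite /vec; under eq_bigr do rewrite mulr_suml.
rewrite exchange_big /=; apply: eq_bigr => e _.
rewrite -sum_evec mulr_sumr; apply: eq_bigr => z _; ring.
Qed.

Lemma evec_sqr A S e : line_rep A S -> e \in S ->
  \sum_z evec z e * evec z e = 2.
Proof.
case=> nac ala gaa _ eS.
transitivity (\sum_z (evec z e)%:~R * evec z e).
  by apply: eq_bigr => z _; rewrite intz.
rewrite (sum_evec (evec^~ e)) !intz /evec !eqxx (negPf (nac e eS)) eq_sym (negPf (nac e eS)).
rewrite !mulr1n !mulr0n addr0 add0r.
by case/orP: (ala e eS) => /eqP ->; case/orP: (gaa e eS) => /eqP ->.
Qed.

Lemma vec_sqr x :
  \sum_z vec x z ^+ 2 =
  \sum_e \sum_f (\sum_z evec z e * evec z f)%:~R * (x e * x f).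
Proof.
under eq_bigr => z _ do rewrite expr2 /vec mulr_suml.
rewrite exchange_big /=; apply: eq_bigr => e _.
under eq_bigr => z _ do rewrite mulr_sumr.
rewrite exchange_big /=; apply: eq_bigr => f _.
rewrite rmorph_sum mulr_suml; apply: eq_bigr => z _.
by rewrite rmorphM; ring.
Qed.

(** [lam - A] is [2 - A], a sum of squares over the root vertices, plus [lam - 2] times the
    identity. *)
Lemma qf_rep A S lam x : signed_mx A -> line_rep A S -> supp_in S x ->
  qf A lam x = \sum_z vec x z ^+ 2 + (lam - 2) * \sum_e x e ^+ 2.
Proof.
move=> [_ A0 _] rS sx; rewrite vec_sqr /qf.
suff -> : \sum_e \sum_f (\sum_z evec z e * evec z f)%:~R * (x e * x f)
  = 2 * \sum_e x e ^+ 2 - \sum_e \sum_f (A e f)%:~R * (x e * x f) by ring.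
rewrite mulr_sumr -sumrB; apply: eq_bigr => e _.
have [eS|eS] := boolP (e \in S); last first.
  rewrite sx // expr0n mulr0 !big1 ?subr0 // => f _; first by rewrite mul0r mulr0.
  by rewrite mul0r mulr0.
rewrite (bigD1 e) //= (evec_sqr rS) // -expr2 [in RHS](bigD1 e) //= A0 mul0r add0r.
rewrite -[2%:~R]/(2 : R); congr (_ + _).
rewrite -sumrN; apply: eq_bigr => f fe.
have [fS|fS] := boolP (f \in S); last by rewrite (sx f) // !mulr0 oppr0.
by case: rS => _ _ _ ->; rewrite // 1?eq_sym // rmorphN mulNr.
Qed.

End EdgeVectors.

(** * Real potentials and sorted sequences *)

Lemma posdef_solve (R : realType) (V : finType) (M : V -> V -> R) (b : V -> R) :
  (forall x, \sum_e \sum_f M e f * (x e * x f) = 0 -> forall e, x e = 0) ->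
  exists x, forall e, \sum_f M e f * x f = b e.
Proof.
move=> pM; pose A : 'M[R]_#|V| := \matrix_(i, j) M (enum_val i) (enum_val j).
have uA : A \in unitmx.
  rewrite unitmxE unitfE; apply/negP => /det0P [v vn0 vA].
  case/negP: vn0; apply/eqP/rowP => j; rewrite mxE.
  have -> : v 0 j = v 0 (enum_rank (enum_val j)) by rewrite enum_valK.
  apply: (pM (fun e => v 0 (enum_rank e))).
  rewrite exchange_big big1 //= => f _.
  move/rowP/(_ (enum_rank f)): vA; rewrite !mxE => h.
  transitivity ((\sum_e M e f * v 0 (enum_rank e)) * v 0 (enum_rank f)).
    by rewrite mulr_suml; apply: eq_bigr => e _; rewrite mulrA.
  rewrite [X in X * _](_ : _ = 0) ?mul0r // -[RHS]h.
  rewrite (reindex _ (onW_bij _ (enum_val_bij V))) /=.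
  by apply: eq_bigr => i _; rewrite !mxE enum_rankK enum_valK mulrC.
pose y : 'cV[R]_#|V| := invmx A *m \col_i b (enum_val i).
exists (fun e => y (enum_rank e) 0) => e.
have /colP/(_ (enum_rank e)) : A *m y = \col_i b (enum_val i).
  by rewrite mulmxA mulmxV // mul1mx.
rewrite !mxE enum_rankK => <-.
rewrite (reindex _ (onW_bij _ (enum_val_bij V))) /=.
by apply: eq_bigr => i _; rewrite !mxE enum_rankK enum_valK.
Qed.

Lemma sumsq_eq0 (R : realType) (I : finType) (F : I -> R) :
  \sum_i F i ^+ 2 <= 0 -> forall i, F i = 0.
Proof.
move=> h i; apply/eqP; rewrite -sqrf_eq0; apply/eqP/le_anti.
rewrite sqr_ge0 andbT; apply: le_trans h.
rewrite (bigD1 i) //= lerDl; apply: sumr_ge0 => j _; exact: sqr_ge0.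
Qed.

Section Potential.
Variables (R : realType) (V X : finType) (a c : V -> X) (al ga : V -> int).
Local Notation evec := (evec a c al ga).
Local Notation vec := (vec a c al ga).

(* Lagrangian duality: the minimum over edge flows [x] is the maximum over vertex potentials [p]. *)
Lemma dual_potential (E0 : {set V}) (b : V -> int) (lam eps : R) : 0 < eps ->
  (forall x, supp_in E0 x ->
    0 <= lam - 2 * (\sum_e (b e)%:~R * x e)
         + \sum_z vec x z ^+ 2 + eps * \sum_e x e ^+ 2) ->
  exists p : X -> R,
    \sum_z p z ^+ 2 + eps^-1 * (\sum_(e in E0)
      ((b e)%:~R - ((al e)%:~R * p (a e) + (ga e)%:~R * p (c e))) ^+ 2) <= lam.
Proof.
move=> eps0 h.
(* The matrix of the stationarity condition. Off [E0] only [eps] is left on the diagonal, which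
   forces the solution to vanish there. *)
pose M e f : R := (if (e \in E0) && (f \in E0)
   then (\sum_z evec z e * evec z f)%:~R else 0) + eps *+ (e == f).
have [x|x xE] := @posdef_solve R V M (fun e => if e \in E0 then (b e)%:~R else 0).
  pose x' e := if e \in E0 then x e else 0.
  have -> : \sum_e \sum_f M e f * (x e * x f)
     = \sum_z vec x' z ^+ 2 + eps * \sum_e x e ^+ 2.
    rewrite vec_sqr mulr_sumr -big_split; apply: eq_bigr => e _ /=.
    rewrite /M; under eq_bigr do rewrite mulrDl; rewrite big_split /=; congr (_ + _).
      apply: eq_bigr => f _; rewrite /x'.
      by case: (e \in E0); case: (f \in E0); rewrite /= ?mul0r ?mulr0.
    by rewrite sum_delta -expr2.
  move=> h0; apply: sumsq_eq0.
  rewrite -(pmulr_rle0 _ eps0).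
  have : 0 <= \sum_z vec x' z ^+ 2 by apply: sumr_ge0 => z _; exact: sqr_ge0.
  by lra.
have sx : supp_in E0 x.
  move=> e eE; have := xE e; rewrite (negPf eE) (bigD1 e) //= big1 => [|f fe].
    rewrite /M (negPf eE) eqxx mulr1n add0r addr0 => /eqP.
    by rewrite mulf_eq0 gt_eqF //= => /eqP.
  by rewrite /M (negPf eE) eq_sym (negPf fe) addr0 mul0r.
have xE' e : e \in E0 ->
  (al e)%:~R * vec x (a e) + (ga e)%:~R * vec x (c e) + eps * x e = (b e)%:~R.
  move=> eE; have := xE e; rewrite eE => <-.
  rewrite -sum_evec /M; under [RHS]eq_bigr do rewrite mulrDl.
  rewrite big_split /=; congr (_ + _); last by rewrite sum_delta.
  under eq_bigr do rewrite mulr_sumr.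
  rewrite exchange_big /=; apply: eq_bigr => f _; rewrite eE /=.
  case: ifPn => fE; last by rewrite (sx f) // mul0r big1 // => z _; rewrite !mulr0.
  rewrite rmorph_sum mulr_suml; apply: eq_bigr => z _.
  by rewrite rmorphM; ring.
(* At the minimiser the defect of an edge [e] is [eps * x e], so that the energy of [vec x] equals
   the sum of the [b e * x e]; the hypothesis at [x] bounds this by [lam]. *)
exists (vec x).
have -> : \sum_(e in E0) ((b e)%:~R
    - ((al e)%:~R * vec x (a e) + (ga e)%:~R * vec x (c e))) ^+ 2
   = eps ^+ 2 * \sum_e x e ^+ 2.
  rewrite mulr_sumr [RHS](bigID (mem E0)) /= [X in _ + X]big1 ?addr0; last first.
    by move=> e eE; rewrite sx // expr0n mulr0.
  by apply: eq_bigr => e eE; rewrite -(xE' e eE); ring.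
have -> : eps^-1 * (eps ^+ 2 * \sum_e x e ^+ 2) = eps * \sum_e x e ^+ 2.
  by field; rewrite gt_eqF.
have bx : \sum_e (b e)%:~R * x e = \sum_z vec x z ^+ 2 + eps * \sum_e x e ^+ 2.
  under [X in _ = X + _]eq_bigr do rewrite expr2.
  rewrite sum_vec mulr_sumr -big_split /=; apply: eq_bigr => e _.
  have [eE|eE] := boolP (e \in E0); first by rewrite -xE' //; ring.
  by rewrite sx // expr0n /= !mulr0 mul0r addr0.
by have := h x sx; rewrite bx; lra.
Qed.

End Potential.

Lemma card_bigcup_le (I T : finType) (S : {set I}) (F : I -> {set T}) k :
  (forall i, i \in S -> (#|F i| <= k)%N) -> (#|\bigcup_(i in S) F i| <= #|S| * k)%N.
Proof.
move=> hF; rewrite -sum_nat_const.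
elim/big_rec2: _ => [|i y1 y2 iS h]; first by rewrite cards0.
by apply: leq_trans (leq_card_setU _ _) _; apply: leq_add; rewrite ?hF.
Qed.

Section Rearrangement.
Variables (R : realType) (V X : finType) (a c : V -> X) (x0 : X).
Variables (f : X -> R) (s : seq X).
Local Notation v := (fun k => f (nth x0 s k)).
Hypothesis vmono : forall i j, (i <= j < size s)%N -> v j <= v i.

Lemma sumsq_le_sqsum (I : Type) (r : seq I) (P : pred I) (g : I -> R) :
  (forall i, P i -> 0 <= g i) ->
  \sum_(i <- r | P i) g i ^+ 2 <= (\sum_(i <- r | P i) g i) ^+ 2.
Proof.
move=> g0; suff [] : 0 <= \sum_(i <- r | P i) g i /\
  \sum_(i <- r | P i) g i ^+ 2 <= (\sum_(i <- r | P i) g i) ^+ 2 by [].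
elim/big_rec2: _ => [|i y z Pi [z0 h]]; first by rewrite expr0n.
have gi := g0 i Pi; split; first exact: addr_ge0.
by nra.
Qed.

(** The gaps are nonnegative, so the sum of their squares is at most the square of their sum, which
    telescopes. *)
Lemma crossed_gaps_le (m n N : nat) : (m <= n < size s)%N -> (N <= size s)%N ->
  \sum_(0 <= k < N | (m < k <= n)%N) (v k.-1 - v k) ^+ 2 <= (v m - v n) ^+ 2.
Proof.
move=> /andP [mn ns] Ns.
have g0 k : (m < k <= n)%N -> 0 <= v k.-1 - v k.
  by move=> hk; rewrite subr_ge0; apply: vmono; lia.
apply: le_trans (@sumsq_le_sqsum _ _ _ (fun k => v k.-1 - v k) g0) _.
have tel : v m - v n = \sum_(0 <= k < size s | (m < k <= n)%N) (v k.-1 - v k).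
  have -> : \sum_(0 <= k < size s | (m < k <= n)%N) (v k.-1 - v k)
     = \sum_(m.+1 <= k < n.+1) (v k.-1 - v k).
    rewrite [RHS](big_nat_widenl _ 0) // [RHS](big_nat_widen _ _ (size s)) //.
  rewrite big_add1 /= -[LHS]opprB -(telescope_sumr v mn) -sumrN.
  by apply: eq_bigr => i _; rewrite opprB.
have le1 : 0 <= \sum_(0 <= k < N | (m < k <= n)%N) (v k.-1 - v k).
  exact: sumr_ge0.
rewrite ler_sqr ?nnegrE //; last by rewrite subr_ge0; apply: vmono; lia.
rewrite tel [leRHS](big_cat_nat _ (n := N)) //= lerDl; exact: sumr_ge0.
Qed.

(* Discrete Polya-Szego inequality: every gap between consecutive sorted values is crossed by an edge. *)
Lemma rearrangement (E : {set V}) (dl : V -> R) (j N : nat) :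
  (N <= size s)%N ->
  (forall e, e \in E -> [/\ a e \in s, c e \in s
      & `|f (a e) - f (c e)| <= `|dl e|]) ->
  (forall k, (j < k < N)%N ->
    exists2 e, e \in E & (index (a e) s < k)%N != (index (c e) s < k)%N) ->
  \sum_(j.+1 <= k < N) (v k.-1 - v k) ^+ 2 <= \sum_(e in E) dl e ^+ 2.
Proof.
move=> Ns hE hk.
pose cr e k := (index (a e) s < k)%N != (index (c e) s < k)%N.
have h1 : \sum_(j.+1 <= k < N) (v k.-1 - v k) ^+ 2
  <= \sum_(j.+1 <= k < N) \sum_(e in E | cr e k) (v k.-1 - v k) ^+ 2.
  rewrite big_nat_cond [leRHS]big_nat_cond; apply: ler_sum => k; rewrite andbT => /hk [e eE ce].
  rewrite (bigD1 e) /=; last by rewrite eE.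
  by rewrite lerDl sumr_ge0 // => i _; exact: sqr_ge0.
apply: le_trans h1 _.
under eq_bigr do rewrite big_mkcondr /=.
(* The gaps crossed by one edge form an interval, between the positions of its two ends. *)
rewrite exchange_big /=; apply: ler_sum => e eE.
have [ia ic le] := hE e eE.
apply: (@le_trans _ _ (\sum_(0 <= k < N | cr e k) (v k.-1 - v k) ^+ 2)).
  rewrite [leRHS]big_mkcond /= (big_nat_widenl j.+1 0) //.
  rewrite [leRHS](bigID (fun k => (j < k)%N)) /= lerDl.
  by apply: sumr_ge0 => k _; case: ifP => // _; exact: sqr_ge0.
rewrite -[leRHS]real_normK ?num_real //.
rewrite -index_mem in ia; rewrite -index_mem in ic.
have va : f (a e) = v (index (a e) s) by rewrite nth_index // -index_mem.
have vc : f (c e) = v (index (c e) s) by rewrite nth_index // -index_mem.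
case: (leqP (index (a e) s) (index (c e) s)) => hac.
  rewrite (eq_bigl (fun k => (index (a e) s < k <= index (c e) s)%N)); last first.
    by rewrite /cr => k; lia.
  apply: le_trans (crossed_gaps_le _ Ns) _; first by rewrite hac.
  rewrite -[leLHS]real_normK ?num_real //.
  by rewrite ler_sqr ?nnegrE // -va -vc.
rewrite (eq_bigl (fun k => (index (c e) s < k <= index (a e) s)%N)); last first.
  by rewrite /cr => k; lia.
apply: le_trans (crossed_gaps_le _ Ns) _; first by rewrite ltnW.
rewrite -[leLHS]real_normK ?num_real //.
by rewrite ler_sqr ?nnegrE // -va -vc distrC.
Qed.

End Rearrangement.

Section SortedSet.
Variables (R : realType) (X : finType) (f : X -> R) (X0 : {set X}).

Definition desc_enum : seq X := sort (fun x y => f y <= f x) (enum X0).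

Lemma size_desc_enum : size desc_enum = #|X0|.
Proof. by rewrite size_sort cardE. Qed.

Lemma mem_desc_enum x : (x \in desc_enum) = (x \in X0).
Proof. by rewrite mem_sort mem_enum. Qed.

Lemma uniq_desc_enum : uniq desc_enum.
Proof. by rewrite sort_uniq enum_uniq. Qed.

Lemma desc_enum_mono x0 i j : (i <= j < size desc_enum)%N ->
  f (nth x0 desc_enum j) <= f (nth x0 desc_enum i).
Proof.
move=> /andP [ij js].
have tr : transitive (fun x y => f y <= f x) by move=> y x z h1 h2; exact: le_trans h2 h1.
have tot : total (fun x y => f y <= f x) by move=> x y; exact: le_total.
have := sort_sorted tot (enum X0).
rewrite (sorted_pairwise tr) => /(pairwiseP x0) h.
case: ltngtP ij => // [ij _|-> _]; last exact: lexx.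
by apply: h => //; rewrite inE //; apply: ltn_trans js.
Qed.

Lemma sum_desc_enum x0 (F : X -> R) :
  \sum_(x in X0) F x = \sum_(0 <= k < #|X0|) F (nth x0 desc_enum k).
Proof.
rewrite -big_enum (perm_big desc_enum) /=; last by rewrite perm_sym perm_sort.
by rewrite (big_nth x0) size_desc_enum.
Qed.

Lemma desc_enum_prefix x0 k x : x \in X0 -> (k <= index x desc_enum)%N ->
  forall i, (i <= k)%N -> f x <= f (nth x0 desc_enum i).
Proof.
rewrite -mem_desc_enum => xs kx i ik.
rewrite -{1}(nth_index x0 xs); apply: desc_enum_mono.
by rewrite index_mem xs andbT; lia.
Qed.

Definition level k : {set X} := [set x in X0 | (index x desc_enum < k)%N].

Lemma card_level k : (k <= #|X0|)%N -> #|level k| = k.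
Proof.
move=> kX; have -> : level k = [set x in take k desc_enum].
  apply/setP => x; rewrite !inE -mem_desc_enum.
  apply/andP/idP => [[xs xk]|xt].
    by rewrite in_take.
  by have xs := mem_take xt; rewrite xs; split=> //; rewrite -in_take.
rewrite cardsE (card_uniqP _) ?take_uniq ?uniq_desc_enum //.
by rewrite size_take size_desc_enum; case: ltngtP kX.
Qed.

End SortedSet.

(** * Energy of a potential along a path *)

Section PathConstants.
Variables (R : realType) (t : R).
Hypotheses (t1 : 1 < t) (tu : t ^+ 6 < t ^+ 2 + 1).
Local Notation lam := (t + t^-1).
Local Notation eps := (t + t^-1 - 2).
Local Notation g := (t / (t - 1)).

(** The supremum of the admissible [t] is the square root 1.15096... of the cubic root 1.3247...;
    828/625 lies just below the square of 1.151. *)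
Lemma t_lt : t < 1151 / 1000.
Proof.
have p1 := t1; have pu := tu.
rewrite ltNge; apply/negP => h.
have h2 : 828 / 625 <= t ^+ 2 by nra.
have := tu; have -> : t ^+ 6 = t ^+ 2 * (t ^+ 2 * t ^+ 2) by ring.
move: (t ^+ 2) h2 => u h2 hu.
have h3 : 0 <= (u - 828 / 625) ^+ 2 by exact: sqr_ge0.
rewrite expr2 in h3.
have h4 : 351 / 200 <= u * u by lra.
have : 0 <= (u - 828 / 625) * (u * u - 351 / 200).
  by rewrite mulr_ge0 // subr_ge0.
by move: (u * u) h4 hu => w h4 hu; lra.
Qed.

Lemma epsE : eps = (t - 1) ^+ 2 / t.
Proof. have p1 := t1; by field; rewrite gt_eqF //; lra. Qed.

Lemma eps_gt0 : 0 < eps.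
Proof. have p1 := t1; by rewrite epsE divr_gt0 // ?exprn_gt0; lra. Qed.

Lemma eps_lt : eps < 199 / (100 * 100).
Proof.
have p1 := t1.
have h := t_lt; rewrite epsE ltr_pdivrMr; last by lra.
by nra.
Qed.

Lemma g_gt : 762 / 100 < g.
Proof.
have p1 := t1.
have h := t_lt; rewrite ltr_pdivlMr; last by lra.
by lra.
Qed.

(** The difference is a square that vanishes for [x = t * y]: the cheapest infinite tail is
    geometric with ratio 1/t, and [g * x ^+ 2] is its energy when it starts at [x]. *)
Lemma tail_step (x y : R) : g * (x ^+ 2 - y ^+ 2) <= x ^+ 2 + eps^-1 * (x - y) ^+ 2.
Proof.
have p1 := t1; have pu := tu.
have e1 : t != 0 by rewrite gt_eqF //; lra.
have e2 : t - 1 != 0 by rewrite gt_eqF //; lra.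
rewrite -subr_ge0.
have -> : x ^+ 2 + eps^-1 * (x - y) ^+ 2 - g * (x ^+ 2 - y ^+ 2)
  = ((x - t * y) / (t - 1)) ^+ 2.
  by rewrite epsE; field; rewrite e1 e2.
exact: sqr_ge0.
Qed.

Lemma tail_sum (v : nat -> R) (k n : nat) : (k <= n)%N ->
  g * (v k ^+ 2 - v n ^+ 2)
  <= \sum_(k <= i < n) v i ^+ 2 + eps^-1 * \sum_(k.+1 <= i < n.+1) (v i.-1 - v i) ^+ 2.
Proof.
have p1 := t1; have pu := tu.
move=> kn; rewrite big_add1 /= mulr_sumr -big_split /=.
have -> : v k ^+ 2 - v n ^+ 2 = \sum_(k <= i < n) (v i ^+ 2 - v i.+1 ^+ 2).
  rewrite -[LHS]opprB -(telescope_sumr (fun k => v k ^+ 2) kn) -sumrN.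
  by apply: eq_bigr => i _; rewrite opprB.
rewrite mulr_sumr; apply: ler_sum => i _; exact: tail_step.
Qed.

(** The series law: conductances [al] and [be] in series have resistance [al^-1 + be^-1]. *)
Lemma cauchy2 (al be x y : R) : 0 < al -> 0 < be ->
  (x + y) ^+ 2 / (al^-1 + be^-1) <= al * x ^+ 2 + be * y ^+ 2.
Proof.
move=> a0 b0; have s0 : 0 < al + be by apply: addr_gt0.
rewrite -subr_ge0.
have -> : al * x ^+ 2 + be * y ^+ 2 - (x + y) ^+ 2 / (al^-1 + be^-1)
  = (al * x - be * y) ^+ 2 / (al + be).
  by field; rewrite !gt_eqF //; nra.
by rewrite divr_ge0 ?sqr_ge0 // ltW.
Qed.

Let mD := (1 - lam^-1 - (t + 1)^-1) / eps.

(** Two parallel edges of a digon ask for [x = y] and [x + y = 1], which only halves satisfy. The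
    products [x * y] of the two squares cancel, so [x] and [y] are minimised separately, at [lam^-1]
    and [(t + 1)^-1]. *)
Lemma digon_end (x y : R) :
  mD <= x ^+ 2 + eps^-1 * ((x - y) ^+ 2 + (1 - x - y) ^+ 2) + g * y ^+ 2.
Proof.
have p1 := t1.
have e1 : t != 0 by rewrite gt_eqF //; lra.
have e2 : t - 1 != 0 by rewrite gt_eqF //; lra.
have e3 : t + 1 != 0 by rewrite gt_eqF //; lra.
have e4 : t * t + 1 != 0 by rewrite gt_eqF //; nra.
have e0 := eps_gt0.
rewrite -subr_ge0.
have -> : x ^+ 2 + eps^-1 * ((x - y) ^+ 2 + (1 - x - y) ^+ 2) + g * y ^+ 2 - mD
  = (1 + 2 * eps^-1) * (x - lam^-1) ^+ 2 + (2 * eps^-1 + g) * (y - (t + 1)^-1) ^+ 2.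
  by rewrite /mD epsE; field; rewrite e1 e2 e3 e4.
have g0 := g_gt.
have ei : 0 < eps^-1 by rewrite invr_gt0.
by apply: addr_ge0; apply: mulr_ge0; rewrite ?sqr_ge0 //; lra.
Qed.

(** The difference is a positive multiple of [t ^+ 2 + 1 - t ^+ 6]; this is one of the two sources
    of the condition on [t]. *)
Lemma digon_end_gt : lam < mD.
Proof.
have p1 := t1; have pu := tu.
have e1 : t != 0 by rewrite gt_eqF //; lra.
have e4 : t * t + 1 != 0 by rewrite gt_eqF //; nra.
have e3 : t + 1 != 0 by rewrite gt_eqF //; lra.
rewrite /mD ltr_pdivlMr ?eps_gt0 // -subr_gt0.
have -> : 1 - lam^-1 - (t + 1)^-1 - lam * eps
  = (t - 1) * (t ^+ 2 + 1 - t ^+ 6) / (t ^+ 2 * (t * t + 1) * (t + 1)).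
  by rewrite epsE; field; rewrite e1 e3 e4.
by rewrite divr_gt0 // !mulr_gt0 ?exprn_gt0 //; try lra; nra.
Qed.

(** Effective conductances of a ladder: [C2] is what remains at [1 - y] after eliminating [x], [C3]
    what remains at [1 - z] after eliminating [y] as well. *)
Let C2 := 1 + (1 + eps)^-1.
Let C3 := 1 + (C2^-1 + eps)^-1.
Let m3 := (C3^-1 + (g - 1)^-1)^-1.

(** One use of [cauchy2] per variable. The tail at [z] has the coefficient [g - 1] because the third
    vertex pays [(1 - z) ^+ 2] in place of [z ^+ 2]. *)
Lemma three_end (x y z : R) :
  m3 <= (1 - x) ^+ 2 + (1 - y) ^+ 2 + (1 - z) ^+ 2
      + eps^-1 * ((x - y) ^+ 2 + (y - z) ^+ 2) + (g - 1) * z ^+ 2.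
Proof.
have p1 := t1.
have e0 := eps_gt0.
have ei : 0 < eps^-1 by rewrite invr_gt0.
have g0 := g_gt.
have C20 : 0 < C2.
  have : 0 < (1 + eps)^-1 by rewrite invr_gt0; lra.
  by rewrite /C2; lra.
have C2i : 0 < C2^-1 by rewrite invr_gt0.
have C30 : 0 < C3.
  have : 0 < (C2^-1 + eps)^-1 by rewrite invr_gt0; lra.
  by rewrite /C3; lra.
have h1 : (1 - y) ^+ 2 * (1 + eps)^-1 <= (1 - x) ^+ 2 + eps^-1 * (x - y) ^+ 2.
  have := @cauchy2 1 eps^-1 (1 - x) (x - y) ltr01 ei.
  by rewrite invr1 invrK mul1r addrA subrK.
have h2 : (1 - z) ^+ 2 * (C2^-1 + eps)^-1 <= C2 * (1 - y) ^+ 2 + eps^-1 * (y - z) ^+ 2.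
  by have := cauchy2 (1 - y) (y - z) C20 ei; rewrite invrK addrA subrK.
have h3 : m3 <= C3 * (1 - z) ^+ 2 + (g - 1) * z ^+ 2.
  have := @cauchy2 C3 (g - 1) (1 - z) z C30.
  by rewrite subrK expr1n mul1r; apply; lra.
rewrite /C3 mulrDl mul1r in h3; rewrite /C2 mulrDl mul1r in h2.
by rewrite mulrDr; rewrite mulrC in h1; rewrite -/C2 mulrC in h2; lra.
Qed.

(** [m3^-1] is [lam^-1] minus a positive multiple of [t ^+ 2 + 1 - t ^+ 6]: this end and the digon
    become possible at the same [t]. *)
Lemma three_end_gt : lam < m3.
Proof.
have p1 := t1; have pu := tu.
have e1 : t != 0 by rewrite gt_eqF //; lra.
have e2 : t - 1 != 0 by rewrite gt_eqF //; lra.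
have l2 : 2 < lam by have := eps_gt0; lra.
have E2 : C2 = lam / (lam - 1).
  by rewrite /C2; move: lam l2 => l l2; field; rewrite !gt_eqF //; lra.
have E3 : C3 = (lam ^+ 2 - 1) / (lam ^+ 2 - lam - 1).
  rewrite /C3 E2; move: lam l2 => l l2; field.
  by rewrite !gt_eqF //; nra.
have Eg : g - 1 = (t - 1)^-1 by field.
have h4 : 0 < t ^+ 2 + 1 by nra.
have h6 : 0 < t ^+ 4 + t ^+ 2 + 1 by rewrite !addr_gt0 // exprn_gt0 //; lra.
have E : C3^-1 + (g - 1)^-1 = lam^-1 -
   (t ^+ 2 + 1 - t ^+ 6) * t / ((t ^+ 2 + 1) * (t ^+ 4 + t ^+ 2 + 1)).
  have -> : C3^-1 + (g - 1)^-1 = t - lam / (lam ^+ 2 - 1).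
    rewrite E3 Eg; move: lam l2 => l l2; field.
    by rewrite !gt_eqF //; nra.
  have -> : lam = (t ^+ 2 + 1) / t by field.
  have -> : ((t ^+ 2 + 1) / t) ^+ 2 - 1 = (t ^+ 4 + t ^+ 2 + 1) / t ^+ 2 by field.
  by field; rewrite e1 !gt_eqF.
have C30 : 0 < C3 by rewrite E3 divr_gt0 //; move: lam l2 => l l2; nra.
have s0 : 0 < C3^-1 + (g - 1)^-1.
  by rewrite addr_gt0 ?invr_gt0 // Eg invr_gt0; lra.
rewrite /m3 -[lam]invrK ltf_pV2 ?posrE ?invr_gt0 //; last by lra.
rewrite E ltrBlDr ltrDl divr_gt0 ?mulr_gt0 //; lra.
Qed.

End PathConstants.

(* [n] is so large that the [n]-th largest value of a potential of energy at most [t + t^-1] is negligible. *)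
Definition large_order (R : realType) (t : R) (n : nat) : Prop :=
  exists2 eta : R, t / (t - 1) * (t + t^-1) <= eta * (n - 39)%:R
  & [/\ (40 < n)%N, 0 < eta <= 1 / 100,
        forall x y : R, t + t^-1 + eta < x ^+ 2
           + (t + t^-1 - 2)^-1 * ((x - y) ^+ 2 + (1 - x - y) ^+ 2) + t / (t - 1) * y ^+ 2
      & forall x y z : R, t + t^-1 + eta < (1 - x) ^+ 2 + (1 - y) ^+ 2 + (1 - z) ^+ 2
           + (t + t^-1 - 2)^-1 * ((x - y) ^+ 2 + (y - z) ^+ 2) + (t / (t - 1) - 1) * z ^+ 2].

Lemma large_order_exists (R : realType) (t : R) : 1 < t -> t ^+ 6 < t ^+ 2 + 1 ->
  exists n, large_order t n.
Proof.
move=> t1 tu.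
have [mD hD hD'] : exists2 m : R, t + t^-1 < m & forall x y, m <= x ^+ 2
    + (t + t^-1 - 2)^-1 * ((x - y) ^+ 2 + (1 - x - y) ^+ 2) + t / (t - 1) * y ^+ 2.
  by eexists; [exact: digon_end_gt|exact: digon_end].
have [m3 h3 h3'] : exists2 m : R, t + t^-1 < m & forall x y z, m <=
    (1 - x) ^+ 2 + (1 - y) ^+ 2 + (1 - z) ^+ 2
    + (t + t^-1 - 2)^-1 * ((x - y) ^+ 2 + (y - z) ^+ 2) + (t / (t - 1) - 1) * z ^+ 2.
  by eexists; [exact: three_end_gt|exact: three_end].
pose eta := Num.min (1 / 100) (Num.min ((mD - (t + t^-1)) / 2) ((m3 - (t + t^-1)) / 2)).
have eta0 : 0 < eta by rewrite /eta !lt_min; apply/and3P; split; lra.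
have etaD : t + t^-1 + eta < mD.
  have : eta <= (mD - (t + t^-1)) / 2 by rewrite /eta !ge_min lexx /= orbT.
  by lra.
have eta3 : t + t^-1 + eta < m3.
  have : eta <= (m3 - (t + t^-1)) / 2 by rewrite /eta !ge_min lexx /= !orbT.
  by lra.
have eta1 : eta <= 1 / 100 by rewrite /eta !ge_min lexx.
exists (Num.bound (t / (t - 1) * (t + t^-1) / eta) + 41)%N; exists eta; last first.
  split=> //; first by lia.
  - by rewrite eta0 eta1.
  - by move=> x y; apply: lt_le_trans (hD' x y).
  - by move=> x y z; apply: lt_le_trans (h3' x y z).
rewrite [eta * _]mulrC -ler_pdivrMr //.
have p0 : 0 <= t / (t - 1) * (t + t^-1) / eta.
  by apply: divr_ge0; [apply: mulr_ge0; [apply: divr_ge0|apply: addr_ge0]|];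
    rewrite ?invr_ge0; lra.
apply: ltW; apply: (lt_le_trans (archi_boundP p0)).
by rewrite ler_nat; lia.
Qed.

Section Sequences.
Variables (R : realType) (t : R) (n : nat).
Local Notation lam := (t + t^-1).
Local Notation eps := (t + t^-1 - 2).
Local Notation g := (t / (t - 1)).
Hypotheses (t1 : 1 < t) (tu : t ^+ 6 < t ^+ 2 + 1).
Variable v : nat -> R.
Hypotheses (v0 : forall k, (k <= n)%N -> 0 <= v k)
  (vmono : forall i j, (i <= j <= n)%N -> v j <= v i).

(** At least [n - 39] terms of the sum are no smaller than [v n ^+ 2]. The 39 leaves room for the
    initial terms that are set aside, at most 33 in [three_contra]. *)
Lemma last_small eta m : g * lam <= eta * (n - 39)%:R -> 0 < eta -> (40 < n)%N ->
  (m <= 39)%N -> \sum_(m <= k < n) v k ^+ 2 <= lam -> g * v n ^+ 2 <= eta.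
Proof.
move=> hg e0 n40 m39 hs.
have t1' := t1; have gp : 0 < g by apply: divr_gt0; lra.
have h : (n - 39)%:R * v n ^+ 2 <= lam.
  apply: le_trans hs.
  apply: (@le_trans _ _ (\sum_(m <= k < n) v n ^+ 2)).
    rewrite sumr_const_nat -[leRHS]mulr_natl ler_wpM2r ?sqr_ge0 // ler_nat; lia.
  rewrite big_nat_cond [leRHS]big_nat_cond; apply: ler_sum => k hk.
  have kn : (k <= n)%N by lia.
  by rewrite ler_sqr ?nnegrE ?v0 // vmono // kn leqnn.
have n0 : 0 < (n - 39)%:R :> R by rewrite ltr0n; lia.
have h' : g * ((n - 39)%:R * v n ^+ 2) <= g * lam by rewrite ler_pM2l.
rewrite -(ler_pM2r n0); apply: le_trans hg; apply: le_trans h'.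
by rewrite le_eqVlt; apply/orP; left; apply/eqP; ring.
Qed.

Lemma top_bound eta m : g * lam <= eta * (n - 39)%:R -> 0 < eta -> (40 < n)%N ->
  (m <= 39)%N -> \sum_(m <= k < n) v k ^+ 2 <= lam ->
  g * v m ^+ 2 <= \sum_(m <= k < n) v k ^+ 2
     + eps^-1 * \sum_(m.+1 <= k < n.+1) (v k.-1 - v k) ^+ 2 + eta.
Proof.
move=> hg e0 n40 m39 hs.
have := last_small hg e0 n40 m39 hs.
have := @tail_sum R t t1 tu v m n; rewrite mulrBr => /(_ ltac:(lia)); lra.
Qed.

Lemma digon_contra : large_order t n ->
  \sum_(0 <= k < n) v k ^+ 2 + eps^-1 * (\sum_(1 <= k < n.+1) (v k.-1 - v k) ^+ 2
     + (1 - v 0%N - v 1%N) ^+ 2) <= lam -> False.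
Proof.
move=> [eta hg [n40 /andP [e0 e1] hD _]] hE.
have ei : 0 < eps^-1 by rewrite invr_gt0 eps_gt0.
have s0 : 0 <= \sum_(1 <= k < n.+1) (v k.-1 - v k) ^+ 2.
  by apply: sumr_ge0 => k _; exact: sqr_ge0.
have hs0 : \sum_(0 <= k < n) v k ^+ 2 <= lam.
  apply: le_trans hE; rewrite lerDl; apply: mulr_ge0; first exact: ltW.
  by rewrite addr_ge0 // sqr_ge0.
move: hE; rewrite big_ltn; last by lia.
rewrite [\sum_(1 <= k < n.+1) _]big_ltn /=; last by lia.
move=> hE.
have hs : \sum_(1 <= k < n) v k ^+ 2 <= lam.
  by apply: le_trans hs0; rewrite [leRHS]big_ltn ?lerDr ?sqr_ge0 //; lia.
have := top_bound (m := 1%N) hg e0 n40 isT hs.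
have := hD (v 0%N) (v 1%N).
move: hE; rewrite !mulrDr; lra.
Qed.

Lemma three_contra j : large_order t n -> (j <= 30)%N ->
  \sum_(j <= k < j.+3) (1 - v k) ^+ 2 + \sum_(j.+3 <= k < n) v k ^+ 2
   + eps^-1 * \sum_(j.+1 <= k < n.+1) (v k.-1 - v k) ^+ 2 <= lam -> False.
Proof.
move=> [eta hg [n40 /andP [e0 e1] _ h3]] j30.
have ei : 0 < eps^-1 by rewrite invr_gt0 eps_gt0.
have -> : \sum_(j <= k < j.+3) (1 - v k) ^+ 2
  = (1 - v j) ^+ 2 + (1 - v j.+1) ^+ 2 + (1 - v j.+2) ^+ 2.
  rewrite big_nat_recr /=; last by lia.
  rewrite big_nat_recr /=; last by lia.
  by rewrite big_nat1.
have s0 : 0 <= \sum_(j.+1 <= k < n.+1) (v k.-1 - v k) ^+ 2.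
  by apply: sumr_ge0 => k _; exact: sqr_ge0.
move=> hE.
have hs : \sum_(j.+3 <= k < n) v k ^+ 2 <= lam.
  apply: le_trans hE; rewrite -addrA [leRHS]addrCA lerDl addr_ge0 //.
    by rewrite !addr_ge0 ?sqr_ge0.
  by rewrite mulr_ge0 // ltW.
move: hE; rewrite (@big_ltn _ _ _ j.+1) /=; last by lia.
rewrite (@big_ltn _ _ _ j.+2) /=; last by lia.
move=> hE.
have := last_small hg e0 n40 _ hs; rewrite (_ : (j.+3 <= 39)%N); last by lia.
move=> /(_ isT) hl.
have := @tail_sum R t t1 tu v j.+2 n; rewrite mulrBr => /(_ ltac:(lia)).
rewrite big_ltn; last by lia.
have := h3 (v j) (v j.+1) (v j.+2).
rewrite mulrBl mul1r !mulrDr.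
move: hE; rewrite !mulrDr; lra.
Qed.

End Sequences.

(** * Rounding a potential *)

Definition pm1 (z : int) := (z == 1) || (z == -1).

(** Only small sets need an edge leaving them, because just the first gaps of a sorted potential are
    used. This also holds for unions of clusters, which need not be connected. *)
Definition open_in (V X : finType) (a c : V -> X) (X0 : {set X}) (E0 : {set V})
    (N : nat) : Prop :=
  (forall e, e \in E0 -> (a e \in X0) && (c e \in X0)) /\
  (forall Y : {set X}, Y \subset X0 -> Y != set0 -> (#|Y| < N)%N ->
     exists2 e, e \in E0 & (a e \in Y) != (c e \in Y)).

Lemma int_cases (z : int) : [|| z <= -2, z == -1, z == 0, z == 1 | 2 <= z].
Proof. lia. Qed.

Lemma int_small (z : int) : -1 <= z <= 1 -> z = -1 \/ z = 0 \/ z = 1.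
Proof. lia. Qed.

Lemma large_sqr (R : realType) (x : R) :
  129 / 100 <= x -> x ^+ 2 < 148 / 100 -> False.
Proof. by move=> h1 h2; nra. Qed.

Lemma exists_subset (T : finType) (A : {set T}) k : (k <= #|A|)%N ->
  exists2 B : {set T}, B \subset A & #|B| = k.
Proof.
move=> kA; exists [set x in take k (enum A)].
  by apply/subsetP => x; rewrite inE => /mem_take; rewrite mem_enum.
rewrite cardsE (card_uniqP _) ?take_uniq ?enum_uniq // size_take -cardE.
by case: ltngtP kA.
Qed.

Section Rounding.
Variables (R : realType) (V X : finType) (a c : V -> X) (al ga : V -> int).
Variables (t : R) (n : nat) (X0 : {set X}) (E0 : {set V}) (b : V -> int) (p : X -> R).
Hypotheses (t1 : 1 < t) (tu : t ^+ 6 < t ^+ 2 + 1) (hn : large_order t n).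
Hypothesis edges : forall e, e \in E0 -> [&& a e != c e, pm1 (al e) & pm1 (ga e)].
Hypothesis hopen : open_in a c X0 E0 n.+1.
Local Notation lam := (t + t^-1).
Local Notation eps := (t + t^-1 - 2).
Local Notation g := (t / (t - 1)).

Definition defect e : R :=
  (b e)%:~R - ((al e)%:~R * p (a e) + (ga e)%:~R * p (c e)).
Hypothesis energy :
  \sum_z p z ^+ 2 + eps^-1 * (\sum_(e in E0) defect e ^+ 2) <= lam.

Definition rnd x : int := Num.floor (p x + 2^-1).
Definition res x : R := p x - (rnd x)%:~R.
Definition dist x : R := `|res x|.
Definition gap e : int := b e - (al e * rnd (a e) + ga e * rnd (c e)).

Lemma res_itv x : - (1 / 2) <= res x <= 1 / 2.
Proof.
have /andP [h1 h2] := floor_itv (p x + 2^-1); rewrite -/(rnd x) rmorphD /= in h1 h2.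
by rewrite /res; lra.
Qed.

Lemma dist_itv x : 0 <= dist x <= 1 / 2.
Proof. by rewrite normr_ge0 ler_norml res_itv. Qed.

Lemma dist_le x : dist x <= `|p x|.
Proof.
have := res_itv x; rewrite /dist /res.
have [->|h] := eqVneq (rnd x) 0; first by rewrite subr0.
have : (rnd x <= -1) || (1 <= rnd x) by move: h; lia.
case/orP; rewrite -(ler_int R) => h' /andP [h1 h2]; rewrite ler_norml;
 [rewrite ler0_norm; lra|rewrite ger0_norm; lra].
Qed.

Lemma defectE e : defect e = (gap e)%:~R - ((al e)%:~R * res (a e) + (ga e)%:~R * res (c e)).
Proof. by rewrite /defect /gap /res rmorphB rmorphD !rmorphM /=; ring. Qed.

Lemma eps_inv : 50 < eps^-1.
Proof.
have h := eps_lt t1 tu; have h0 := eps_gt0 t1.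
have -> : 50 = (50^-1)^-1 :> R by rewrite invrK.
by rewrite ltf_pV2 ?posrE; lra.
Qed.

Lemma sump_ge0 : 0 <= \sum_z p z ^+ 2.
Proof. by apply: sumr_ge0 => z _; exact: sqr_ge0. Qed.

Lemma lam_lt : lam < 202 / 100.
Proof. have := eps_lt t1 tu; lra. Qed.

(** Even if one edge takes all the energy, [defect e ^+ 2 <= lam * eps], which is below 2.02 / 50
    and hence below the square of 0.21. *)
Lemma defect_le e : e \in E0 -> `|defect e| <= 21 / 100.
Proof.
move=> eE; rewrite -ler_sqr ?nnegrE ?normr_ge0 ?divr_ge0 //.
rewrite real_normK ?num_real //.
have : defect e ^+ 2 <= \sum_(e in E0) defect e ^+ 2.
  by rewrite (bigD1 e) //= lerDl; apply: sumr_ge0 => i _; exact: sqr_ge0.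
have := energy; have := sump_ge0; have := eps_inv; have := lam_lt.
move: (\sum_z _) (\sum_(e in E0) _) (eps^-1) => S1 S2 i h1 h2 h3 h4 h5.
have h6 : 50 * defect e ^+ 2 <= i * S2.
  by have := sqr_ge0 (defect e); nra.
have -> : (21 / 100) ^+ 2 = 441 / (100 * 100) :> R by field.
by lra.
Qed.

Lemma pm1P (z : int) : pm1 z -> z = 1 \/ z = -1.
Proof. by case/orP => /eqP ->; [left|right]. Qed.

(** The two signed residues are at most 1/2 and must add up to within 0.21 of a nonzero integer. So
    this integer is 1 or -1, and each residue is at least 1/2 - 0.21 = 0.29 in size. *)
Lemma bad_edge e : e \in E0 -> gap e != 0 ->
  (gap e = 1 /\ 29 / 100 <= (al e)%:~R * res (a e)
      /\ 29 / 100 <= (ga e)%:~R * res (c e)) \/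
  (gap e = -1 /\ (al e)%:~R * res (a e) <= - (29 / 100)
      /\ (ga e)%:~R * res (c e) <= - (29 / 100)).
Proof.
move=> eE g0; have := defect_le eE; rewrite ler_norml defectE.
have /and3P [_ /pm1P ala /pm1P gaa] := edges eE.
have ha := res_itv (a e); have hc := res_itv (c e).
have h1 : - (1 / 2) <= (al e)%:~R * res (a e) <= 1 / 2.
  by case: ala => ->; rewrite ?rmorphN ?mulN1r ?mul1r //; lra.
have h2 : - (1 / 2) <= (ga e)%:~R * res (c e) <= 1 / 2.
  by case: gaa => ->; rewrite ?rmorphN ?mulN1r ?mul1r //; lra.
clear ala gaa; move: (_ * res (a e)) (_ * res (c e)) h1 h2 => u w h1 h2 h3.
have := int_cases (gap e); rewrite (negPf g0) /=; case/or4P.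
- by rewrite -(ler_int R) (_ : (-2)%:~R = - 2) // => h; exfalso; lra.
- by move=> /eqP E; right; move: h3; rewrite E rmorphN /=; split=> //; split; lra.
- by move=> /eqP E; left; move: h3; rewrite E /=; split=> //; split; lra.
- by rewrite -(ler_int R) (_ : 2%:~R = 2) // => h; exfalso; lra.
Qed.

Lemma bad_dist e : e \in E0 -> gap e != 0 ->
  [/\ 29 / 100 <= dist (a e), 29 / 100 <= dist (c e)
    & 1 - dist (a e) - dist (c e) <= `|defect e|].
Proof.
move=> eE g0; have := bad_edge eE g0; rewrite /dist defectE.
have /and3P [_ /pm1P ala /pm1P gaa] := edges eE.
have -> : `|res (a e)| = `|(al e)%:~R * res (a e)|.
  by case: ala => ->; rewrite ?rmorphN ?mulN1r ?normrN ?mul1r.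
have -> : `|res (c e)| = `|(ga e)%:~R * res (c e)|.
  by case: gaa => ->; rewrite ?rmorphN ?mulN1r ?normrN ?mul1r.
clear ala gaa; move: (_ * res (a e)) (_ * res (c e)) => u w.
case=> -[-> [hu hw]].
  rewrite ger0_norm; last by lra.
  rewrite (ger0_norm (x := w)); last by lra.
  split; [exact: hu|exact: hw|].
  by apply: le_trans (ler_norm _); lra.
rewrite ler0_norm; last by lra.
rewrite (ler0_norm (x := w)); last by lra.
split; [lra|lra|].
by rewrite rmorphN /= -normrN; apply: le_trans (ler_norm _); lra.
Qed.

(** This survives on bad edges: as [dist] is at most 1/2, a difference of two distances is at most 1
    minus their sum, which [bad_dist] bounds by the defect. *)
Lemma dist_lip e : e \in E0 -> `|dist (a e) - dist (c e)| <= `|defect e|.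
Proof.
move=> eE; have [g0|g0] := eqVneq (gap e) 0; last first.
  have [h1 h2 h3] := bad_dist eE g0; apply: le_trans h3.
  have /andP [h4 h5] := dist_itv (a e); have /andP [h6 h7] := dist_itv (c e).
  by clear h1 h2; rewrite ler_norml; apply/andP; split; lra.
rewrite defectE g0 sub0r normrN /dist.
have /and3P [_ /pm1P ala /pm1P gaa] := edges eE.
have -> : `|res (a e)| = `|(al e)%:~R * res (a e)|.
  by case: ala => ->; rewrite ?rmorphN ?mulN1r ?normrN ?mul1r.
have -> : `|res (c e)| = `|- ((ga e)%:~R * res (c e))|.
  by case: gaa => ->; rewrite ?rmorphN ?mulN1r ?normrN ?mul1r.
by rewrite (le_trans (ler_dist_dist _ _)) // opprK.
Qed.

Lemma card_X0 : X0 != set0 -> (n < #|X0|)%N.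
Proof.
move=> X00; rewrite ltnNge; apply/negP => hX.
have [e eE] := hopen.2 _ (subxx X0) X00 hX.
by have /andP [-> ->] := hopen.1 e eE.
Qed.

Lemma level_crossed (f : X -> R) k : X0 != set0 -> (0 < k < n.+1)%N ->
  exists2 e, e \in E0 & (a e \in level f X0 k) != (c e \in level f X0 k).
Proof.
move=> X00 /andP [k0 kn]; have hX := card_X0 X00.
have ck : #|level f X0 k| = k by apply: card_level; lia.
apply: hopen.2; rewrite ?ck //; last by rewrite -card_gt0 ck.
by apply/subsetP => x; rewrite inE => /andP [].
Qed.

Lemma mem_level (f : X -> R) k e : e \in E0 ->
  ((a e \in level f X0 k) != (c e \in level f X0 k)) =
  ((index (a e) (desc_enum f X0) < k)%N != (index (c e) (desc_enum f X0) < k)%N).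
Proof. by move=> /(hopen.1) /andP [ha hc]; rewrite !inE ha hc. Qed.

Section Sorted.
Variables (x0 : X) (f : X -> R).
Hypotheses (x0X : x0 \in X0) (f0 : forall x, 0 <= f x).
Local Notation v := (fun k => f (nth x0 (desc_enum f X0) k)).

Lemma X0_n0 : X0 != set0.
Proof. by apply/set0Pn; exists x0. Qed.

Lemma sorted_mono i j : (i <= j <= n)%N -> v j <= v i.
Proof.
move=> hij; apply: desc_enum_mono; rewrite size_desc_enum.
by have := card_X0 X0_n0; lia.
Qed.

Lemma sorted_gaps (E : {set V}) j : E \subset E0 ->
  (forall e, e \in E -> `|f (a e) - f (c e)| <= `|defect e|) ->
  (forall k, (j < k < n.+1)%N -> exists2 e, e \in E
     & (a e \in level f X0 k) != (c e \in level f X0 k)) ->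
  \sum_(j.+1 <= k < n.+1) (v k.-1 - v k) ^+ 2 <= \sum_(e in E) defect e ^+ 2.
Proof.
move=> sE lip cross; apply: (@rearrangement R V X a c x0 f).
- by move=> i k hik; exact: desc_enum_mono.
- by rewrite size_desc_enum; exact: card_X0 X0_n0.
- move=> e eE; rewrite !mem_desc_enum.
  by have /andP [-> ->] := hopen.1 e (subsetP sE e eE); split=> //; exact: lip.
- move=> k /cross [e eE h]; exists e => //.
  by rewrite -mem_level // (subsetP sE).
Qed.

Lemma sorted_sum m (F : R -> R) : (forall y, 0 <= F y) ->
  \sum_(m <= k < n) F (v k) <= \sum_(x in X0) F (f x).
Proof.
move=> F0; rewrite (sum_desc_enum f _ x0).
have hX := card_X0 X0_n0.
rewrite [leRHS](big_cat_nat _ (n := n)) //=; last by rewrite ltnW.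
apply: (@le_trans _ _ (\sum_(0 <= k < n) F (v k))); last by rewrite lerDl sumr_ge0.
case: (leqP m n) => mn; last by rewrite big_geq ?sumr_ge0 // ltnW.
by rewrite [leRHS](big_cat_nat _ (n := m)) //= lerDr sumr_ge0.
Qed.

Lemma sorted_top x : x \in X0 -> f x <= v 0%N.
Proof. by move=> xX; apply: (@desc_enum_prefix _ _ f X0 x0 0). Qed.

Lemma sorted_top2 x y : x \in X0 -> y \in X0 -> x != y -> f x + f y <= v 0%N + v 1%N.
Proof.
wlog hxy : x y / (index x (desc_enum f X0) <= index y (desc_enum f X0))%N.
  move=> h xX yX xy; case: (leqP (index x (desc_enum f X0)) (index y (desc_enum f X0))) => hh.
    exact: h.
  by rewrite addrC; apply: h; rewrite 1?ltnW // eq_sym.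
move=> xX yX xy; apply: lerD; first exact: sorted_top.
apply: (@desc_enum_prefix _ _ f X0 x0 1) => //.
case: (posnP (index y (desc_enum f X0))) => // y0.
have xi : index x (desc_enum f X0) = 0%N by lia.
case/negP: xy; apply/eqP.
have e1 : nth x0 (desc_enum f X0) (index x (desc_enum f X0)) = x.
  by rewrite nth_index // mem_desc_enum.
have e2 : nth x0 (desc_enum f X0) (index y (desc_enum f X0)) = y.
  by rewrite nth_index // mem_desc_enum.
by rewrite -e1 -e2 xi y0.
Qed.

End Sorted.

Lemma sum_X0_le (F : X -> R) : (forall x, F x <= p x ^+ 2) ->
  \sum_(x in X0) F x <= \sum_z p z ^+ 2.
Proof.
move=> h; rewrite [leRHS](bigID (mem X0)) /=.
rewrite -[leLHS]addr0; apply: lerD; first exact: ler_sum.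
by apply: sumr_ge0 => z _; exact: sqr_ge0.
Qed.

Lemma dist_sqr_le x : dist x ^+ 2 <= p x ^+ 2.
Proof.
rewrite -[leRHS]real_normK ?num_real // ler_sqr ?nnegrE ?normr_ge0 //.
exact: dist_le.
Qed.

Lemma eps_inv_gt0 : 0 < eps^-1.
Proof. by rewrite invr_gt0; exact: eps_gt0. Qed.

(** The sorted distances start at or above [dist x], so their tail costs about [g * dist x ^+ 2];
    the vertex [x] itself pays [p x ^+ 2] instead of [dist x ^+ 2]. *)
Lemma local_energy x : x \in X0 ->
  p x ^+ 2 + (g - 1) * dist x ^+ 2 <= lam + 1 / 100.
Proof.
move=> xX; have [eta hg [n40 /andP [e0 e1] _ _]] := hn.
pose v k := dist (nth x (desc_enum dist X0) k).
have d0 y : 0 <= dist y by case/andP: (dist_itv y).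
have vm i j : (i <= j <= n)%N -> v j <= v i by exact: sorted_mono.
have vp k : (k <= n)%N -> 0 <= v k by move=> _; exact: d0.
have hX0 : \sum_(0 <= k < n) v k ^+ 2 <= \sum_(z in X0) dist z ^+ 2.
  by apply: (@sorted_sum x dist xX 0 (fun y => y ^+ 2)) => y; exact: sqr_ge0.
have hp : \sum_(z in X0) dist z ^+ 2 + (p x ^+ 2 - dist x ^+ 2) <= \sum_z p z ^+ 2.
  rewrite (bigD1 x xX) /= [leRHS](bigD1 x) //=.
  have : \sum_(i in X0 | i != x) dist i ^+ 2 <= \sum_(i | i != x) p i ^+ 2.
    rewrite [leRHS](bigID (mem X0)) /= -[leLHS]addr0; apply: lerD.
      by under eq_bigl do rewrite andbC; apply: ler_sum => z _; exact: dist_sqr_le.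
    by apply: sumr_ge0 => z _; exact: sqr_ge0.
  by move: (\sum_(i in X0 | i != x) _) (\sum_(i | i != x) _) => S1 S2; lra.
have ei := eps_inv_gt0.
have hE0 : 0 <= \sum_(e in E0) defect e ^+ 2 by apply: sumr_ge0 => z _; exact: sqr_ge0.
have hgap : \sum_(1 <= k < n.+1) (v k.-1 - v k) ^+ 2 <= \sum_(e in E0) defect e ^+ 2.
  apply: sorted_gaps => //; first exact: dist_lip.
  by move=> k hk; apply: level_crossed => //; apply: X0_n0 xX.
have en := energy.
have pe : 0 <= eps^-1 * \sum_(e in E0) defect e ^+ 2 by rewrite mulr_ge0 // ltW.
have hs : \sum_(0 <= k < n) v k ^+ 2 <= lam.
  apply: le_trans hX0 _; apply: le_trans (sum_X0_le dist_sqr_le) _; lra.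
have := top_bound t1 tu vp vm hg e0 n40 (leq0n _) hs.
have : eps^-1 * \sum_(1 <= k < n.+1) (v k.-1 - v k) ^+ 2
   <= eps^-1 * \sum_(e in E0) defect e ^+ 2 by rewrite ler_pM2l.
have : g * dist x ^+ 2 <= g * v 0%N ^+ 2.
  rewrite ler_pM2l; last by have := g_gt t1 tu; lra.
  by rewrite ler_sqr ?nnegrE ?d0 //; apply: sorted_top.
rewrite mulrBl mul1r; lra.
Qed.

Lemma rnd_small x : x \in X0 -> -1 <= rnd x <= 1.
Proof.
move=> /local_energy h; have := g_gt t1 tu; have := lam_lt => hl hg.
have d2 := sqr_ge0 (dist x).
have hp : p x ^+ 2 < 9 / 4 by nra.
have [h1 h2] : - (3 / 2) < p x /\ p x < 3 / 2 by split; nra.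
have /andP [h3 h4] := res_itv x; rewrite /res in h3 h4.
case/or4P: (int_cases (rnd x)) => [h5|/eqP -> //|/eqP -> //|/orP [/eqP -> //|h5]];
  exfalso; move: h5; rewrite -(ler_int R).
  by rewrite (_ : (-2)%:~R = - 2) // => h5; lra.
by rewrite (_ : 2%:~R = 2) // => h5; lra.
Qed.

(** Moving [x] to its second nearest integer must not leave the range from -1 to 1. The tail at [x]
    costs at least 0.55, which leaves [p x ^+ 2] below 1.48 and so excludes values of size 1.29 or
    more. *)
Lemma far_rnd x : x \in X0 -> 29 / 100 <= dist x ->
  [\/ rnd x = 0, rnd x = 1 /\ res x < 0 | rnd x = -1 /\ 0 <= res x].
Proof.
move=> xX hd; have hs := rnd_small xX; have := local_energy xX.
have := g_gt t1 tu; have hl := lam_lt => hg.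
have d2 : (29 / 100) ^+ 2 <= dist x ^+ 2.
  by rewrite ler_sqr ?nnegrE ?normr_ge0 //; lra.
have hd2 : 55 / 100 <= (g - 1) * dist x ^+ 2.
  have : 84 / (100 * 100) * 10 <= dist x ^+ 2 by lra.
  by nra.
move=> hp; have hp2 : p x ^+ 2 < 148 / 100 by lra.
case: (int_small hs) => [E|[E|E]]; [apply: Or33|exact: Or31|apply: Or32];
  split=> //; have hr : res x = p x - (rnd x)%:~R by []; rewrite E in hr.
- rewrite leNgt; apply/negP => r0.
  rewrite /dist ltr0_norm // hr (_ : (-1)%:~R = - 1) // in hd.
  have : p x <= - (129 / 100) by lra.
  by rewrite -lerN2 opprK => h; apply: (large_sqr h); rewrite sqrrN.
- rewrite ltNge; apply/negP => r0.
  rewrite /dist ger0_norm // hr (_ : 1%:~R = 1) // in hd.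
  have : 129 / 100 <= p x by lra.
  by move=> h; exact: (large_sqr h).
Qed.

(* Moving the rounding of the vertices of [Y] to their second nearest integer repairs the bad
   edges leaving [Y]; no good edge may leave [Y]. *)
Definition admissible (Y : {set X}) :=
  (Y \subset [set x in X0 | 29 / 100 <= dist x]) &&
  [forall e in E0, (gap e == 0) ==> ((a e \in Y) == (c e \in Y))].

Definition bad (Y : {set X}) e :=
  (gap e != 0) (+) ((a e \in Y) != (c e \in Y)).

(** An exchange argument: [Y] minimises the number of bad edges. If every edge leaving a level set
    [Z] were bad, toggling [Z] as well would repair all of them and change no other edge. *)
Lemma best_admissible : X0 != set0 -> exists Y, admissible Y /\
  forall k, (0 < k < n.+1)%N -> exists2 e, (e \in E0) && ~~ bad Y e
    & (a e \in level dist X0 k) != (c e \in level dist X0 k).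
Proof.
move=> X00; have A0 : admissible set0.
  by rewrite /admissible sub0set; apply/forall_inP => e _; rewrite !inE eqxx implybT.
pose m (Y : {set X}) := #|[set e in E0 | bad Y e]|.
case: (@arg_minnP _ set0 admissible m A0) => Y AY minY; exists Y; split=> // k hk.
set Z := level dist X0 k.
have [e eE ce] := level_crossed dist X00 hk.
have /andP [sY gY] := AY.
have [|nob] := boolP [exists e in E0, (gap e == 0) && ((a e \in Z) != (c e \in Z))].
  case/exists_inP => e' eE' /andP [g' c']; exists e' => //; rewrite eE' /bad.
  by have := forall_inP gY e' eE'; rewrite g' /= => /eqP ->; rewrite eqxx.
have badZ e' : e' \in E0 -> (a e' \in Z) != (c e' \in Z) -> gap e' != 0.
  move=> eE' c'; apply: contra nob => g'; apply/exists_inP; exists e' => //.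
  by rewrite g' c'.
have [da dc _] := bad_dist eE (badZ e eE ce).
have /andP [aX cX] := hopen.1 e eE.
(* Some end outside [Z] of the crossing bad edge is at distance at least 0.29 from the integers, and
   every vertex of [Z] comes earlier in the order. *)
have sZ : Z \subset [set x in X0 | 29 / 100 <= dist x].
  apply/subsetP => x; rewrite !inE => /andP [xX xk]; rewrite xX /=.
  have [y [yX yk dy]] : exists y, [/\ y \in X0,
     (k <= index y (desc_enum dist X0))%N & 29 / 100 <= dist y].
    move: ce; rewrite /Z mem_level //.
    case: (ltnP (index (a e) (desc_enum dist X0)) k) => h1;
      case: (ltnP (index (c e) (desc_enum dist X0)) k) => h2 // _.
      by exists (c e).
    by exists (a e).
  apply: le_trans dy _.
  have := @desc_enum_prefix _ _ dist X0 x _ _ yX yk _ (ltnW xk).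
  by rewrite nth_index // mem_desc_enum.
(* The symmetric difference of [Y] and [Z]. *)
pose Y' : {set X} := [set x | (x \in Y) != (x \in Z)].
have mY' x : (x \in Y') = ((x \in Y) != (x \in Z)) by rewrite [LHS]inE.
have AY' : admissible Y'.
  apply/andP; split.
    apply/subsetP => x xY'; have : (x \in Y) != (x \in Z) by rewrite -mY'.
    have [xY _|_] := boolP (x \in Y); first exact: (subsetP sY x xY).
    by have [xZ _|//] := boolP (x \in Z); exact: (subsetP sZ x xZ).
  apply/forall_inP => e' eE'; apply/implyP => g'; rewrite !mY'.
  have := forall_inP gY e' eE'; rewrite g' /= => /eqP ->.
  have [->//|hZ] := eqVneq (a e' \in Z) (c e' \in Z).
  by have := badZ e' eE' hZ; rewrite g'.
apply: contrapT => nex.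
have allbad e' : e' \in E0 -> (a e' \in Z) != (c e' \in Z) -> bad Y e'.
  move=> eE' cr; apply: contrapT => /negP nb; apply: nex; exists e' => //.
  by rewrite eE'.
have : (m Y' < m Y)%N.
  apply: proper_card; apply/properP; split.
    apply/subsetP => e'; rewrite !inE => /andP [eE']; rewrite eE' /=.
    have [hZ|hZ] := eqVneq (a e' \in Z) (c e' \in Z); last by rewrite allbad.
    rewrite /bad !mY' hZ.
    by case: (a e' \in Y); case: (c e' \in Y); case: (c e' \in Z).
  exists e; first by rewrite inE eE allbad.
  rewrite inE eE /= /bad !mY'; have := allbad e eE ce; rewrite /bad.
  move: ce; case: (a e \in Z); case: (c e \in Z) => //;
  by case: (a e \in Y); case: (c e \in Y); case: (gap e == 0).
by rewrite ltnNge minY.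
Qed.

(* A surviving bad edge costs at least the energy of a half-integral digon with a tail. *)
Lemma no_bad_edge Y e0 : admissible Y ->
  (forall k, (0 < k < n.+1)%N -> exists2 e, (e \in E0) && ~~ bad Y e
    & (a e \in level dist X0 k) != (c e \in level dist X0 k)) ->
  e0 \in E0 -> ~~ bad Y e0.
Proof.
move=> /andP [sY gY] cross eE0; apply/negP => be0.
have /andP [aX cX] := hopen.1 e0 eE0.
have g0 : gap e0 != 0.
  apply/negP => g0; move: be0; rewrite /bad g0 /=.
  by have := forall_inP gY e0 eE0; rewrite g0 /= => ->.
have /and3P [ac _ _] := edges eE0.
have [_ _ hd0] := bad_dist eE0 g0.
pose v k := dist (nth (a e0) (desc_enum dist X0) k).
have d0 y : 0 <= dist y by case/andP: (dist_itv y).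
have dh y : dist y <= 1 / 2 by case/andP: (dist_itv y).
have vm i j : (i <= j <= n)%N -> v j <= v i by exact: sorted_mono.
have vp k : (k <= n)%N -> 0 <= v k by move=> _; exact: d0.
have hX0 : \sum_(0 <= k < n) v k ^+ 2 <= \sum_z p z ^+ 2.
  apply: le_trans (sum_X0_le dist_sqr_le).
  by apply: (@sorted_sum (a e0) dist aX 0 (fun y => y ^+ 2)) => y; exact: sqr_ge0.
pose E := [set e in E0 | ~~ bad Y e].
have hgap : \sum_(1 <= k < n.+1) (v k.-1 - v k) ^+ 2 <= \sum_(e in E) defect e ^+ 2.
  apply: sorted_gaps => //.
  - by apply/subsetP => e; rewrite inE => /andP [].
  - by move=> e; rewrite inE => /andP [eE _]; exact: dist_lip.
  - by move=> k hk; have [e he ce] := cross k hk; exists e; rewrite // inE.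
(* The edges of [E] already cross all the gaps, so the defect of [e0] comes on top of them. Its ends
   are distinct, so their distances add up to at most [v 0 + v 1]; this supplies the second edge of
   the digon. *)
have hsum : \sum_(e in E) defect e ^+ 2 + (1 - v 0%N - v 1%N) ^+ 2
    <= \sum_(e in E0) defect e ^+ 2.
  rewrite [leRHS](bigID (fun e => ~~ bad Y e)) /=; apply: lerD.
    by under eq_bigl do rewrite inE.
  rewrite (bigD1 e0) /=; last by rewrite eE0 be0.
  apply: (@le_trans _ _ (defect e0 ^+ 2)); last first.
    by rewrite lerDl; apply: sumr_ge0 => i _; exact: sqr_ge0.
  rewrite -[leRHS]real_normK ?num_real // ler_sqr ?nnegrE ?normr_ge0 //.
    apply: le_trans hd0.
    by have : dist (a e0) + dist (c e0) <= v 0%N + v 1%N; [exact: sorted_top2|lra].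
  by have : v 0%N <= 1 / 2 /\ v 1%N <= 1 / 2; [by split; exact: dh|case; lra].
apply: (digon_contra t1 tu vp vm hn).
have ei := eps_inv_gt0; have en := energy.
have : eps^-1 * (\sum_(1 <= k < n.+1) (v k.-1 - v k) ^+ 2 + (1 - v 0%N - v 1%N) ^+ 2)
   <= eps^-1 * \sum_(e in E0) defect e ^+ 2.
  by rewrite ler_pM2l //; apply: le_trans hsum; rewrite lerD2r.
lra.
Qed.

Definition toggle (Y : {set X}) x : int :=
  if x \in Y then (if 0 <= res x then 1 else -1) else 0.

Definition rounding (Y : {set X}) x : int :=
  if x \in X0 then rnd x + toggle Y x else 0.

Lemma rounding_exact Y e : admissible Y -> e \in E0 -> ~~ bad Y e ->
  al e * rounding Y (a e) + ga e * rounding Y (c e) = b e.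
Proof.
move=> /andP [sY _] eE nb; rewrite /rounding.
have /andP [-> ->] := hopen.1 e eE.
suff h : al e * toggle Y (a e) + ga e * toggle Y (c e) = gap e.
  rewrite !mulrDr addrACA h /gap; ring.
have dY x : x \in Y -> 29 / 100 <= dist x.
  by move=> /(subsetP sY); rewrite inE => /andP [].
have /and3P [_ pa pc] := edges eE.
move: nb; rewrite /bad /toggle.
(* If both ends of a good edge are toggled, the changes cancel: otherwise two signed residues of the
   same sign, each at least 0.29 in size, would give a defect of at least 0.58. *)
have [g0|g0] := eqVneq (gap e) 0 => /=.
  rewrite negbK => /eqP acY; rewrite g0 acY.
  case: ifPn => cY; last by rewrite !mulr0 addr0.
  rewrite cY in acY.
  have := defect_le eE; rewrite defectE g0 sub0r normrN ler_norml.
  have := dY _ acY; have := dY _ cY; rewrite /dist.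
  case: (ger0P (res (a e))) => ha; case: (ger0P (res (c e))) => hc;
  case: (pm1P pa) => ->; case: (pm1P pc) => ->; rewrite ?rmorphN /= ?mulN1r ?mul1r ?opprK ?subrr ?addNr ?subrr //;
  by move=> h1 h2 /andP [h3 h4]; first [reflexivity | exfalso; clear acY g0; lra].
rewrite negbK => cr; case: (bad_edge eE g0) => -[-> [h1 h2]]; move: h1 h2 cr;
  case: (pm1P pa) => ->; case: (pm1P pc) => ->;
  case: (ger0P (res (a e))) => ha; case: (ger0P (res (c e))) => hc;
  rewrite ?rmorphN /= ?mulN1r ?mul1r => h1 h2; try (exfalso; lra);
  by case: (a e \in Y); case: (c e \in Y); rewrite // ?mulr0 ?addr0 ?add0r ?mulN1r ?opprK ?mulr1.
Qed.

Lemma rounding_small Y x : admissible Y -> x \in X0 ->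
  [/\ -1 <= rounding Y x <= 1, `|p x - (rounding Y x)%:~R| <= 1
    & 1 / 2 < `|p x - (rounding Y x)%:~R| -> 29 / 100 <= dist x].
Proof.
move=> /andP [sY _] xX; rewrite /rounding xX /toggle.
have /andP [r1 r2] := res_itv x.
have pE : p x = res x + (rnd x)%:~R by rewrite /res subrK.
have [xY|xY] := boolP (x \in Y); last first.
  rewrite addr0 -/(res x) rnd_small //; split=> //.
    by have /andP [_] := dist_itv x; rewrite /dist; lra.
  by rewrite -/(dist x); have /andP [_] := dist_itv x; lra.
have dx : 29 / 100 <= dist x by have := subsetP sY x xY; rewrite inE => /andP [].
rewrite pE !rmorphD /= addrKA.
split=> //.
  case: (far_rnd xX dx) => [->|[-> h]|[-> h]]; first by case: ifP.
    by rewrite (lt_geF h).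
  by rewrite h.
have [h|h] := lerP 0 (res x); rewrite ?rmorphN /=.
  by rewrite ler0_norm; lra.
by rewrite ger0_norm; lra.
Qed.

Section Norm.
Variable Y : {set X}.
Hypotheses (AY : admissible Y) (nobad : forall e, e \in E0 -> ~~ bad Y e).
Let m := rounding Y.
Let u x : R := `|p x - (m x)%:~R|.

Lemma u_ge0 x : 0 <= u x. Proof. exact: normr_ge0. Qed.

Lemma u_lip e : e \in E0 -> `|u (a e) - u (c e)| <= `|defect e|.
Proof.
move=> eE; rewrite /u /defect -(rounding_exact AY eE (nobad eE)) -/m.
have /and3P [_ pa pc] := edges eE.
rewrite rmorphD !rmorphM /=.
have -> : `|p (a e) - (m (a e))%:~R| = `|(al e)%:~R * ((m (a e))%:~R - p (a e))|.
  by case: (pm1P pa) => ->; rewrite ?rmorphN ?mulN1r ?normrN ?mul1r distrC.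
have -> : `|p (c e) - (m (c e))%:~R| = `|(ga e)%:~R * (p (c e) - (m (c e))%:~R)|.
  by case: (pm1P pc) => ->; rewrite ?rmorphN ?mulN1r ?normrN ?mul1r.
apply: le_trans (ler_dist_dist _ _) _.
by rewrite le_eqVlt; apply/orP; left; apply/eqP; congr (`|_|); ring.
Qed.

(** If [m x] is 0 then [p x] has absolute value [u x]; if it is 1 or -1, then this absolute value is
    at least [1 - u x], hence at least [u x] as long as [u x <= 1 / 2]. *)
Lemma cost_low x : x \in X0 -> (u x <= 1 / 2) || (m x == 0) -> u x ^+ 2 <= p x ^+ 2.
Proof.
move=> xX; have [h1 _ _] := rounding_small AY xX; rewrite -/m -/(u x) in h1.
have [m0 _|m0] := eqVneq (m x) 0; first by rewrite /u m0 subr0 real_normK ?num_real.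
rewrite orbF /u; case: (int_small h1) m0 => [->|[->|->]] // _; rewrite ?rmorphN /=.
  case: (ler0P (p x - -1)) => h2 h3; nra.
by case: (ler0P (p x - 1)) => h2 h3; nra.
Qed.

Lemma cost_high x : x \in X0 -> (1 / 2 < u x) || (m x != 0) -> (1 - u x) ^+ 2 <= p x ^+ 2.
Proof.
move=> xX; have [h1 h2 _] := rounding_small AY xX; rewrite -/m -/(u x) in h1 h2.
have [m0|m0 _] := eqVneq (m x) 0.
  rewrite orbF => h3.
  have -> : p x ^+ 2 = u x ^+ 2 by rewrite /u m0 subr0 real_normK ?num_real.
  by have := u_ge0 x; nra.
have hp : 1 - u x <= `|p x|.
  have : `|(m x)%:~R| <= u x + `|p x| :> R.
    by rewrite /u distrC; have := ler_normD ((m x)%:~R - p x) (p x); rewrite subrK.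
  have -> : `|(m x)%:~R| = 1 :> R.
    by case: (int_small h1) m0 => [->|[->|->]] // _; rewrite ?rmorphN ?normrN /= normr1.
  lra.
rewrite -[leRHS]real_normK ?num_real // ler_sqr ?nnegrE ?normr_ge0 //; lra.
Qed.

(** Three nonzero values of [m] would give three vertices that pay [(1 - u x) ^+ 2] in front of a
    tail that pays [u x ^+ 2], against [three_contra]. *)
Lemma rounding_norm : \sum_z m z ^+ 2 <= 2.
Proof.
rewrite leNgt; apply/negP => hm.
pose S := [set x in X0 | m x != 0].
have mE : \sum_z m z ^+ 2 = #|S|%:Z.
  rewrite -[RHS]natz -sum1_card natr_sum (bigID (mem S)) /= [X in _ + X]big1 ?addr0; last first.
    move=> x; rewrite inE negb_and negbK => /orP [xX|/eqP -> //].
    by rewrite /m /rounding (negPf xX).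
  apply: eq_bigr => x; rewrite inE => /andP [xX m0].
  have [h1 _ _] := rounding_small AY xX; rewrite -/m in h1.
  by case: (int_small h1) m0 => [->|[->|->]].
have S3 : (2 < #|S|)%N by rewrite mE ltz_nat in hm.
have /card_gt0P [x0] : (0 < #|S|)%N by apply: ltn_trans S3.
rewrite inE => /andP [x0X _]; clear hm mE.
have X00 : X0 != set0 by apply: X0_n0 x0X.
have hX := card_X0 X00.
pose s := desc_enum u X0; pose v k := u (nth x0 s k).
have vm i j : (i <= j <= n)%N -> v j <= v i by exact: sorted_mono.
have vp k : (k <= n)%N -> 0 <= v k by move=> _; exact: u_ge0.
have hgap j : \sum_(j.+1 <= k < n.+1) (v k.-1 - v k) ^+ 2 <= \sum_(e in E0) defect e ^+ 2.
  apply: sorted_gaps => //; first exact: u_lip.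
  by move=> k hk; apply: level_crossed => //; case/andP: hk => h1 ->; rewrite (leq_ltn_trans _ h1).
have ei := eps_inv_gt0; have en := energy.
have n40 : (40 < n)%N by case: hn => eta _ [].
have fin j Q : Q <= \sum_(x in X0) p x ^+ 2 -> Q + eps^-1 * \sum_(j.+1 <= k < n.+1) (v k.-1 - v k) ^+ 2 <= lam.
  move=> hQ; have h1 := sum_X0_le (F := fun x => p x ^+ 2) (fun x => lexx _).
  have : eps^-1 * \sum_(j.+1 <= k < n.+1) (v k.-1 - v k) ^+ 2
     <= eps^-1 * \sum_(e in E0) defect e ^+ 2 by rewrite ler_pM2l.
  lra.
pose T := [set x in X0 | 1 / 2 < u x].
(* A vertex with [u x > 1 / 2] has [dist x >= 29 / 100], and 31 such vertices would cost more than
   [lam]. *)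
have T25 : (#|T| <= 30)%N.
  rewrite leqNgt; apply/negP => T30.
  have : 2523 / 1000 <= \sum_z p z ^+ 2.
    apply: le_trans (sum_X0_le dist_sqr_le).
    rewrite (big_setID T) /=; apply: (@le_trans _ _ (\sum_(x in X0 :&: T) dist x ^+ 2)); last first.
      by rewrite lerDl; apply: sumr_ge0 => z _; exact: sqr_ge0.
    have -> : X0 :&: T = T by apply/setIidPr/subsetP => x; rewrite inE => /andP [].
    apply: (@le_trans _ _ (\sum_(x in T) (29 / 100) ^+ 2)).
      rewrite sumr_const; apply: (@le_trans _ _ ((29 / 100) ^+ 2 *+ 31)); first by rewrite -mulr_natl; lra.
      by apply: ler_wpMn2l; rewrite ?sqr_ge0.
    apply: ler_sum => x; rewrite inE => /andP [xX xu].
    rewrite ler_sqr ?nnegrE ?normr_ge0 //; last by lra.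
    by have [_ _] := rounding_small AY xX; apply.
  have hl := lam_lt; have : 0 <= eps^-1 * \sum_(e in E0) defect e ^+ 2.
    by apply: mulr_ge0; [exact: ltW|apply: sumr_ge0 => e _; exact: sqr_ge0].
  lra.
have sX k : (k <= n)%N -> nth x0 s k \in X0.
  by move=> kn; rewrite -(mem_desc_enum u) mem_nth // size_desc_enum; apply: leq_ltn_trans hX.
(* If [T] has three elements, the last three of them in the order are the end of the path and all
   earlier vertices are dropped. *)
have [T3|T3] := leqP 3 #|T|.
  have lowT k : (k < #|T|)%N -> 1 / 2 < v k.
    move=> kT; rewrite ltNge; apply/negP => vk.
    have : (#|T| <= #|level u X0 k|)%N.
      apply: subset_leq_card; apply/subsetP => x; rewrite !inE => /andP [xX xu].
      rewrite xX /= ltnNge; apply/negP => kx.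
      by have := @desc_enum_prefix _ _ u X0 x0 _ _ xX kx _ (leqnn k); rewrite -/s -/(v k); lra.
    have kX : (k <= #|X0|)%N.
      apply: leq_trans (ltnW kT) _; apply: subset_leq_card.
      by apply/subsetP => x; rewrite inE => /andP [].
    by rewrite (card_level u kX) => h; have := leq_trans kT h; rewrite ltnn.
  have highT k : (#|T| <= k)%N -> (k <= n)%N -> v k <= 1 / 2.
    move=> kT kn; rewrite leNgt; apply/negP => vk.
    have : (#|level u X0 k.+1| <= #|T|)%N.
      apply: subset_leq_card; apply/subsetP => x; rewrite !inE => /andP [xX xk].
      rewrite xX /=; apply: lt_le_trans vk _.
      have <- : nth x0 s (index x s) = x by rewrite nth_index // mem_desc_enum.
      by apply: desc_enum_mono; rewrite size_desc_enum -ltnS xk; apply: leq_ltn_trans hX.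
    have kX : (k < #|X0|)%N by apply: leq_ltn_trans hX.
    by rewrite (card_level u kX) => h; have := leq_trans h kT; rewrite ltnn.
  apply: (three_contra t1 tu vp vm (j := #|T| - 3) hn).
    by rewrite leq_subLR; apply: leq_trans T25 _.
  apply: fin; rewrite (sum_desc_enum u _ x0) -/s.
  set j := (#|T| - 3)%N.
  have jT : (j.+3 = #|T|)%N by rewrite /j -addn3 subnK.
  have jn : (j.+3 <= n)%N by rewrite jT; apply: leq_trans T25 _; apply: ltnW; apply: ltn_trans n40.
  rewrite [leRHS](big_cat_nat _ (n := n)) ?(ltnW hX) //=.
  rewrite [X in _ <= X + _](big_cat_nat _ (n := j.+3)) //=.
  rewrite [X in _ <= X + _ + _](big_cat_nat _ (n := j)) //=; last by rewrite -addn3 leq_addr.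
  rewrite -[leLHS]add0r -[leLHS]addr0 !addrA; apply: lerD; last first.
    by apply: sumr_ge0 => k _; exact: sqr_ge0.
  apply: lerD; last first.
    rewrite big_nat_cond [leRHS]big_nat_cond; apply: ler_sum => k /andP [/andP [k1 k2] _].
    by apply: cost_low; rewrite ?sX ?(ltnW k2) // highT -?jT // ltnW.
  apply: lerD; first by apply: sumr_ge0 => k _; exact: sqr_ge0.
  rewrite big_nat_cond [leRHS]big_nat_cond; apply: ler_sum => k /andP [/andP [k1 k2] _].
  apply: cost_high; first by rewrite sX // ltnW // (leq_trans k2).
  by rewrite lowT // -jT.
(* Otherwise [T] is filled up to exactly three vertices by others where [m] is nonzero; these too
   satisfy [cost_high]. *)
have [|B sB cB] := @exists_subset _ (S :\: T) (3 - #|T|).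
  rewrite leq_subLR; apply: leq_trans S3 _.
  rewrite -(cardsID T S) leq_add2r; apply: subset_leq_card; exact: subsetIr.
pose W := T :|: B.
have cW : #|W| = 3.
  rewrite /W cardsU cB; have -> : T :&: B = set0.
    apply/setP => x; rewrite !inE; apply/negP => /andP [/andP [xX xu] xB].
    by have := subsetP sB x xB; rewrite !inE xX xu.
  by rewrite cards0 subn0 subnKC // ltnW.
have sW : W \subset X0.
  apply/subsetP => x; rewrite in_setU => /orP [|/(subsetP sB)]; rewrite !inE.
    by case/andP.
  by case/and3P.
have hW : \sum_(x in W) u x <= \sum_(0 <= k < 3) v k.
  rewrite (sum_desc_enum u _ x0) cW big_nat_cond [leRHS]big_nat_cond.
  apply: ler_sum => k /andP [/andP [_ k3] _]; rewrite leNgt; apply/negP => hk.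
  have : (#|level u W k.+1| <= #|level u X0 k|)%N.
    apply: subset_leq_card; apply/subsetP => x; rewrite inE => /andP [xW xk].
    have xX : x \in X0 by apply: (subsetP sW).
    rewrite inE xX /= ltnNge; apply/negP => kx.
    have := @desc_enum_prefix _ _ u X0 x0 _ _ xX kx _ (leqnn k); rewrite -/s -/(v k).
    apply/negP; rewrite -ltNge; apply: lt_le_trans hk _.
    have <- : nth x0 (desc_enum u W) (index x (desc_enum u W)) = x.
      by rewrite nth_index // mem_desc_enum.
    by apply: (@desc_enum_mono _ _ u W x0); rewrite size_desc_enum cW -ltnS xk.
  have kW : (k < #|W|)%N by rewrite cW.
  have kX : (k <= #|X0|)%N by apply: leq_trans (ltnW kW) _; apply: subset_leq_card.
  by rewrite (card_level u kW) (card_level u kX) ltnn.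
apply: (three_contra t1 tu vp vm (j := 0) hn) => //.
apply: fin.
(* Paying [(1 - u x) ^+ 2] instead of [u x ^+ 2] changes the cost by [1 - 2 * u x]. Over three
   vertices this is least at the three largest values, so [W] may be replaced by the first three
   positions. *)
have h1 : \sum_(x in X0) u x ^+ 2 + \sum_(x in W) (1 - 2 * u x) <= \sum_(x in X0) p x ^+ 2.
  have -> : \sum_(x in W) (1 - 2 * u x) = \sum_(x in X0) (if x \in W then 1 - 2 * u x else 0).
    rewrite -big_mkcondr /=; apply: eq_bigl => x.
    by case: (boolP (x \in W)) => [/(subsetP sW) ->|]; rewrite ?andbF.
  rewrite -big_split; apply: ler_sum => x xX /=.
  case: ifPn => xW.
    have -> : u x ^+ 2 + (1 - 2 * u x) = (1 - u x) ^+ 2 by ring.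
    apply: cost_high => //; move: xW; rewrite in_setU => /orP [|/(subsetP sB)]; rewrite !inE.
      by case/andP => _ ->.
    by case/and3P => _ _ ->; rewrite orbT.
  rewrite addr0; apply: cost_low => //; apply/orP; left.
  by move: xW; rewrite in_setU inE xX /= negb_or -leNgt => /andP [].
have h2 : \sum_(0 <= k < n) v k ^+ 2 <= \sum_(x in X0) u x ^+ 2.
  by apply: (@sorted_sum x0 u x0X 0 (fun y => y ^+ 2)) => y; exact: sqr_ge0.
apply: le_trans h1; move: h2.
rewrite sumrB sumr_const cW -mulr_sumr.
rewrite (big_cat_nat _ (n := 3)) //=; last by apply: leq_trans (ltnW n40).
have -> : \sum_(0 <= k < 3) (1 - v k) ^+ 2
  = 3 - 2 * \sum_(0 <= k < 3) v k + \sum_(0 <= k < 3) v k ^+ 2.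
  by rewrite !big_nat_recr //= !big_geq //; ring.
lra.
Qed.

End Norm.

Lemma rounding_exists : exists2 m : X -> int,
  (forall e, e \in E0 -> al e * m (a e) + ga e * m (c e) = b e)
  & \sum_z m z ^+ 2 <= 2.
Proof.
have [X00|X00] := eqVneq X0 set0.
  exists (fun _ => 0); last by rewrite big1 // => z _; rewrite expr0n.
  by move=> e /(hopen.1); rewrite X00 !inE.
have [Y [AY cross]] := best_admissible X00.
have nobad e : e \in E0 -> ~~ bad Y e by exact: no_bad_edge.
exists (rounding Y); last exact: rounding_norm.
by move=> e eE; apply: rounding_exact => //; apply: nobad.
Qed.

End Rounding.

Lemma potential_exists (R : realType) (V X : finType) (A : V -> V -> int)
    (a c : V -> X) (al ga : V -> int) (t : R) (n : nat)
    (H E0 : {set V}) (X0 : {set X}) (v : V) :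
  1 < t -> t ^+ 6 < t ^+ 2 + 1 -> large_order t n ->
  signed_mx A -> line_rep a c al ga A H -> E0 \subset H -> v \notin H ->
  open_in a c X0 E0 n.+1 -> psd A (t + t^-1) (v |: E0) ->
  exists2 m : X -> int,
    (forall e, e \in E0 -> al e * m (a e) + ga e * m (c e) = - A v e)
    & \sum_z m z ^+ 2 <= 2.
Proof.
move=> t1 tu hn sA rH sE vH oE pE.
have vE : v \notin E0 by apply: contra vH; apply: subsetP.
have [p hp] : exists p : X -> R,
    \sum_z p z ^+ 2 + (t + t^-1 - 2)^-1 * (\sum_(e in E0) ((- A v e)%:~R
      - ((al e)%:~R * p (a e) + (ga e)%:~R * p (c e))) ^+ 2) <= t + t^-1.
  apply: dual_potential; first exact: eps_gt0.
  (* The coefficient of [v] is normalised to -1, which turns semidefiniteness into the hypothesis of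
     [dual_potential] with [b e = - A v e]. *)
  move=> x sx; pose y w : R := - (w == v)%:R.
  have sy : supp_in (v |: E0) (fun w => x w + y w).
    move=> w; rewrite in_setU1 negb_or => /andP [wv wE].
    by rewrite sx // /y (negPf wv) oppr0 addr0.
  have := pE _ sy; rewrite qf_lin // (qf_rep _ sA rH (supp_in_sub sE sx)).
  have -> : qf A (t + t^-1) y = t + t^-1.
    have [_ A0 _] := sA; rewrite /qf [X in _ - X]big1 => [|u _]; last first.
      rewrite big1 // => w _; rewrite /y.
      have [->|uv] := eqVneq u v; last by rewrite oppr0 mul0r mulr0.
      have [->|wv] := eqVneq w v; last by rewrite oppr0 !mulr0.
      by rewrite A0 mul0r.
    rewrite (bigD1 v) //= big1 => [|w /negPf wv]; last by rewrite /y wv oppr0 expr0n.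
    by rewrite /y eqxx sqrrN expr1n addr0 mulr1 subr0.
  have -> : \sum_w x w * y w = 0.
    rewrite big1 // => w _; have [->|wv] := eqVneq w v; first by rewrite sx ?mul0r.
    by rewrite /y (negPf wv) oppr0 mulr0.
  have -> : \sum_u \sum_w (A u w)%:~R * (x u * y w) = \sum_e (- A v e)%:~R * x e.
    apply: eq_bigr => u _; rewrite (bigD1 v) //= big1 => [|w /negPf wv]; last first.
      by rewrite /y wv oppr0 !mulr0.
    by case: sA => sym _ _; rewrite /y eqxx addr0 sym rmorphN /=; ring.
  by move=> h; apply: le_trans h _; rewrite le_eqVlt; apply/orP; left; apply/eqP; ring.
apply: (rounding_exists (p := p) t1 tu hn _ oE hp).
move=> e /(subsetP sE) eH; case: rH => h1 h2 h3 _.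
by rewrite h1 // /pm1 h2 //= h3.
Qed.

Definition cut_connected (V X : finType) (a c : V -> X) (H : {set V}) : Prop :=
  forall Y : {set X}, Y != set0 -> Y != setT ->
    exists2 e, e \in H & (a e \in Y) != (c e \in Y).

(** A subtree through [x], grown by one crossing edge at a time. The bound on its edges matters: it
    keeps the sets to which criticality is applied small. *)
Lemma cluster_exists (V X : finType) (a c : V -> X) (H : {set V}) (x : X) N :
  cut_connected a c H -> (N < #|X|)%N ->
  exists CF : {set X} * {set V},
    [/\ x \in CF.1, #|CF.1| = N.+1, CF.2 \subset H, (#|CF.2| <= N)%N
      & (forall e, e \in CF.2 -> (a e \in CF.1) && (c e \in CF.1)) /\
      forall Y : {set X}, Y \subset CF.1 -> Y != set0 -> Y != CF.1 ->
        exists2 e, e \in CF.2 & (a e \in Y) != (c e \in Y)].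
Proof.
move=> cH; elim: N => [|N IH] NX.
  exists ([set x], set0); split=> /=; rewrite ?set11 ?cards1 ?cards0 ?sub0set //.
  split=> [e|Y sY Y0 Y1]; first by rewrite in_set0.
  by exfalso; move: sY; rewrite subset1 (negPf Y0) (negPf Y1).
have [[C F] /= [xC cC sF cF [eF xF]]] := IH (ltnW NX).
have [||e eH ce] := cH C.
- by apply/set0Pn; exists x.
- by apply: contraTneq NX => CT; rewrite -cC CT cardsT ltnn.
pose z := if a e \in C then c e else a e.
have zC : z \notin C by rewrite /z; move: ce; case: (boolP (a e \in C)) => [aC|//]; case: (c e \in C).
have ez : (a e \in z |: C) && (c e \in z |: C).
  by rewrite !in_setU1 /z; move: ce; case: (boolP (a e \in C)) => h1 /=;
     case: (boolP (c e \in C)) => h2 //= _; rewrite eqxx ?orbT.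
exists (z |: C, e |: F); split=> /=.
- by rewrite in_setU1 xC orbT.
- by rewrite cardsU1 zC cC.
- by rewrite subUset sub1set eH.
- by rewrite cardsU1; apply: leq_trans (leq_add (leq_b1 _) cF) _.
split=> [f|Y sY Y0 Y1].
  rewrite in_setU1 => /orP [/eqP -> //|/eF /andP [fa fc]].
  by rewrite !in_setU1 fa fc !orbT.
have [D0|D0] := eqVneq (Y :&: C) set0.
  have YE : Y = [set z].
    apply/eqP; rewrite eqEsubset sub1set; apply/andP; split.
      apply/subsetP => y yY; have := subsetP sY y yY; rewrite in_setU1 inE => /orP [//|yC].
      by have := in_set0 y; rewrite -D0 inE yY yC.
    case/set0Pn: Y0 => y yY; have := subsetP sY y yY; rewrite in_setU1 => /orP [/eqP <- //|yC].
    by have := in_set0 y; rewrite -D0 inE yY yC.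
  exists e; first by rewrite in_setU1 eqxx.
  rewrite YE !inE /z; move: ce; case: ifP => aC.
    by case: (eqVneq (a e) (c e)) => [<-|_ _]; rewrite ?aC ?eqxx.
  by case: (eqVneq (c e) (a e)) => [->|_ _]; rewrite ?aC ?eqxx.
have [DC|DC] := eqVneq (Y :&: C) C.
  have YE : Y = C.
    apply/eqP; rewrite eqEsubset -{2}DC subsetIl andbT; apply/subsetP => y yY.
    have := subsetP sY y yY; rewrite in_setU1 => /orP [/eqP yz|//].
    case/negP: Y1; rewrite eqEsubset sY /= subUset sub1set -yz yY /=.
    by rewrite -DC subsetIl.
  by exists e; rewrite ?in_setU1 ?eqxx // YE.
have [f fF cf] := xF _ (subsetIr _ _) D0 DC.
exists f; first by rewrite in_setU1 fF orbT.
by have /andP [fa fc] := eF f fF; move: cf; rewrite !inE fa fc !andbT.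
Qed.

(** * Representing large critical graphs *)

Lemma card_supp_le (X : finType) (p : X -> int) (k : nat) :
  \sum_z p z ^+ 2 <= k%:Z -> (#|[set z | p z != 0%R]| <= k)%N.
Proof.
move=> h; rewrite -lez_nat; apply: le_trans h.
rewrite -[leLHS]natz -sum1_card natr_sum big_mkcond /=.
apply: ler_sum => z _; rewrite inE; case: eqVneq => [->|pz]; first by rewrite expr0n.
by rewrite -gtz0_ge1 lt_neqAle sqr_ge0 andbT eq_sym sqrf_eq0.
Qed.

Lemma pm1_cancel (z x y : int) : pm1 z -> z * x = z * y -> x = y.
Proof. by case/orP => /eqP ->; lia. Qed.

(* The set where [p] and [q] differ has at most 4 points and is crossed by no edge of [F]. *)
Lemma potential_unique (V X : finType) (a c : V -> X) (al ga : V -> int)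
    (C : {set X}) (F : {set V}) (p q : X -> int) :
  (forall e, e \in F -> (a e \in C) && (c e \in C)) ->
  (forall e, e \in F -> pm1 (al e) && pm1 (ga e)) ->
  (forall Y : {set X}, Y \subset C -> Y != set0 -> Y != C ->
        exists2 e, e \in F & (a e \in Y) != (c e \in Y)) ->
  (forall e, e \in F -> al e * p (a e) + ga e * p (c e) = al e * q (a e) + ga e * q (c e)) ->
  \sum_z p z ^+ 2 <= 2 -> \sum_z q z ^+ 2 <= 2 -> (4 < #|C|)%N ->
  forall x, x \in C -> p x = q x.
Proof.
move=> eF pF xF eq np nq C4.
pose Y := [set x in C | p x != q x].
have Y4 : (#|Y| <= 4)%N.
  apply: (@leq_trans #|[set z | p z != 0] :|: [set z | q z != 0]|).
    apply: subset_leq_card; apply/subsetP => x; rewrite !inE => /andP [_].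
    by apply: contra_neqT; rewrite negb_or !negbK => /andP [/eqP -> /eqP ->].
  apply: leq_trans (leq_card_setU _ _) _.
  by apply: (@leq_add _ _ 2 2); apply: card_supp_le.
have [Y0 x xC|Y0] := eqVneq Y set0.
  by apply/eqP; have := in_set0 x; rewrite -Y0 inE xC /= => /negbFE.
have [||e eE ce] := xF Y _ Y0.
- by apply/subsetP => x; rewrite inE => /andP [].
- by apply: contraTneq C4 => <-; rewrite -leqNgt.
have /andP [aC cC] := eF e eE; have /andP [pa pc] := pF e eE.
have h := eq e eE; move: ce; rewrite !inE aC cC /=.
have [ha|ha] := eqVneq (p (a e)) (q (a e));
  have [hc|hc] := eqVneq (p (c e)) (q (c e)) => //.
  by case/negP: hc; apply/eqP; apply: (pm1_cancel pc); move: h; rewrite ha => /addrI.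
by case/negP: ha; apply/eqP; apply: (pm1_cancel pa); move: h; rewrite hc => /addIr.
Qed.

(** Each root vertex [x] takes the value at [x] of a potential of its own cluster. An edge equation
    involves two vertices and a violation of the norm bound three, so the clusters of three vertices
    and one more edge suffice for every check. *)
Lemma potential_of_local (R : realType) (V X : finType) (A : V -> V -> int)
    (a c : V -> X) (al ga : V -> int) (t : R) (n : nat) (H : {set V}) (v : V) :
  1 < t -> t ^+ 6 < t ^+ 2 + 1 -> large_order t n -> signed_mx A ->
  line_rep a c al ga A H -> cut_connected a c H -> (n < #|X|)%N -> v \notin H ->
  (forall E0 : {set V}, E0 \subset H -> (#|E0| <= (3 * n).+1)%N ->
     psd A (t + t^-1) (v |: E0)) ->
  exists2 m : X -> int,
    (forall e, e \in H -> al e * m (a e) + ga e * m (c e) = - A v e)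
    & \sum_z m z ^+ 2 <= 2.
Proof.
move=> t1 tu hn sA rH cH nX vH hp.
have n40 : (40 < n)%N by case: hn => eta _ [].
have rpm e : e \in H -> pm1 (al e) && pm1 (ga e).
  by case: rH => _ h1 h2 _ eH; rewrite /pm1 h1 ?h2.
have [CF hCF] := choice (fun x => cluster_exists x cH nX).
pose C x := (CF x).1; pose F x := (CF x).2.
have sub_open (S : {set X}) (D : {set V}) :
    (forall e, e \in D -> (a e \in S) && (c e \in S)) ->
    open_in a c (\bigcup_(x in S) C x) ((\bigcup_(x in S) F x) :|: D) n.+1.
  move=> hD; split.
    move=> e; rewrite in_setU => /orP [/bigcupP [x xS eF]|/hD /andP [ha hc]].
      have [_ _ _ _ [h _]] := hCF x; have /andP [h1 h2] := h e eF.
      by apply/andP; split; apply/bigcupP; exists x.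
    apply/andP; split; apply/bigcupP.
      by exists (a e) => //; have [] := hCF (a e).
    by exists (c e) => //; have [] := hCF (c e).
  move=> Y sY /set0Pn [y yY] Yn.
  have /bigcupP [x xS yC] := subsetP sY y yY.
  have [_ cC _ _ [hF hY]] := hCF x.
  have [||e eF ce] := hY (Y :&: C x) (subsetIr _ _).
  - by apply/set0Pn; exists y; rewrite inE yY.
  - apply: contraTneq Yn => YC; rewrite -leqNgt -cC -YC; apply: subset_leq_card; exact: subsetIl.
  exists e; first by rewrite in_setU; apply/orP; left; apply/bigcupP; exists x.
  by have /andP [fa fc] := hF e eF; move: ce; rewrite !inE fa fc !andbT.
have loc (S : {set X}) (D : {set V}) : D \subset H -> (#|S| <= 3)%N -> (#|D| <= 1)%N ->
    (forall e, e \in D -> (a e \in S) && (c e \in S)) ->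
    exists2 m : X -> int,
    (forall e, e \in (\bigcup_(x in S) F x) :|: D -> al e * m (a e) + ga e * m (c e) = - A v e)
    & \sum_z m z ^+ 2 <= 2.
  move=> DH S3 D1 hD; apply: potential_exists t1 tu hn sA rH _ vH (sub_open S D hD) _.
    rewrite subUset DH andbT; apply/bigcupsP => x _; by have [] := hCF x.
  apply: hp.
    rewrite subUset DH andbT; apply/bigcupsP => x _; by have [] := hCF x.
  apply: leq_trans (leq_card_setU _ _) _; rewrite -addn1; apply: leq_add => //.
  apply: leq_trans (card_bigcup_le (k := n) _) _; last by rewrite leq_mul2r S3 orbT.
  by move=> x _; have [] := hCF x.
have loc1 x : exists m : X -> int,
    (forall e, e \in F x -> al e * m (a e) + ga e * m (c e) = - A v e)
    /\ \sum_z m z ^+ 2 <= 2.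
  have [||||m hm nm] := loc [set x] set0; rewrite ?sub0set ?cards1 ?cards0 //.
    by move=> e; rewrite in_set0.
  exists m; split=> // e eF; apply: hm; rewrite in_setU; apply/orP; left.
  by apply/bigcupP; exists x; rewrite ?inE.
have [M hM] := choice loc1.
pose P x := M x x.
(* A potential found for several clusters jointly agrees on each of them with the one found
   separately, by [potential_unique]; thus [P] can be replaced by a genuine potential near up to
   three vertices. *)
have locP (S : {set X}) (D : {set V}) : D \subset H -> (#|S| <= 3)%N -> (#|D| <= 1)%N ->
    (forall e, e \in D -> (a e \in S) && (c e \in S)) ->
    exists m : X -> int, [/\ forall e, e \in D -> al e * m (a e) + ga e * m (c e) = - A v e,
     \sum_z m z ^+ 2 <= 2 & forall x, x \in S -> m x = P x].
  move=> DH S3 D1 hD; have [m hm nm] := loc S D DH S3 D1 hD.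
  exists m; split=> // [e eD|x xS]; first by apply: hm; rewrite in_setU eD orbT.
  have [xC cC sF _ [eF xF]] := hCF x; have [hMx nMx] := hM x.
  apply: (potential_unique (al := al) (ga := ga) (q := M x) eF _ xF) => //.
  - by move=> e /(subsetP sF); exact: rpm.
  - move=> e eF'; rewrite hMx // hm // in_setU; apply/orP; left; apply/bigcupP; by exists x.
  - by rewrite cC ltnS; apply: leq_trans (ltnW n40).
exists P.
  move=> e eH.
  have [||||m [hm _ mP]] := locP [set a e; c e] [set e]; rewrite ?sub1set ?cards1 //.
  - by rewrite cards2; case: (_ != _).
  - by move=> f; rewrite inE => /eqP ->; rewrite !inE !eqxx orbT.
  by rewrite -!mP ?hm // !inE eqxx ?orbT.
rewrite leNgt; apply/negP => hP.
have P1 x : -1 <= P x <= 1.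
  have [m [_ nm mP]] : exists m : X -> int, [/\ forall e, e \in set0 -> al e * m (a e) + ga e * m (c e) = - A v e,
     \sum_z m z ^+ 2 <= 2 & forall y, y \in [set x] -> m y = P y].
    by apply: locP; rewrite ?sub0set ?cards1 ?cards0 // => e; rewrite in_set0.
  have : m x ^+ 2 <= 2.
    by apply: le_trans nm; rewrite (bigD1 x) //= lerDl; apply: sumr_ge0 => z _; exact: sqr_ge0.
  by rewrite -mP ?inE //; clear; nia.
pose S := [set x | P x != 0].
have PE : \sum_z P z ^+ 2 = #|S|%:Z.
  rewrite -[RHS]natz -sum1_card natr_sum (bigID (mem S)) /= [X in _ + X]big1 ?addr0; last first.
    by move=> x; rewrite inE negbK => /eqP ->.
  apply: eq_bigr => x; rewrite inE => P0.
  by case: (int_small (P1 x)) P0 => [->|[->|->]].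
rewrite PE ltz_nat in hP.
have [B sB cB] := exists_subset hP.
have [|||| m [_ nm mP]] := locP B set0; rewrite ?sub0set ?cB ?cards0 //.
  by move=> e; rewrite in_set0.
have : (#|[set z | m z != 0%R]| <= 2)%N by exact: card_supp_le.
have : (#|B| <= #|[set z | m z != 0%R]|)%N.
  apply: subset_leq_card; apply/subsetP => x xB; rewrite inE mP //.
  by have := subsetP sB x xB; rewrite inE.
by rewrite cB => h1 h2; have := leq_trans h1 h2.
Qed.

Definition line_graph (V : finType) (A : V -> V -> int) (H : {set V}) (k : nat) : Prop :=
  exists (X : finType) (a c : V -> X) (al ga : V -> int),
    [/\ line_rep a c al ga A H, cut_connected a c H & (k < #|X|)%N].

Lemma small_int_vector (X : finType) (P : X -> int) :
  \sum_z P z ^+ 2 <= 2 -> (exists x, P x != 0) ->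
  exists2 i, pm1 (P i) & (forall z, z != i -> P z = 0) \/
    exists2 j, (j != i) && pm1 (P j) & forall z, z != i -> z != j -> P z = 0.
Proof.
have sq_pm1 (z s : int) : z != 0 -> 0 <= s -> z ^+ 2 + s <= 2 -> pm1 z /\ s <= 1.
  rewrite /pm1 => z0 s0 h; have h1 : z * z + s <= 2 by rewrite -expr2.
  by split; nia.
have sq_pos (z : int) : z != 0 -> 1 <= z ^+ 2 by rewrite expr2; nia.
move=> hP [i i0]; move: hP; rewrite (bigD1 i) //= => hP.
have [|pi h1] := sq_pm1 _ _ i0 _ hP; first by apply: sumr_ge0 => z _; exact: sqr_ge0.
exists i => //; have [/existsP [j /andP [ji j0]]|none] := boolP [exists j, (j != i) && (P j != 0)].
  move: h1; rewrite (bigD1 j) //= => h1; right.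
  have s0 : 0 <= \sum_(z | (z != i) && (z != j)) P z ^+ 2.
    by apply: sumr_ge0 => z _; exact: sqr_ge0.
  have pj : pm1 (P j).
    by have [|] := sq_pm1 (P j) _ j0 s0 => //; apply: le_trans h1 _.
  exists j; first by rewrite ji.
  move=> z zi zj; apply/eqP; apply: contraT => z0.
  move: h1; rewrite (bigD1 z) /= ?zi // => h1.
  have := sq_pos _ z0; have := sq_pos _ j0.
  have : 0 <= \sum_(z0 | (z0 != i) && (z0 != j) && (z0 != z)) P z0 ^+ 2.
    by apply: sumr_ge0 => w _; exact: sqr_ge0.
  by move: (\sum_(_ | _) _) (P j ^+ 2) (P z ^+ 2) h1 => u w w'; clear; lia.
left => z zi; apply/eqP; apply: contraNT none => z0.
by apply/existsP; exists z; rewrite zi.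
Qed.

Lemma gramE (V X : finType) (a c : V -> X) (al ga : V -> int) e (F : X -> int) :
  \sum_z evec a c al ga z e * F z = al e * F (a e) + ga e * F (c e).
Proof.
transitivity (\sum_z (evec a c al ga z e)%:~R * F z).
  by apply: eq_bigr => z _; rewrite intz.
by rewrite sum_evec !intz.
Qed.

Lemma line_rep_add (V X X' : finType) (A : V -> V -> int) (a c : V -> X) (a' c' : V -> X')
    (al ga al' ga' : V -> int) (H : {set V}) (v : V) (h : X -> X') :
  signed_mx A -> injective h -> line_rep a c al ga A H -> v \notin H ->
  (forall e, e \in H -> [/\ a' e = h (a e), c' e = h (c e), al' e = al e & ga' e = ga e]) ->
  a' v != c' v -> pm1 (al' v) -> pm1 (ga' v) ->
  (forall e, e \in H -> al e * evec a' c' al' ga' (h (a e)) v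
      + ga e * evec a' c' al' ga' (h (c e)) v = - A v e) ->
  line_rep a' c' al' ga' A (v |: H).
Proof.
move=> [Asym _ _] hI [h1 h2 h3 h4] vH E acv pav pcv dv; split.
- move=> e; rewrite in_setU1 => /orP [/eqP -> //|eH].
  by have [-> -> _ _] := E e eH; rewrite (inj_eq hI) h1.
- move=> e; rewrite in_setU1 => /orP [/eqP -> //|eH].
  by have [_ _ -> _] := E e eH; rewrite h2.
- move=> e; rewrite in_setU1 => /orP [/eqP -> //|eH].
  by have [_ _ _ ->] := E e eH; rewrite h3.
have gv e : e \in H -> \sum_z evec a' c' al' ga' z e * evec a' c' al' ga' z v = - A v e.
  by move=> eH; rewrite gramE; have [-> -> -> ->] := E e eH; rewrite dv.
move=> e f; rewrite !in_setU1 => /orP [/eqP ->|eH] /orP [/eqP ->|fH].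
- by rewrite eqxx.
- by move=> _; under eq_bigr do rewrite mulrC; rewrite gv.
- by rewrite gv // Asym.
move=> ef; rewrite -h4 // !gramE.
have [-> -> -> ->] := E e eH.
have ev z : evec a' c' al' ga' (h z) f = evec a c al ga z f.
  by have [ea ec ea' ec'] := E f fH; rewrite /evec ea ec ea' ec' !(inj_eq hI).
by rewrite !ev.
Qed.

Lemma line_graph_add (V X : finType) (A : V -> V -> int) (a c : V -> X)
    (al ga : V -> int) (H : {set V}) (v : V) (k : nat) (P : X -> int) :
  signed_mx A -> line_rep a c al ga A H -> cut_connected a c H -> (k < #|X|)%N ->
  v \notin H -> (exists2 f, f \in H & A v f != 0) ->
  (forall e, e \in H -> al e * P (a e) + ga e * P (c e) = - A v e) ->
  \sum_z P z ^+ 2 <= 2 -> line_graph A (v |: H) k.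
Proof.
move=> sA rH cH kX vH [f fH Af] hP nP.
have [|i pi hi] := small_int_vector nP.
  apply: contrapT => nex; case/negP: Af; rewrite -oppr_eq0 -hP //.
  have P0 x : P x = 0 by apply/eqP; apply: contra_notT nex => h; exists x.
  by rewrite !P0 !mulr0 addr0.
have nv e : e \in H -> (e == v) = false.
  by move=> eH; apply: contraNF vH => /eqP <-.
(* If the new vector has a single coordinate, its second end is a new root vertex [None], and [v]
   becomes a pendant edge. *)
case: hi => [Pz|[j /andP [ji pj] Pz]].
  exists (option X), (fun e => Some (if e == v then i else a e)),
    (fun e => if e == v then None else Some (c e)),
    (fun e => if e == v then P i else al e), (fun e => if e == v then 1 else ga e).
  split.
  - have sI : injective (@Some X) by exact: Some_inj.
    apply: (@line_rep_add _ _ _ _ a c _ _ al ga _ _ _ _ _ sA sI rH vH); rewrite ?eqxx //.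
      by move=> e /nv ->.
    move=> e eH; rewrite -hP // /evec !eqxx.
    have PE z : P i *+ (Some z == Some i) + 1 *+ (Some z == None) = P z.
      rewrite addr0 (inj_eq sI); have [->//|zi] := eqVneq z i.
      by rewrite (Pz z).
    by rewrite !PE.
  - move=> Y Y0 YT; pose Z := [set x | Some x \in Y].
    have [Z0|Z0] := eqVneq Z set0.
      have Sn x : (Some x \in Y) = false by have := in_set0 x; rewrite -Z0 inE.
      exists v; first by rewrite in_setU1 eqxx.
      rewrite !eqxx Sn; case/set0Pn: Y0 => -[y|->//]; by rewrite Sn.
    have [ZT|ZT] := eqVneq Z setT.
      have Sn x : (Some x \in Y) = true by have := in_setT x; rewrite -ZT inE.
      exists v; first by rewrite in_setU1 eqxx.
      rewrite !eqxx Sn; apply: contra YT => /eqP YN; apply/eqP/setP => -[y|]; by rewrite inE ?Sn.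
    have [e eH ce] := cH Z Z0 ZT; exists e; first by rewrite in_setU1 eH orbT.
    by move: ce; rewrite !inE nv.
  - by rewrite card_option ltnW.
exists X, (fun e => if e == v then i else a e),
    (fun e => if e == v then j else c e),
    (fun e => if e == v then P i else al e), (fun e => if e == v then P j else ga e).
split=> //.
- have idI : injective (@id X) by [].
  apply: (@line_rep_add _ _ _ _ a c _ _ al ga _ _ _ _ _ sA idI rH vH); rewrite ?eqxx //.
  + by move=> e /nv ->.
  + by rewrite eq_sym.
  move=> e eH; rewrite -hP // /evec !eqxx.
  have PE z : P i *+ (z == i) + P j *+ (z == j) = P z.
    have [->|zi] := eqVneq z i; first by rewrite eq_sym (negPf ji) addr0.
    by have [->|zj] := eqVneq z j; rewrite add0r // (Pz z).
  by rewrite !PE.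
move=> Y Y0 YT; have [e eH ce] := cH Y Y0 YT; exists e; first by rewrite in_setU1 eH orbT.
by rewrite nv.
Qed.

(** * Induced paths and cliques in large connected sets *)

Section InducedPath.
Variables (V : finType) (e : rel V) (S : {set V}) (v0 : V).

Definition ball i : {set V} :=
  iter i (fun B => B :|: [set y in S | [exists x in B, e x y]]) [set v0].

Lemma ball_S i : ball i \subset ball i.+1.
Proof. exact: subsetUl. Qed.

Lemma ball_le i j : (i <= j)%N -> ball i \subset ball j.
Proof.
by elim: j => [|j IH]; [case: i|rewrite leq_eqVlt => /predU1P [->//|/IH h];
  apply: subset_trans h (ball_S j)].
Qed.

Lemma ball_next i x y : x \in ball i -> y \in S -> e x y -> y \in ball i.+1.
Proof.
by move=> xB yS xy; rewrite inE; apply/orP; right; rewrite inE yS; apply/exists_inP; exists x.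
Qed.

Lemma ball_sub i : v0 \in S -> ball i \subset S.
Proof.
move=> v0S; elim: i => [|i IH]; first by rewrite sub1set.
by rewrite subUset IH; apply/subsetP => y; rewrite inE => /andP [].
Qed.

Lemma ball_trace l w : w \in ball l.+1 -> w \notin ball l ->
  exists f : nat -> V, [/\ f 0%N = v0, f l.+1 = w,
    forall i, (i <= l.+1)%N -> f i \in ball i,
    forall i, (i <= l)%N -> f i.+1 \notin ball i
    & forall i, (i <= l)%N -> e (f i) (f i.+1)].
Proof.
elim: l w => [|l IH] w wB wN.
  move: (wB); rewrite in_setU (negPf wN) inE /= => /andP [wS /exists_inP [x]].
  rewrite inE => /eqP -> vw; exists (fun i => if i == 0%N then v0 else w); split=> //.
  - by case=> [|[|i]] // _; rewrite ?set11.
  - by case.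
  - by case.
have [x xB xw] : exists2 x, x \in ball l.+1 & e x w.
  by move: wB; rewrite in_setU (negPf wN) inE /= => /andP [_ /exists_inP].
have wS : w \in S by move: wB; rewrite in_setU (negPf wN) inE => /andP [].
have xN : x \notin ball l by apply: contra wN => xB'; exact: ball_next xB' wS xw.
have [f [f0 fl fB fN fe]] := IH x xB xN.
exists (fun i => if (i <= l.+1)%N then f i else w); split=> //.
- by rewrite ltnn.
- move=> i il2; case: (leqP i l.+1) => il; first exact: fB.
  have -> : i = l.+2 by lia.
  exact: wB.
- move=> i il2; case: (ltnP i l.+1) => il; first exact: fN.
  have -> : i = l.+1 by lia.
  exact: wN.
- move=> i il2; rewrite il2; case: (ltnP i l.+1) => il; first exact: fe.
  have -> : i = l.+1 by lia.
  by rewrite fl.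
Qed.

Lemma card_ball i m : (forall x, x \in S -> (#|[set y in S | e x y]| <= m)%N) ->
  v0 \in S -> (#|ball i| <= m.+1 ^ i)%N.
Proof.
move=> hm v0S; elim: i => [|i IH]; first by rewrite cards1 expn0.
apply: leq_trans (leq_card_setU _ _) _; rewrite expnS mulSn; apply: leq_add => //.
apply: (@leq_trans #|\bigcup_(x in ball i) [set y in S | e x y]|).
  apply: subset_leq_card; apply/subsetP => y; rewrite inE => /andP [yS /exists_inP [x xB xy]].
  by apply/bigcupP; exists x => //; rewrite inE yS.
apply: (@leq_trans (#|ball i| * m)); last by rewrite mulnC leq_mul2l IH orbT.
by apply: card_bigcup_le => x xB; apply: hm; apply: (subsetP (ball_sub i v0S)).
Qed.

Lemma ball_grow i :
  (forall T : {set V}, T \subset S -> T != set0 -> T != S ->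
     exists u v, [/\ u \in T, v \in S, v \notin T & e u v]) ->
  v0 \in S -> ball i != S -> exists2 w, w \in ball i.+1 & w \notin ball i.
Proof.
move=> hc v0S bS; have [|u [v [uB vS vB uv]]] := hc (ball i) (ball_sub i v0S) _ bS.
  by apply/set0Pn; exists v0; apply: (subsetP (ball_le (leq0n i))); rewrite inE.
by exists v => //; apply: ball_next uv.
Qed.

End InducedPath.

(** The degree bound keeps the balls small, so some vertex is at distance [L.+1] from the start. A
    shortest path to it has no chords. *)
Lemma induced_path (V : finType) (e : rel V) (S : {set V}) (m L : nat) :
  (forall T : {set V}, T \subset S -> T != set0 -> T != S ->
     exists u v, [/\ u \in T, v \in S, v \notin T & e u v]) ->
  (forall x, x \in S -> (#|[set y in S | e x y]| <= m)%N) ->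
  (m.+1 ^ L < #|S|)%N ->
  exists f : nat -> V, [/\ forall i, (i <= L)%N -> f i \in S,
    forall i, (i < L)%N -> e (f i) (f i.+1)
    & forall i j, (i < j <= L)%N -> f i != f j /\ ((i.+1 < j)%N -> ~~ e (f i) (f j))].
Proof.
move=> hc hm hS.
have /card_gt0P [v0 v0S] : (0 < #|S|)%N by apply: leq_ltn_trans hS.
have bS : ball e S v0 L != S.
  by apply: contraTneq hS => <-; rewrite -leqNgt; exact: card_ball.
have [w wB wN] := ball_grow hc v0S bS.
have [f [f0 fl fB fN fe]] := ball_trace wB wN.
exists f; split.
- by move=> i iL; apply: (subsetP (ball_sub e i v0S)); apply: fB; apply: leqW.
- by move=> i iL; apply: fe; apply: ltnW.
move=> i [//|j] /andP [ij jL]; rewrite ltnS in ij; have jN := fN j (ltnW jL).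
have fi : f i \in ball e S v0 i by apply: fB; lia.
split.
  by apply: contraNneq jN => <-; apply: (subsetP (ball_le e S v0 ij)).
move=> ij'; apply: contra jN => fij.
apply: (subsetP (ball_le e S v0 (i := i.+1) (j := j) ij')).
apply: ball_next fi _ fij; apply: (subsetP (ball_sub e j.+1 v0S)); apply: fB.
exact: leqW.
Qed.

Section Ramsey.
Variables (V : finType) (A : V -> V -> int).
Hypothesis sA : signed_mx A.

Definition clique (z : int) (K : {set V}) :=
  [forall x in K, forall y in K, (x != y) ==> (A x y == z)].

Lemma cliqueP z (K : {set V}) : reflect (forall x y, x \in K -> y \in K -> x != y -> A x y = z) (clique z K).
Proof.
apply: (iffP forall_inP) => [h x y xK yK xy|h x xK].
  by have /forall_inP /(_ y yK) := h x xK; rewrite xy => /eqP.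
by apply/forall_inP => y yK; apply/implyP => xy; apply/eqP; exact: h.
Qed.

Lemma clique_add z (K : {set V}) i : clique z K -> (forall y, y \in K -> A i y = z) -> clique z (i |: K).
Proof.
have [Asym _ _] := sA.
move=> /cliqueP hK hi; apply/cliqueP => x y; rewrite !in_setU1.
move=> /orP [/eqP ->|xK] /orP [/eqP ->|yK] xy; rewrite ?eqxx // in xy *; [exact: hi| |exact: hK].
by rewrite Asym hi.
Qed.

(** A maximal independent set has at most four vertices, and their neighbourhoods cover the rest of
    [S]. So one of at most eight signed neighbourhoods keeps a tenth of [S], and the induction
    continues there. *)
Lemma ramsey_signed k l (S : {set V}) :
  (forall I : {set V}, I \subset S -> clique 0 I -> (#|I| <= 4)%N) ->
  (10 ^ (k + l) <= #|S|)%N ->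
  (exists2 K : {set V}, K \subset S & clique (-1) K && (#|K| == k)) \/
  (exists2 K : {set V}, K \subset S & clique 1 K && (#|K| == l)).
Proof.
have e0 z : clique z set0 by apply/cliqueP => x y; rewrite inE.
have [_ A0 A1] := sA.
move: {2}(k + l)%N (leqnn (k + l)) => r; elim: r k l S => [|r IH] k l S.
  rewrite leqn0 addn_eq0 => /andP [/eqP -> _] _ _; left.
  by exists set0; rewrite ?sub0set // e0 cards0.
case: k => [|k]; first by move=> _ _ _; left; exists set0; rewrite ?sub0set // e0 cards0.
case: l => [|l]; first by move=> _ _ _; right; exists set0; rewrite ?sub0set // e0 cards0.
move=> kl ind cS.
have [I maxI _] : {I : {set V} | maxset (fun I => (I \subset S) && clique 0 I) I & set0 \subset I}.
  by apply: maxset_exists; rewrite sub0set e0.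
have [/andP [sI cI] mI] := maxsetP maxI.
pose N z i := [set y in S | (y != i) && (A i y == z)].
have cov : S \subset I :|: \bigcup_(i in I) (N 1 i :|: N (-1) i).
  apply/subsetP => y yS; rewrite in_setU; have [//|yI /=] := boolP (y \in I).
  apply: contrapT => nc.
  have : y |: I = I.
    apply: mI; last exact: subsetUr.
    rewrite subUset sub1set yS sI /=; apply: clique_add => // i iI.
    apply/eqP; apply: contra_notT nc => Ayi; apply/bigcupP; exists i => //.
    have yi : y != i by apply: contraNneq yI => ->.
    rewrite !inE yS yi /=; case: sA => Asym _ _; rewrite Asym in Ayi.
    by have := A1 i y; move: Ayi; clear; lia.
  by move/setP/(_ y); rewrite in_setU1 eqxx (negPf yI).
have step z i : i \in I -> forall K : {set V}, K \subset N z i -> clique z K -> forall q, #|K| = q ->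
   (i |: K \subset S) /\ clique z (i |: K) && (#|i |: K| == q.+1).
  move=> iI K sK cK q cq; split.
    rewrite subUset sub1set (subsetP sI) //=; apply: subset_trans sK _.
    by apply/subsetP => y; rewrite inE => /andP [].
  rewrite clique_add //= ?cardsU1 ?cq; last first.
    by move=> y /(subsetP sK); rewrite !inE => /and3P [_ _ /eqP].
  by have -> : i \notin K; [apply/negP => /(subsetP sK); rewrite !inE eqxx andbF|rewrite add1n].
have small z i : N z i \subset S by apply/subsetP => y; rewrite inE => /andP [].
have ind' z i (J : {set V}) : J \subset N z i -> clique 0 J -> (#|J| <= 4)%N.
  by move=> sJ; apply: ind; apply: subset_trans sJ (small z i).
have [/existsP [i /andP [iI ci]]|none] :=
    boolP [exists i, (i \in I) && (10 ^ (k + l.+1) <= #|N (-1)%R i|)%N].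
  have [|[K sK /andP [cK /eqP cq]]|[K sK h]] := IH k l.+1 (N (-1) i) _ (ind' _ i) ci.
  - by rewrite addSn ltnS in kl.
  - by left; have [h1 h2] := step (-1) i iI K sK cK k cq; exists (i |: K).
  - by right; exists K => //; apply: subset_trans sK (small _ i).
have [/existsP [i /andP [iI ci]]|none'] :=
    boolP [exists i, (i \in I) && (10 ^ (k.+1 + l) <= #|N 1%R i|)%N].
  have [|[K sK h]|[K sK /andP [cK /eqP cq]]] := IH k.+1 l (N 1 i) _ (ind' _ i) ci.
  - by rewrite addnS ltnS in kl.
  - by left; exists K => //; apply: subset_trans sK (small _ i).
  - by right; have [h1 h2] := step 1 i iI K sK cK l cq; exists (i |: K).
exfalso; move: cS; apply/negP; rewrite -ltnNge.
pose T := (10 ^ (k + l).+1)%N.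
have T0 : (0 < T)%N by rewrite expn_gt0.
have hN i : i \in I -> (#|N 1%R i :|: N (-1)%R i| <= 2 * T.-1)%N.
  move=> iI; apply: leq_trans (leq_card_setU _ _) _.
  have h1 : (#|N (-1)%R i| < T)%N.
    rewrite ltnNge; apply: contra none => h; apply/existsP; exists i.
    by rewrite iI /T -addnS in h *; rewrite h.
  have h2 : (#|N 1%R i| < T)%N.
    rewrite ltnNge; apply: contra none' => h; apply/existsP; exists i.
    by rewrite iI /T -addSn in h *; rewrite h.
  by move: h1 h2; move: (#|_|) (#|_|) => u w; clear; lia.
have I4 := ind I sI cI.
have h3 : (#|S| <= 4 + 4 * (2 * T.-1))%N.
  apply: leq_trans (subset_leq_card cov) _.
  apply: leq_trans (leq_card_setU _ _) _; apply: leq_add => //.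
  by apply: leq_trans (card_bigcup_le hN) _; rewrite leq_mul2r I4 orbT.
apply: leq_ltn_trans h3 _; rewrite addSn addnS expnS -/T.
by clearbody T; clear -T0; lia.
Qed.

End Ramsey.

Section SmallForbidden.
Variables (R : realType) (V : finType) (A : V -> V -> int) (lam : R).
Hypothesis sA : signed_mx A.

Lemma signed_sqr u v : A u v != 0 -> (A u v)%:~R * (A u v)%:~R = 1 :> R.
Proof.
have [_ _ A1] := sA; move=> nz; rewrite -rmorphM /=.
by case: (int_small (A1 u v)) nz => [->|[->|->]].
Qed.

(** With 2 at the centre and the edge signs at the leaves, the form is [9 * lam - 20], which is
    negative for [lam < 20 / 9]; this includes all [lam] below 2.2. *)
Lemma no_star u (I : {set V}) : u \notin I -> (forall i, i \in I -> A u i != 0) ->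
  clique A 0 I -> #|I| = 5%N -> lam < 22%:R / 10%:R -> ~ psd A lam (u |: I).
Proof.
move=> uI hI /cliqueP cI I5 hl /(_ (fun v => (if v == u then 2 else 0)
   + (if v \in I then (A u v)%:~R else 0))) h.
have [Asym A0 A1] := sA.
have : 0 <= 9%:R * lam - 20%:R; last by have := hl; lra.
apply: le_trans (h _) _.
  move=> v; rewrite in_setU1 negb_or => /andP [/negPf -> /negPf ->]; exact: addr0.
rewrite qf_lin //.
set x := fun v => if v == u then 2 else 0 : R.
set y := fun v => if v \in I then (A u v)%:~R else 0 : R.
have -> : qf A lam x = lam * 4%:R.
  rewrite /qf [X in _ - X]big1 ?subr0 => [|v _]; last first.
    rewrite big1 // => w _; rewrite /x.
    have [->|_] := eqVneq v u; last by rewrite mul0r mulr0.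
    by have [->|_] := eqVneq w u; rewrite ?A0 ?mul0r // !mulr0.
  rewrite (bigD1 u) //= big1 => [|v /negPf vu]; last by rewrite /x vu expr0n.
  by rewrite /x eqxx addr0 -natrX.
have -> : qf A lam y = lam * 5%:R.
  rewrite /qf [X in _ - X]big1 ?subr0 => [|v _]; last first.
    rewrite big1 // => w _; rewrite /y.
    case: ifP => vI; last by rewrite mul0r mulr0.
    case: ifP => wI; last by rewrite !mulr0.
    have -> : A v w = 0 by have [->|vw] := eqVneq v w; [exact: A0|exact: cI].
    by rewrite mul0r.
  congr (_ * _); rewrite -I5 -sum1_card natr_sum [RHS]big_mkcond /=.
  apply: eq_bigr => v _; rewrite /y; case: ifP => vI; last by rewrite expr0n.
  by rewrite expr2 signed_sqr // hI.
have -> : \sum_v x v * y v = 0.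
  rewrite big1 // => v _; rewrite /x /y.
  by have [->|_] := eqVneq v u; rewrite ?(negPf uI) ?mulr0 ?mul0r.
have -> : \sum_v \sum_w (A v w)%:~R * (x v * y w) = 10%:R.
  rewrite (bigD1 u) //= [X in _ + X]big1 ?addr0 => [|v /negPf vu]; last first.
    by rewrite big1 // => w _; rewrite /x vu mul0r mulr0.
  rewrite (_ : 10%N = (5 * 2)%N) // natrM -I5 -sum1_card natr_sum mulr_suml [RHS]big_mkcond /=.
  apply: eq_bigr => v _; rewrite /x /y eqxx; case: ifP => vI; last by rewrite !mulr0.
  by rewrite mulrCA signed_sqr ?hI // mulr1 mul1r.
lra.
Qed.

Lemma no_positive_K4 (K : {set V}) : clique A 1 K -> #|K| = 4%N -> lam < 3%:R ->
  ~ psd A lam K.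
Proof.
move=> /cliqueP cK K4 hl /(_ (fun v => if v \in K then 1 else 0)) h.
have [Asym A0 A1] := sA.
have : 0 <= 4%:R * lam - 12%:R; last by have := hl; lra.
apply: le_trans (h _) _; first by move=> v /negPf ->.
rewrite /qf.
have -> : \sum_v (if v \in K then 1 else 0) ^+ 2 = 4%:R :> R.
  rewrite -K4 -sum1_card natr_sum [RHS]big_mkcond /=.
  by apply: eq_bigr => v _; case: ifP => _; rewrite ?expr1n ?expr0n.
have -> : \sum_v \sum_w (A v w)%:~R * ((if v \in K then 1 else 0) * (if w \in K then 1 else 0)) = 12%:R :> R.
  rewrite (_ : 12%N = (4 * 3)%N) // natrM -{1}K4 -sum1_card natr_sum mulr_suml [RHS]big_mkcond /=.
  apply: eq_bigr => v _; case: ifP => vK; last by rewrite big1 // => w _; rewrite mul0r mulr0.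
  have -> : 3%N = #|K :\ v| by move: K4; rewrite (cardsD1 v) vK => -[].
  rewrite mul1r -sum1_card natr_sum [RHS]big_mkcond /=; apply: eq_bigr => w _.
  rewrite in_setD1; have [->|wv] := eqVneq w v; first by rewrite A0 mul0r.
  by case: ifP => wK /=; rewrite ?mulr0 // cK // 1?eq_sym // !mul1r.
lra.
Qed.

End SmallForbidden.

Section Cores.
Variables (V : finType) (A : V -> V -> int).
Hypothesis sA : signed_mx A.

(** The root graph is a star with centre [ord0]: any two of its edges share the centre and have
    inner product 1. *)
Lemma negative_clique_line_graph (K : {set V}) k : clique A (-1) K -> (k <= #|K|)%N ->
  line_graph A K k.
Proof.
move=> /cliqueP cK kK; pose N := #|K|.
pose idx (v : V) : 'I_N.+1 := inord (index v (enum K)).+1.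
have idxE v : v \in K -> idx v = (index v (enum K)).+1 :> nat.
  move=> vK; rewrite inordK // ltnS /N cardE index_mem mem_enum //.
have idx0 v : v \in K -> (ord0 == idx v) = false.
  by move=> vK; rewrite -val_eqE /= idxE.
exists 'I_N.+1, (fun=> ord0), idx, (fun=> 1), (fun=> 1); split.
- split=> // [e eK|e f eK fK ef]; first by rewrite idx0.
  rewrite gramE /evec !mul1r !eqxx [idx e == ord0]eq_sym !idx0 //.
  rewrite [idx e == idx f](_ : _ = false) ?cK ?opprK ?mulr0n ?addr0 //.
  apply/negP => /eqP /(congr1 val) /=; rewrite !idxE // => -[h].
  case/negP: ef; apply/eqP; rewrite -(nth_index e (s := enum K) (x := e)) ?mem_enum //.
  by rewrite h nth_index ?mem_enum.
- move=> Y Y0 YT.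
  have idx_onto z : z != ord0 -> exists2 v, v \in K & idx v = z.
    move=> z0; have zp : (z.-1 < size (enum K))%N.
      by rewrite -cardE -/N; have := ltn_ord z; move: z0; rewrite -val_eqE /=; lia.
    have /card_gt0P [v0 _] : (0 < #|K|)%N by rewrite cardE; apply: leq_ltn_trans zp.
    have nK : nth v0 (enum K) z.-1 \in K by rewrite -mem_enum mem_nth.
    exists (nth v0 (enum K) z.-1) => //.
    apply: val_inj; rewrite /= (idxE _ nK) (index_uniq _ zp (enum_uniq _)).
    by move: z0; rewrite -val_eqE /=; lia.
  have [o0|o0] := boolP (ord0 \in Y).
    have [z zY] : exists z, z \notin Y.
      apply: contrapT => h; case/negP: YT; apply/eqP/setP => z; rewrite in_setT.
      by apply: contrapT => /negP zY; apply: h; exists z.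
    have [|v vK vz] := idx_onto z; first by apply: contraNneq zY => ->.
    by exists v => //=; rewrite vz (negPf zY).
  case/set0Pn: Y0 => z zY; have [|v vK vz] := idx_onto z; first by apply: contraTneq zY => ->.
  by exists v => //=; rewrite vz zY.
- by rewrite card_ord.
Qed.

(** The root graph is again a path, with one more vertex; any signs can be realised because
    consecutive edges meet in just one end. *)
Lemma induced_path_line_graph (f : nat -> V) (L : nat) :
  (forall i, (i < L)%N -> A (f i) (f i.+1) != 0) ->
  (forall i j, (i < j <= L)%N -> f i != f j /\ ((i.+1 < j)%N -> A (f i) (f j) = 0)) ->
  line_graph A [set f i | i : 'I_L.+1] L.
Proof.
move=> h1 h2; have [Asym A0 A1] := sA.
pose idx (v : V) : nat := index v [seq f i | i <- iota 0 L.+1].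
have f_inj i j : (i <= L)%N -> (j <= L)%N -> f i = f j -> i = j.
  move=> iL jL fij; case: (ltngtP i j) => // ij.
    by have [|nij _] := h2 i j; [rewrite ij|rewrite fij eqxx in nij].
  by have [|nij _] := h2 j i; [rewrite ij|rewrite fij eqxx in nij].
have us : uniq [seq f i | i <- iota 0 L.+1].
  rewrite map_inj_in_uniq ?iota_uniq // => i j; rewrite !mem_iota /= !add0n !ltnS.
  exact: f_inj.
have fidx i : (i <= L)%N -> idx (f i) = i.
  move=> iL; rewrite /idx -[X in index X](_ : nth (f 0%N) [seq f i | i <- iota 0 L.+1] i = f i).
    by rewrite index_uniq // size_map size_iota ltnS.
  by rewrite (nth_map 0%N) ?size_iota ?ltnS // nth_iota ?ltnS.
(* The sign of edge [i] at the end that it shares with edge [i - 1], whose own sign there is 1. *)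
pose sg := fix sg i : int := if i is j.+1 then - A (f j) (f j.+1) else 1.
have sg_pm i : (i <= L)%N -> (sg i == 1) || (sg i == -1).
  case: i => [//|i] iL /=; have := A1 (f i) (f i.+1); have := h1 i iL.
  by move: (A _ _) => z; clear; lia.
have inH e : e \in [set f i | i : 'I_L.+1] -> exists2 i, (i <= L)%N & e = f i.
  by case/imsetP => i _ ->; exists i; rewrite // -ltnS.
exists 'I_L.+2, (fun v => inord (idx v)), (fun v => inord (idx v).+1),
  (fun v => sg (idx v)), (fun=> 1).
have eqI i j : (i <= L.+1)%N -> (j <= L.+1)%N ->
    ((inord i : 'I_L.+2) == inord j) = (i == j).
  by move=> iL jL; rewrite -val_eqE /= !inordK.
split.
- have gram i j : (i < j <= L)%N -> \sum_z
       evec (fun v => inord (idx v) : 'I_L.+2) (fun v => inord (idx v).+1) (fun v => sg (idx v)) (fun=> 1) z (f i)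
     * evec (fun v => inord (idx v) : 'I_L.+2) (fun v => inord (idx v).+1) (fun v => sg (idx v)) (fun=> 1) z (f j)
     = - A (f i) (f j).
    move=> /andP [ij jL]; have iL : (i <= L)%N by apply: leq_trans (ltnW ij) jL.
    rewrite gramE /evec !fidx // !eqI //; try by rewrite ?ltnS // leqW.
    rewrite (ltn_eqF ij) eqSS (ltn_eqF ij) ltn_eqF; last by rewrite ltnS ltnW.
    rewrite !mulr0n !addr0 mulr0 add0r mul1r.
    case: (eqVneq i.+1 j) => [<-//|ij']; rewrite mulr0n.
    have [|_ hij] := h2 i j; first by rewrite ij.
    by rewrite hij ?oppr0 // ltn_neqAle ij' ij.
  split.
  + by move=> e /inH [i iL ->]; rewrite fidx // eqI ?ltnS // 1?leqW // ltn_eqF.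
  + by move=> e /inH [i iL ->]; rewrite fidx // sg_pm.
  + by [].
  move=> e e' /inH [i iL ->] /inH [j jL ->] ff; case: (ltngtP i j) => ij.
  + by rewrite gram // ij.
  + by under eq_bigr do rewrite mulrC; rewrite gram ?ij // Asym.
  + by move: ff; rewrite ij eqxx.
- move=> Y Y0 YT; apply: contrapT => nex.
  have step i : (i <= L)%N -> ((inord i : 'I_L.+2) \in Y) = ((inord i.+1 : 'I_L.+2) \in Y).
    move=> iL; apply/eqP; apply: contra_notT nex => h; exists (f i); rewrite ?fidx //.
    by apply/imsetP; exists (Ordinal (iL : (i < L.+1)%N)).
  have all i : (i <= L.+1)%N -> ((inord i : 'I_L.+2) \in Y) = ((inord 0 : 'I_L.+2) \in Y).
    by elim: i => [//|i IH] iL; rewrite -step // IH // ltnW.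
  have all' (z : 'I_L.+2) : (z \in Y) = ((inord 0 : 'I_L.+2) \in Y).
    by rewrite -(all z) ?inord_val // -ltnS.
  case/set0Pn: Y0 => z zY; case/negP: YT; apply/eqP/setP => w.
  by rewrite in_setT all' -(all' z).
- by rewrite card_ord.
Qed.

End Cores.

(** The first term yields an induced path; the others exceed the [3 * n + 2] vertices used for one
    extension step and the six vertices of a forbidden star. *)
Definition core_bound (n : nat) : nat := ((10 ^ (n + 4)).+1 ^ n + 3 * n + 7)%N.

Section Growth.
Variables (R : realType) (V : finType) (A : V -> V -> int) (lam : R) (S : {set V}).
Hypotheses (sA : signed_mx A) (cS : critical A lam S).

Lemma critical_psd (T : {set V}) : T \subset S -> (#|T| < #|S|)%N -> psd A lam T.
Proof.
move=> sT hT; apply: cS.2; rewrite properEneq sT andbT.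
by apply: contraTneq hT => ->; rewrite ltnn.
Qed.

Lemma core_exists n : lam < 22%:R / 10%:R -> (core_bound n < #|S|)%N ->
  exists2 C : {set V}, C \subset S & line_graph A C n.
Proof.
move=> hl hS; have [Asym A0 A1] := sA.
pose Nb u := [set y in S | A u y != 0].
have small (T : {set V}) : T \subset S -> (#|T| <= 6)%N -> psd A lam T.
  move=> sT T6; apply: critical_psd => //; apply: leq_ltn_trans T6 _.
  by move: hS; rewrite /core_bound; apply: leq_ltn_trans; rewrite addnC; apply: leq_trans (leq_addr _ _).
have sNb u : Nb u \subset S by apply/subsetP => y; rewrite inE => /andP [].
have [/existsP [u /andP [uS hu]]|none] := boolP [exists u, (u \in S) && (10 ^ (n + 4) <= #|Nb u|)%N].
  have [||[K sK /andP [cK /eqP nK]]|[K sK /andP [cK /eqP nK]]] := @ramsey_signed _ _ sA n 4 (Nb u).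
  - move=> I sI cI; rewrite leqNgt; apply/negP => I5.
    have [I' sI' nI'] := exists_subset I5.
    have sI'N := subset_trans sI' sI.
    apply: (@no_star R V A lam sA u I') => //.
    + by apply/negP => /(subsetP sI'N); rewrite inE A0 eqxx andbF.
    + by move=> i /(subsetP sI'N); rewrite inE => /andP [].
    + apply/cliqueP => x y xI yI xy; move/cliqueP: cI; apply => //; exact: (subsetP sI').
    + apply: small; first by rewrite subUset sub1set uS /=; exact: subset_trans sI'N (sNb u).
      by rewrite cardsU1 nI'; case: (u \notin I').
  - exact: hu.
  - exists K; first exact: subset_trans sK (sNb u).
    by apply: negative_clique_line_graph => //; rewrite nK.
  - exfalso; apply: (@no_positive_K4 R V A lam sA K) => //; first by lra.
    by apply: small; [exact: subset_trans sK (sNb u)|rewrite nK].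
have [||| f [fS fe fn]] := @induced_path V (fun x y => A x y != 0) S (10 ^ (n + 4)) n.
- move=> T sT T0 TS; exact: critical_connected sA cS sT T0 TS.
- move=> x xS; rewrite leqNgt; apply: contra none => h; apply/existsP; exists x.
  by rewrite xS ltnW.
- by move: hS; rewrite /core_bound; apply: leq_ltn_trans; rewrite -addnA leq_addr.
exists [set f i | i : 'I_n.+1]; first by apply/subsetP => _ /imsetP [i _ ->]; apply: fS; rewrite -ltnS.
apply: induced_path_line_graph => // i j hij; have [h1 h2] := fn i j hij; split=> // h.
by apply/eqP; rewrite -[_ == _]negbK h2.
Qed.

Lemma line_graph_grow (t : R) n (C : {set V}) :
  1 < t -> t ^+ 6 < t ^+ 2 + 1 -> large_order t n -> lam <= t + t^-1 ->
  (3 * n + 2 < #|S|)%N -> C \subset S -> line_graph A C n -> line_graph A S n.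
Proof.
move=> t1 tu hn hlam hS sC gC.
pose P := [pred H : {set V} | (H \subset S) && `[< line_graph A H n >]].
have [|H /maxsetP [/andP [sH /asboolP gH] mH] sCH] := @maxset_exists _ P C.
  by rewrite /= sC; apply/asboolP.
have [HS|HS] := eqVneq H S; first by rewrite -HS.
have n40 : (40 < n)%N by case: hn => eta _ [].
have [X [a [c [al [ga [rH cH nX]]]]]] := gH.
have H0 : H != set0.
  have /card_gt0P [x _] : (0 < #|X|)%N by apply: leq_ltn_trans nX.
  have [||e eH _] := cH [set x].
  - by apply/set0Pn; exists x; rewrite inE.
  - by apply: contraTneq nX => h; rewrite -cardsT -h cards1 -leqNgt; apply: leq_trans (ltnW n40).
  by apply/set0Pn; exists e.
have [u [v [uH vS vH Auv]]] := critical_connected sA cS sH H0 HS.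
have [Asym _ _] := sA.
have [|m hm nm] := @potential_of_local R V X A a c al ga t n H v t1 tu hn sA rH cH nX vH.
  move=> E0 sE hE; apply: (psd_le hlam); apply: critical_psd.
    by rewrite subUset sub1set vS /=; exact: subset_trans sE sH.
  rewrite cardsU1; apply: leq_ltn_trans hS.
  by apply: leq_trans (leq_add (leq_b1 _) hE) _; rewrite add1n addn2.
have gvH : line_graph A (v |: H) n.
  by apply: line_graph_add sA rH cH nX vH _ hm nm; exists u; rewrite // Asym.
have PvH : P (v |: H) by rewrite /= subUset sub1set vS sH; apply/asboolP.
by have := mH _ PvH (subsetUr _ _) => /setP /(_ v); rewrite in_setU1 eqxx (negPf vH).
Qed.

Lemma critical_line_graph (t : R) n :
  1 < t -> t ^+ 6 < t ^+ 2 + 1 -> large_order t n -> lam <= t + t^-1 ->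
  (core_bound n < #|S|)%N -> line_graph A S n.
Proof.
move=> t1 tu hn hlam hS.
have [|C sC gC] := core_exists _ hS; first by have := eps_lt t1 tu; lra.
apply: (line_graph_grow t1 tu hn hlam _ sC gC); apply: leq_ltn_trans hS.
by rewrite /core_bound; apply: leq_add; rewrite ?leq_addl.
Qed.

End Growth.

(** * Bounds smaller than 2 *)

Section RootGraph.
Variables (R : realType) (V X : finType) (A : V -> V -> int).
Variables (a c : V -> X) (al ga : V -> int) (S : {set V}).
Hypothesis rS : line_rep a c al ga A S.
Local Notation evec := (evec a c al ga).
Local Notation vec := (vec a c al ga).

Implicit Types (T : {set X}) (x : V -> R).

Definition gram_off T e f : int := \sum_(z | z \notin T) evec z e * evec z f.

(* The quadratic form of [S] at [2 - delta], after merging the vertices of [T] with the ground. *)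
Definition grounded (T : {set X}) (delta : R) (x : V -> R) : R :=
  \sum_(z | z \notin T) vec x z ^+ 2 - delta * \sum_e x e ^+ 2.

Lemma sum_vec_off T x (p : X -> R) :
  \sum_(z | z \notin T) vec x z * p z =
  \sum_e x e * \sum_(z | z \notin T) (evec z e)%:~R * p z.
Proof.
rewrite /vec; under eq_bigr do rewrite mulr_suml.
rewrite exchange_big /=; apply: eq_bigr => e _.
by rewrite mulr_sumr; apply: eq_bigr => z _; ring.
Qed.

Lemma vec_off_gram T x e :
  \sum_(z | z \notin T) vec x z * (evec z e)%:~R = \sum_f x f * (gram_off T f e)%:~R.
Proof.
rewrite sum_vec_off; apply: eq_bigr => f _; congr (_ * _).
by rewrite /gram_off rmorph_sum; apply: eq_bigr => z _; rewrite rmorphM.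
Qed.

Lemma groundedE T delta x :
  grounded T delta x = qform (fun e f => (gram_off T e f)%:~R - delta *+ (e == f)) x.
Proof.
rewrite /grounded /qform mulr_sumr.
have -> : \sum_(z | z \notin T) vec x z ^+ 2 = \sum_e \sum_f (gram_off T e f)%:~R * (x e * x f).
  under eq_bigr do rewrite expr2.
  rewrite sum_vec_off; apply: eq_bigr => e _.
  under eq_bigr do rewrite mulrC.
  rewrite vec_off_gram mulr_sumr; apply: eq_bigr => f _.
  by rewrite /gram_off; under eq_bigr do rewrite mulrC; ring.
rewrite -sumrB; apply: eq_bigr => e _.
under [RHS]eq_bigr do rewrite mulrBl.
by rewrite sumrB sum_delta -expr2.
Qed.

Definition upd (x : V -> R) f (k : R) : V -> R := fun e => x e + k *+ (e == f).

Lemma vec_upd x f k z : vec (upd x f k) z = vec x z + (evec z f)%:~R * k.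
Proof.
rewrite /vec /upd; under eq_bigr do rewrite mulrDr.
rewrite big_split /= [X in _ + X](bigD1 f) //= eqxx mulr1n [X in _ + (_ + X)]big1 ?addr0 //.
by move=> e /negPf ->; rewrite mulr0n mulr0.
Qed.

Lemma sumsq_upd x f k : x f = 0 -> \sum_e upd x f k e ^+ 2 = \sum_e x e ^+ 2 + k ^+ 2.
Proof.
move=> xf; rewrite (bigD1 f) //= [in RHS](bigD1 f) //= /upd eqxx xf.
rewrite expr0n !add0r addrC; congr (_ + _); apply: eq_bigr => e /negPf ->.
by rewrite addr0.
Qed.

Lemma energy_upd T x f k :
  \sum_(z | z \notin T) vec (upd x f k) z ^+ 2 = \sum_(z | z \notin T) vec x z ^+ 2
   + 2 * k * (\sum_e x e * (gram_off T e f)%:~R) + (gram_off T f f)%:~R * k ^+ 2.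
Proof.
rewrite -vec_off_gram /gram_off rmorph_sum mulr_suml mulr_sumr -!big_split /=.
by apply: eq_bigr => z _; rewrite vec_upd rmorphM /=; ring.
Qed.

Lemma gram_off_le2 T e : e \in S -> gram_off T e e <= 2.
Proof.
move=> eS; rewrite -(evec_sqr rS eS) [leRHS](bigID (fun z => z \notin T)) /= lerDl.
by apply: sumr_ge0 => z _; rewrite -expr2 sqr_ge0.
Qed.

(** The signs are chosen greedily: each new edge adds at most 2 on the diagonal, and its product
    with the previous edge can be made at most -1, which takes off 2. So the energy never exceeds 2
    while the squared norm grows. *)
Lemma path_vector T (f : nat -> V) L :
  (forall i, (i <= L)%N -> f i \in S) ->
  (forall i, (i < L)%N -> gram_off T (f i) (f i.+1) != 0) ->
  (forall i j, (i < j <= L)%N -> f i != f j /\ ((i.+1 < j)%N -> gram_off T (f i) (f j) = 0)) ->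
  exists x, [/\ supp_in [set f i | i : 'I_L.+1] x,
    \sum_(z | z \notin T) vec x z ^+ 2 <= 2 & \sum_e x e ^+ 2 = L.+1%:R].
Proof.
move=> fS fe fn.
suff H k : (k <= L)%N -> exists x, [/\ (forall e, (forall i, (i <= k)%N -> e != f i) -> x e = 0),
    (x (f k) = 1) \/ (x (f k) = -1),
    \sum_(z | z \notin T) vec x z ^+ 2 <= 2 & \sum_e x e ^+ 2 = k.+1%:R].
  have [x [x1 _ x2 x3]] := H L (leqnn L); exists x; split=> // e eN; apply: x1 => i iL.
  by apply: contraNneq eN => ->; apply/imsetP; exists (Ordinal (iL : (i < L.+1)%N)).
elim: k => [|k IH] kL.
  exists (upd (fun=> 0) (f 0%N) 1); split.
  - by move=> e /(_ 0%N isT) /negPf h; rewrite /upd h addr0.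
  - by left; rewrite /upd eqxx add0r.
  - rewrite energy_upd [X in X + _ + _]big1 => [|z _]; last first.
      by rewrite /vec big1 ?expr0n // => e _; rewrite mulr0.
    rewrite [X in _ + _ * X + _]big1 => [|e _]; last by rewrite mul0r.
    rewrite mulr0 !add0r.
    by rewrite expr1n mulr1 -[leRHS]/(2%:~R) ler_int gram_off_le2 ?fS.
  - by rewrite sumsq_upd // big1 ?add0r ?expr1n // => e _; rewrite expr0n.
have [x [x1 x2 x3 x4]] := IH (ltnW kL).
have xk : x (f k.+1) = 0.
  by apply: x1 => i ik; have [|h _] := fn i k.+1; rewrite ?ltnS ?ik // eq_sym.
have cross : \sum_e x e * (gram_off T e (f k.+1))%:~R
   = x (f k) * (gram_off T (f k) (f k.+1))%:~R.
  rewrite (bigD1 (f k)) //= big1 ?addr0 // => e ek.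
  have [/existsP [i /eqP ei]|none] := boolP [exists i : 'I_k.+1, e == f i].
    have ik : (i < k)%N.
      rewrite ltn_neqAle -ltnS ltn_ord andbT; apply: contraNneq ek => <-; exact/eqP.
    have [|_ h] := fn i k.+1; first by rewrite kL andbT (ltn_trans ik).
    by rewrite ei h ?mulr0 // ltnS.
  rewrite x1 ?mul0r // => i ik; apply: contraNneq none => ->.
  by apply/existsP; exists (Ordinal (ik : (i < k.+1)%N)).
pose s : R := if 0 < x (f k) * (gram_off T (f k) (f k.+1))%:~R then -1 else 1.
have s2 : s ^+ 2 = 1 by rewrite /s; case: ifP => _; rewrite ?sqrrN expr1n.
have hs : s * (x (f k) * (gram_off T (f k) (f k.+1))%:~R) <= -1.
  have hg := fe k kL; rewrite /s.
  have : ((gram_off T (f k) (f k.+1))%:~R <= -1 :> R) \/ (1 <= (gram_off T (f k) (f k.+1))%:~R :> R).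
    rewrite -[1]/(1%:~R) -(rmorphN _ 1) !ler_int; move: (gram_off _ _ _) hg => w hg.
    by apply/orP; clear -hg; lia.
  move: (gram_off _ _ _)%:~R => w; case: x2 => -> hw; rewrite ?mulN1r ?mul1r.
    case: ltrP => h; rewrite ?mulN1r ?mul1r; case: hw; lra.
  by case: ltrP => h; rewrite ?mulN1r ?mul1r; case: hw; lra.
exists (upd x (f k.+1) s); split.
- move=> e he; rewrite /upd x1 ?add0r; last by move=> i ik; apply: he; exact: leqW.
  by rewrite (negPf (he k.+1 (leqnn _))).
- by rewrite /upd eqxx xk add0r /s; case: ifP; [right|left].
- rewrite energy_upd cross s2 mulr1.
  have : (gram_off T (f k.+1) (f k.+1))%:~R <= 2%:~R :> R by rewrite ler_int gram_off_le2 ?fS.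
  rewrite -[2%:~R]/(2 : R) -mulrA; lra.
- by rewrite sumsq_upd // x4 s2 -[RHS]natr1.
Qed.

End RootGraph.

(** A negative form remains negative somewhere after a small rank-one term is added. Here [r] is the
    row of a hub, and [k.+1] the number of edges over which the flow into the hub has to be shared;
    it must depend only on [delta] and the size. *)
Definition spectral_gap (R : realType) (delta : R) (n k : nat) : Prop :=
  forall (M : 'I_n -> 'I_n -> int) (r : 'I_n -> int) (x : 'I_n -> R),
  (forall i j, -2 <= M i j <= 2) -> (forall i, -1 <= r i <= 1) ->
  \sum_i \sum_j (M i j)%:~R * (x i * x j) - delta * \sum_i x i ^+ 2 < 0 ->
  exists y : 'I_n -> R, \sum_i \sum_j (M i j)%:~R * (y i * y j)
    - delta * \sum_i y i ^+ 2 + (\sum_i (r i)%:~R * y i) ^+ 2 / k.+1%:R < 0.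

(* Only finitely many pairs [(M, r)] occur. *)
Lemma spectral_gap_exists (R : realType) (delta : R) n : exists k, spectral_gap delta n k.
Proof.
pose F (M : 'I_n -> 'I_n -> int) (x : 'I_n -> R) :=
  \sum_i \sum_j (M i j)%:~R * (x i * x j) - delta * \sum_i x i ^+ 2.
pose I : finType := ({ffun 'I_n * 'I_n -> 'I_5} * {ffun 'I_n -> 'I_3})%type.
pose dM (p : I) i j : int := (p.1 (i, j) : nat)%:Z - 2.
pose dr (p : I) i : int := (p.2 i : nat)%:Z - 1.
have ex (p : I) : exists k : nat, forall x, F (dM p) x < 0 ->
    exists y, F (dM p) y + (\sum_i (dr p i)%:~R * y i) ^+ 2 / k.+1%:R < 0.
  have [[x hx]|nx] := pselect (exists x, F (dM p) x < 0); last first.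
    by exists 0%N => x hx; case: nx; exists x.
  pose s := (\sum_i (dr p i)%:~R * x i) ^+ 2.
  exists (Num.bound (s / - F (dM p) x)) => _ _; exists x; rewrite -/s.
  have s0 : 0 <= s by exact: sqr_ge0.
  have F0 : 0 < - F (dM p) x by rewrite oppr_gt0.
  have h := archi_boundP (divr_ge0 s0 (ltW F0)).
  set b := Num.bound _ in h *.
  rewrite addrC -ltrBrDr sub0r ltr_pdivrMr ?ltr0n //.
  rewrite ltr_pdivrMr // in h; apply: lt_le_trans h _.
  by rewrite mulrC ler_pM2l // ler_nat.
have [k hk] := choice ex.
exists (\max_p k p)%N => M r x hM hr hx.
pose p : I := ([ffun ij => inord (absz (M ij.1 ij.2 + 2))], [ffun i => inord (absz (r i + 1))]).
have EM : dM p = M.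
  apply/funext => i; apply/funext => j; rewrite /dM ffunE /= inordK; have := hM i j; lia.
have Er : dr p = r.
  apply/funext => i; rewrite /dr ffunE /= inordK; have := hr i; lia.
have [|y hy] := hk p x; first by rewrite EM.
exists y; apply: le_lt_trans hy; rewrite EM Er lerD2l ler_wpM2l ?sqr_ge0 //.
by rewrite lef_pV2 ?posrE ?ltr0n // ler_nat ltnS; exact: leq_bigmax.
Qed.

Section Hubs.
Variables (V X : finType) (A : V -> V -> int).
Variables (a c : V -> X) (al ga : V -> int) (S : {set V}).
Hypotheses (sA : signed_mx A) (rS : line_rep a c al ga A S).
Local Notation evec := (evec a c al ga).
Local Notation gram_off := (gram_off a c al ga).
Implicit Types (T : {set X}).

Definition joins z e z' :=
  (a e == z) && (c e == z') || (a e == z') && (c e == z).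
Definition adjacent z z' := [exists e in S, joins z e z'].
Definition neighbors z : {set X} := [set z' | adjacent z z'].
Definition incident z : {set V} := [set e in S | (a e == z) || (c e == z)].

Lemma evec_ends z e : z != a e -> z != c e -> evec z e = 0.
Proof. by rewrite /evec => /negPf -> /negPf ->. Qed.

Lemma joins_evec z e z' : e \in S -> joins z e z' ->
  [/\ z != z', evec z e = 1 \/ evec z e = -1, evec z' e = 1 \/ evec z' e = -1
    & forall y, y != z -> y != z' -> evec y e = 0].
Proof.
move=> eS; case: rS => /(_ e eS) h1 /(_ e eS) h2 /(_ e eS) h3 _.
have e1 : evec (a e) e = al e by rewrite /evec eqxx (negPf h1) addr0.
have e2 : evec (c e) e = ga e by rewrite /evec eqxx eq_sym (negPf h1) add0r.
have o2 : al e = 1 \/ al e = -1 by case/orP: h2 => /eqP; [left|right].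
have o3 : ga e = 1 \/ ga e = -1 by case/orP: h3 => /eqP; [left|right].
case/orP=> /andP [/eqP <- /eqP <-]; rewrite e1 e2; split=> //.
- by move=> y; exact: evec_ends.
- by rewrite eq_sym.
- by move=> y y1 y2; exact: evec_ends.
Qed.

(** Ends, orientation and signs determine an edge, as two equal vectors would have the inner product
    2, which is not minus an entry of [A]. This leaves 8 edges for each neighbour. *)
Lemma incident_card z : (#|incident z| <= #|neighbors z| * 8)%N.
Proof.
pose g e := (if a e == z then c e else a e, (a e == z, al e == 1, ga e == 1)).
have -> : (#|neighbors z| * 8 = #|setX (neighbors z) [set: bool * bool * bool]|)%N.
  by rewrite cardsX cardsT !card_prod card_bool.
rewrite -(@card_in_imset _ _ g (incident z)).
  apply: subset_leq_card; apply/subsetP => _ /imsetP [e eI ->].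
  rewrite in_setX in_setT andbT /g /= inE; apply/exists_inP; exists e.
    by move: eI; rewrite inE => /andP [].
  move: eI; rewrite inE /joins => /andP [_]; case: eqP => [-> _|_ /= /eqP ->].
    by rewrite !eqxx.
  by rewrite !eqxx ?orbT.
case: rS => h1 h2 h3 h4 e f; rewrite !inE => /andP [eS ez] /andP [fS fz].
rewrite /g => -[E1 E2 E3 E4]; apply/eqP; apply: contraT => ef.
have sg (x y : int) : (x == 1) || (x == -1) -> (y == 1) || (y == -1) ->
    (x == 1) = (y == 1) -> x = y.
  by case/orP => /eqP -> /orP [] /eqP ->.
have Eal := sg _ _ (h2 e eS) (h2 f fS) E3; have Ega := sg _ _ (h3 e eS) (h3 f fS) E4.
have [Ea Ec] : a e = a f /\ c e = c f.
  move: E1 E2 ez fz; case: (a e =P z) => [->|_]; case: (a f =P z) => [->|_] //=.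
  by move=> -> _ /eqP -> /eqP ->.
have Ef y : evec y f = evec y e by rewrite /evec Ea Ec Eal Ega.
have := h4 e f eS fS ef; under eq_bigr do rewrite Ef.
by rewrite (evec_sqr rS eS); case: sA => _ _ /(_ e f); clear; lia.
Qed.

Lemma evec_bound z e : e \in S -> -1 <= evec z e <= 1.
Proof.
move=> eS; have [|h1 [] h2 [] h3 h4] := @joins_evec (a e) e (c e) eS;
  rewrite /joins ?eqxx //;
  (have [->|za] := eqVneq z (a e); first by rewrite h2);
  (have [->|zc] := eqVneq z (c e); first by rewrite h3);
  by rewrite h4.
Qed.

Lemma gram_off_bound T e f : e \in S -> f \in S -> -2 <= gram_off T e f <= 2.
Proof.
move=> eS fS; rewrite /gram_off big_mkcond /=.
have -> : \sum_z (if z \notin T then evec z e * evec z f else 0)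
    = \sum_z evec z e * (if z \notin T then evec z f else 0).
  by apply: eq_bigr => z _; case: ifP; rewrite ?mulr0.
rewrite gramE.
have b z : -1 <= (if z \notin T then evec z f else 0) <= 1.
  by case: ifP => // _; exact: evec_bound.
case: rS => _ h2 h3 _.
move: (b (a e)) (b (c e)); move: (if _ then _ else _) (if _ then _ else _) => p q.
by case/orP: (h2 e eS) => /eqP ->; case/orP: (h3 e eS) => /eqP ->; clear; lia.
Qed.

End Hubs.

Section Spreading.
Variables (R : realType) (V X : finType) (A : V -> V -> int).
Variables (a c : V -> X) (al ga : V -> int) (S : {set V}).
Hypothesis rS : line_rep a c al ga A S.
Local Notation evec := (evec a c al ga).
Local Notation vec := (vec a c al ga).
Local Notation joins := (joins a c).
Local Notation adjacent := (adjacent a c S).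
Local Notation neighbors := (neighbors a c S).
Implicit Types (x : V -> R) (W : {set V}).

Lemma vec_off_ends W x z : supp_in W x ->
  (forall e, e \in W -> z != a e /\ z != c e) -> vec x z = 0.
Proof.
move=> sx zW; rewrite /vec big1 // => e _.
have [eW|eW] := boolP (e \in W); last by rewrite sx // mulr0.
by have [h1 h2] := zW e eW; rewrite evec_ends // mul0r.
Qed.

(* The flow at [w] is pushed out along [k.+1] fresh edges, in equal shares. *)
Lemma spread (w : X) (Y : {set X}) W (k : nat) x :
  W \subset S -> supp_in W x -> (k.+1 + (#|W| + #|W|) + #|Y| <= #|neighbors w|)%N ->
  exists x' W', [/\ W' \subset S, (#|W'| <= #|W| + k.+1)%N, supp_in W' x',
    (forall y, y \in Y -> y != w -> vec x' y = vec x y) &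
    \sum_z vec x' z ^+ 2 = \sum_(z | z != w) vec x z ^+ 2 + vec x w ^+ 2 / k.+1%:R
    /\ \sum_e x e ^+ 2 <= \sum_e x' e ^+ 2].
Proof.
move=> WS sx hk.
pose E := [set a e | e in W] :|: [set c e | e in W].
have cE : (#|E| <= #|W| + #|W|)%N.
  by apply: leq_trans (leq_card_setU _ _) _; apply: leq_add; exact: leq_imset_card.
have [N sN cN] : exists2 N : {set X}, N \subset neighbors w :\: (E :|: Y) & #|N| = k.+1.
  apply: exists_subset.
  have := cardsID (E :|: Y) (neighbors w).
  have := leq_trans (subset_leq_card (subsetIr (neighbors w) (E :|: Y))) (leq_card_setU E Y).
  by move: hk cE; clear; lia.
have NP y : y \in N -> [/\ y \in neighbors w, y \notin E & y \notin Y].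
  by move=> /(subsetP sN); rewrite in_setD in_setU negb_or => /andP [/andP [-> ->] ->].
have /choice [phi hphi] y : exists e, y \in N -> e \in S /\ joins w e y.
  have [/NP [h _ _]|] := boolP (y \in N).
    by move: h; rewrite inE => /exists_inP [e eS ew]; exists e.
  have /card_gt0P [y' /NP [h _ _]] : (0 < #|N|)%N by rewrite cN.
  by move: h; rewrite inE => /exists_inP [e eS ew]; exists e.
have pm (s : int) : s = 1 \/ s = -1 -> (s%:~R : R) ^+ 2 = 1.
  by case=> ->; rewrite ?rmorphN ?sqrrN expr1n.
have phiW y : y \in N -> phi y \notin W.
  move=> yN; have [_ yE _] := NP y yN; have [_ jy] := hphi y yN.
  apply: contra yE => yW; rewrite in_setU; case/orP: jy => /andP [/eqP h1 /eqP h2].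
    by apply/orP; right; apply/imsetP; exists (phi y).
  by apply/orP; left; apply/imsetP; exists (phi y).
pose q : R := vec x w / k.+1%:R.
pose d e : R := \sum_(y in N) (evec w (phi y))%:~R * q *+ (e == phi y).
have vd z : vec d z = \sum_(y in N) (evec z (phi y))%:~R * (evec w (phi y))%:~R * q.
  rewrite /vec; under eq_bigr do rewrite mulr_sumr.
  rewrite exchange_big /=; apply: eq_bigr => y _.
  rewrite (bigD1 (phi y)) //= eqxx mulr1n big1 ?addr0 ?mulrA // => e /negPf ->.
  by rewrite mulr0n mulr0.
pose x' e : R := x e - d e.
have vx z : vec x' z = vec x z - vec d z.
  by rewrite /vec -sumrB; apply: eq_bigr => e _; rewrite mulrBr.
have k0 : (k.+1%:R : R) != 0 by rewrite pnatr_eq0.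
have vw : vec x' w = 0.
  rewrite vx vd (eq_bigr (fun=> q)) => [|y yN]; last first.
    have [h1 h2] := hphi y yN; have [_ h _ _] := joins_evec rS h1 h2.
    by rewrite -expr2 pm // mul1r.
  by rewrite sumr_const cN -mulr_natr /q divfK ?subrr.
have vN y : y \in N -> vec x y = 0 /\ vec x' y ^+ 2 = q ^+ 2.
  move=> yN; have [_ yE _] := NP y yN; have [h1 h2] := hphi y yN.
  have [wy h3 h4 _] := joins_evec rS h1 h2.
  have x0 : vec x y = 0.
    apply: vec_off_ends sx _ => e eW; move: yE; rewrite in_setU negb_or => /andP [h5 h6].
    split; first by apply: contra h5 => /eqP ->; apply/imsetP; exists e.
    by apply: contra h6 => /eqP ->; apply/imsetP; exists e.
  split=> //; rewrite vx vd x0 (bigD1 y) //= big1 ?addr0 ?sub0r.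
    by rewrite sqrrN !exprMn !pm // !mul1r.
  move=> y' /andP [y'N ne]; have [h5 h6] := hphi y' y'N.
  have [_ _ _ ->] := joins_evec rS h5 h6; rewrite ?mul0r // 1?eq_sym //.
have vO z : z != w -> z \notin N -> vec x' z = vec x z.
  move=> zw zN; rewrite vx vd big1 ?subr0 // => y yN.
  have [h5 h6] := hphi y yN.
  have [_ _ _ ->] := joins_evec rS h5 h6; rewrite ?mul0r //.
  by apply: contraNneq zN => ->.
exists x', (W :|: [set phi y | y in N]); split.
- by rewrite subUset WS; apply/subsetP => _ /imsetP [y /hphi [h _] ->].
- apply: leq_trans (leq_card_setU _ _) _; rewrite leq_add2l -cN; exact: leq_imset_card.
- move=> e; rewrite in_setU negb_or => /andP [eW eN].
  rewrite /x' sx // /d big1 ?subr0 // => y yN.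
  rewrite (_ : (e == phi y) = false) //.
  by apply: contraNF eN => /eqP ->; apply/imsetP; exists y.
- move=> y yY yw; apply: vO => //; apply/negP => /NP [_ _]; by rewrite yY.
split.
  rewrite (bigD1 w) //= vw expr0n add0r.
  rewrite (bigID (mem N)) /= [in RHS](bigID (mem N)) /=.
  rewrite [X in _ = X + _ + _]big1 => [|z /andP [_ /vN [-> _]]]; last by rewrite expr0n.
  rewrite add0r addrC; congr (_ + _).
    by apply: eq_bigr => z /andP [h1 h2]; rewrite vO.
  rewrite (eq_bigr (fun=> q ^+ 2)) => [|z /andP [_ /vN [_ ->]]] //.
  rewrite (eq_bigl (fun z => z \in N)) => [|z]; last first.
    have [zN|zN] := boolP (z \in N); last by rewrite andbF.
    have [h1 h2] := hphi z zN; have [h _ _ _] := joins_evec rS h1 h2.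
    by rewrite eq_sym h.
  rewrite sumr_const cN -(mulr_natr (q ^+ 2)) /q; move: (k.+1%:R) k0 => K k0.
  by field.
apply: ler_sum => e _; have [eW|eW] := boolP (e \in W); last first.
  by rewrite sx // expr0n sqr_ge0.
rewrite /x' /d big1 ?subr0 // => y yN.
by rewrite (_ : (e == phi y) = false) //; apply: contraNF (phiW y yN) => /eqP <-.
Qed.

(* A shortest walk from [u] carries a unit flow. *)
Lemma trail (u w : X) (l : nat) :
  w \in ball adjacent setT u l.+1 ->
  w \notin ball adjacent setT u l ->
  exists x W, [/\ W \subset S, (#|W| <= l.+1)%N, supp_in W x, \sum_e x e ^+ 2 = l.+1%:R
    & [/\ vec x u ^+ 2 = 1, vec x w ^+ 2 = 1 & forall z, z != u -> z != w -> vec x z = 0]].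
Proof.
move=> wB wN.
have [f [f0 fl fB fN fr]] := ball_trace wB wN.
suff H k : (k <= l.+1)%N -> exists x W s s', [/\ W \subset S, (#|W| <= k)%N, supp_in W x,
    \sum_e x e ^+ 2 = k%:R & [/\ s ^+ 2 = 1, s' ^+ 2 = 1,
    (forall e, e \in W -> a e \in ball adjacent setT u k /\ c e \in ball adjacent setT u k)
    & forall z, vec x z = s *+ (z == u) + s' *+ (z == f k)]].
  have [x [W [s [s' [h1 h2 h3 h4 [h5 h6 _ h7]]]]]] := H l.+1 (leqnn _).
  have uw : u != w.
    apply: contraNneq wN => <-; apply: (subsetP (ball_le adjacent setT u (leq0n l))).
    by rewrite inE.
  exists x, W; split=> //; split; rewrite ?h7 ?fl ?eqxx ?mulr1n.
  - by rewrite (negPf uw) addr0.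
  - by rewrite eq_sym (negPf uw) add0r.
  - by move=> z /negPf zu /negPf zw; rewrite h7 fl zu zw addr0.
elim: k => [|k IH] kl.
  exists (fun=> 0), set0, 1, (-1); split; rewrite ?sub0set ?cards0 //.
    by rewrite big1 // => e _; rewrite expr0n.
  split; rewrite ?sqrrN ?expr1n //; first by move=> e; rewrite in_set0.
  move=> z; rewrite f0 /vec big1 => [|e _]; last by rewrite mulr0.
  by case: eqP => _; rewrite ?subrr ?addr0.
have [x [W [s [s' [h1 h2 h3 h4 [h5 h6 h7 h8]]]]]] := IH (ltnW kl).
have /exists_inP [e eS je] := fr k kl.
have [ne ek ek1 eo] := joins_evec rS eS je.
have fkN : f k.+1 \notin ball adjacent setT u k by apply: fN.
have eW : e \notin W.
  apply: contra fkN => /h7 [h9 h10].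
  by case/orP: je => /andP [/eqP h /eqP h']; rewrite -?h -?h'.
have pm (t : int) : t = 1 \/ t = -1 -> (t%:~R : R) ^+ 2 = 1.
  by case=> ->; rewrite ?rmorphN ?sqrrN expr1n.
pose t : R := - s' * (evec (f k) e)%:~R.
have t2 : t ^+ 2 = 1 by rewrite /t exprMn sqrrN pm // h6 mulr1.
exists (upd x e t), (e |: W), s, (t * (evec (f k.+1) e)%:~R); split.
- by rewrite subUset sub1set eS.
- by rewrite cardsU1 eW add1n.
- move=> e'; rewrite in_setU1 negb_or => /andP [/negPf e'e e'W].
  by rewrite /upd e'e addr0 h3.
- by rewrite sumsq_upd ?h3 // t2 h4 natr1.
split=> //.
- by rewrite exprMn t2 pm // mulr1.
- have sub := subsetP (ball_S adjacent setT u k).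
  move=> e'; rewrite in_setU1 => /orP [/eqP ->|/h7 [h9 h10]]; last by split; apply: sub.
  have B1 : f k \in ball adjacent setT u k.+1 by apply: sub; apply: fB; exact: ltnW.
  have B2 : f k.+1 \in ball adjacent setT u k.+1 by apply: fB.
  by case/orP: je => /andP [/eqP -> /eqP ->].
move=> z; rewrite vec_upd h8.
have [->|zk] := eqVneq z (f k).
  by rewrite (negPf ne) addr0 mulr1n /t mulrCA -expr2 pm // mulr1 addrK.
rewrite addr0; have [->|zk1] := eqVneq z (f k.+1); first by rewrite mulr1n mulrC.
by rewrite eo // mul0r.
Qed.

End Spreading.

(** Transports [spectral_gap], which speaks of matrices of a given size, to the vectors supported in
    [W]. *)
Lemma grounded_margin (R : realType) (V X : finType) (A : V -> V -> int)
    (a c : V -> X) (al ga : V -> int) (S W : {set V}) (w : X) (delta : R) (k : nat) x :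
  signed_mx A -> line_rep a c al ga A S -> W \subset S ->
  spectral_gap delta #|W| k ->
  supp_in W x -> grounded a c al ga [set w] delta x < 0 ->
  exists2 y, supp_in W y
    & grounded a c al ga [set w] delta y + vec a c al ga y w ^+ 2 / k.+1%:R < 0.
Proof.
move=> sA rS WS hk sx gx.
have sumW y (F : V -> R) : supp_in W y ->
    \sum_e F e * y e = \sum_(i < #|W|) F (enum_val i) * y (enum_val i).
  move=> sy; rewrite -(big_enum_val (A := mem W) (fun e => F e * y e)) /= [RHS]big_mkcond /=.
  by apply: eq_bigr => e _; case: ifPn => // /sy ->; rewrite mulr0.
have gE y : supp_in W y -> grounded a c al ga [set w] delta y =
    \sum_(i < #|W|) \sum_(j < #|W|)
      (gram_off a c al ga [set w] (enum_val i) (enum_val j))%:~R * (y (enum_val i) * y (enum_val j))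
    - delta * \sum_(i < #|W|) y (enum_val i) ^+ 2.
  move=> sy; rewrite groundedE /qform.
  have -> : \sum_(i < #|W|) y (enum_val i) ^+ 2 = \sum_e y e ^+ 2.
    by under [RHS]eq_bigr do rewrite expr2; rewrite sumW //; apply: eq_bigr => i _.
  transitivity (\sum_u (\sum_v (gram_off a c al ga [set w] u v)%:~R * y v - delta * y u) * y u).
    apply: eq_bigr => u _; rewrite mulrBl mulr_suml.
    under eq_bigr do rewrite mulrBl.
    rewrite sumrB sum_delta mulrA; congr (_ - _).
    by apply: eq_bigr => v _; ring.
  under eq_bigr do rewrite mulrBl.
  rewrite sumrB mulr_sumr; congr (_ - _); last by apply: eq_bigr => u _; rewrite -mulrA -expr2.
  rewrite sumW //; apply: eq_bigr => i _; rewrite /= sumW // mulr_suml.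
  by apply: eq_bigr => j _; ring.
have vE (y : V -> R) : supp_in W y -> vec a c al ga y w =
    \sum_(i < #|W|) (evec a c al ga w (enum_val i))%:~R * y (enum_val i).
  by move=> sy; rewrite /vec sumW.
have eS (i : 'I_#|W|) : enum_val i \in S by apply: (subsetP WS); exact: enum_valP.
have [|||y hy] := hk (fun i j => gram_off a c al ga [set w] (enum_val i) (enum_val j))
   (fun i => evec a c al ga w (enum_val i)) (fun i => x (enum_val i)).
- by move=> i j; apply: (gram_off_bound rS).
- by move=> i; apply: (evec_bound rS).
- by rewrite -gE.
pose y' e := \sum_(i < #|W|) y i *+ (e == enum_val i).
have sy : supp_in W y'.
  move=> e eW; rewrite /y' big1 // => i _; rewrite (_ : (_ == _) = false) //.
  by apply: contraNF eW => /eqP ->; exact: enum_valP.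
have yE i : y' (enum_val i) = y i.
  rewrite /y' (bigD1 i) //= eqxx mulr1n big1 ?addr0 // => j /negPf ji.
  by rewrite (inj_eq enum_val_inj) eq_sym ji.
exists y' => //; rewrite gE // vE //.
under eq_bigr do under eq_bigr do rewrite !yE.
by under [X in delta * X]eq_bigr do rewrite yE; under [X in X ^+ 2 / _]eq_bigr do rewrite yE.
Qed.

Section BelowTwo.
Variables (R : realType) (V X : finType) (A : V -> V -> int).
Variables (a c : V -> X) (al ga : V -> int) (S : {set V}) (delta : R) (L : nat).
Hypotheses (sA : signed_mx A) (rS : line_rep a c al ga A S).
Hypotheses (cS : critical A (2 - delta) S) (cH : cut_connected a c S).
Hypotheses (d0 : 0 < delta) (hL : 2 < delta * L.+1%:R).
Local Notation evec := (evec a c al ga).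
Local Notation vec := (vec a c al ga).
Local Notation gram_off := (gram_off a c al ga).
Local Notation grounded := (grounded a c al ga).
Local Notation joins := (joins a c).
Local Notation adjacent := (adjacent a c S).
Local Notation neighbors := (neighbors a c S).
Local Notation incident := (incident a c S).
Implicit Types (T : {set X}) (x : V -> R) (W : {set V}).

(** A vector of negative form cannot live on a proper subset of a critical set. All bounds below 2
    come from exhibiting such a vector with small support. *)
Lemma critical_card W x : W \subset S -> supp_in W x ->
  \sum_z vec x z ^+ 2 < delta * \sum_e x e ^+ 2 -> (#|S| <= #|W|)%N.
Proof.
move=> WS sx hx; rewrite leqNgt; apply/negP => ltW.
have pW : W \proper S by rewrite properEcard WS.
have := cS.2 W pW x sx; rewrite (qf_rep _ sA rS) ?leNgt; last exact: supp_in_sub WS sx.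
by apply/negP; rewrite negbK; lra.
Qed.

Definition degree_bound D := ((16 * D).+1 ^ L + L.+1)%N.

(** Each ungrounded end of an edge meets at most [8 * D] edges. A larger set would properly contain
    an induced path of [L.+1] edges, whose [path_vector] has energy at most 2, less than
    [delta * L.+1]. *)
Lemma grounded_critical_card T D W : W \subset S ->
  form_critical (fun e f => (gram_off T e f)%:~R - delta *+ (e == f)) W ->
  (forall z, z \notin T -> (#|neighbors z| <= D)%N) -> (#|W| <= degree_bound D)%N.
Proof.
move=> WS cW hD; rewrite leqNgt; apply/negP => hW.
have gsym e f : gram_off T e f = gram_off T f e.
  by rewrite /gram_off; under eq_bigr do rewrite mulrC.
have [|||f [fW fe fn]] := @induced_path V (fun e f => (e != f) && (gram_off T e f != 0)) W (16 * D) L.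
- move=> U UW U0 UnW.
  have [|u [v [uU vW vU]]] := form_critical_connected _ cW UW U0 UnW.
    by move=> e f; rewrite gsym eq_sym.
  have uv : u != v by apply: contraNneq vU => <-.
  rewrite (negPf uv) subr0 intr_eq0 => guv; exists u, v; split=> //; by rewrite uv.
- move=> e eW; pose I z := if z \in T then set0 else incident z.
  have cI z : (#|I z| <= D * 8)%N.
    rewrite /I; case: ifPn => [_|zT]; first by rewrite cards0.
    by apply: leq_trans (incident_card sA rS z) _; rewrite leq_mul2r hD.
  apply: (@leq_trans #|I (a e) :|: I (c e)|); last first.
    apply: leq_trans (leq_card_setU _ _) _.
    by apply: leq_trans (leq_add (cI _) (cI _)) _; clear; lia.
  apply: subset_leq_card; apply/subsetP => g; rewrite inE => /andP [gW /andP [_]].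
  have gS := subsetP WS g gW.
  apply: contraNT; rewrite in_setU negb_or => /andP [h1 h2].
  have off z : z \notin T -> g \notin I z -> evec z g = 0.
    move=> zT; rewrite /I (negPf zT) inE gS /= negb_or => /andP [za zc].
    by apply: evec_ends; rewrite eq_sym.
  rewrite /gram_off big1 // => z zT; have [za|za] := eqVneq z (a e).
    by rewrite off ?mulr0 // za.
  have [zc|zc] := eqVneq z (c e); first by rewrite off ?mulr0 // zc.
  by rewrite evec_ends ?mul0r.
- by apply: leq_ltn_trans hW; exact: leq_addr.
have [|||x [sx ex nx]] := @path_vector R V X A a c al ga S rS T f L.
- by move=> i /fW; exact: (subsetP WS).
- by move=> i /fe /andP [].
- move=> i j ij; have [h1 h2] := fn i j ij; split=> // /h2.
  by rewrite h1 /= negbK => /eqP.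
have fI : [set f i | i : 'I_L.+1] \proper W.
  rewrite properEcard; apply/andP; split.
    by apply/subsetP => _ /imsetP [i _ ->]; apply: fW; rewrite -ltnS.
  apply: leq_ltn_trans (leq_imset_card _ _) _; rewrite card_ord.
  by apply: leq_ltn_trans hW; exact: leq_addl.
have := cW.2 _ fI x sx; rewrite -groundedE /grounded nx.
by have h := hL; lra.
Qed.

(** A unit flow along a shortest walk from [u] to [w], spread over [L.+1] edges at each hub, costs
    [2 / L.+1 < delta]. If [w] is too far away, a shortest walk of [L.+1] edges from [u] is already
    bad by itself. The second spreading needs [L.+1] neighbours besides the ends of at most
    [2 * L.+1] edges, which is the origin of the 5. *)
Lemma two_hubs u w : u != w -> (5 * L.+1 < #|neighbors u|)%N ->
  (5 * L.+1 < #|neighbors w|)%N -> (#|S| <= 3 * L.+1)%N.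
Proof.
move=> uw hu hw.
have d1 : 1 / L.+1%:R + 1 / L.+1%:R < delta.
  by rewrite -mulrDl ltr_pdivrMr ?ltr0n.
have grow l : ball adjacent setT u l != setT ->
    exists2 z, z \in ball adjacent setT u l.+1 & z \notin ball adjacent setT u l.
  apply: ball_grow; rewrite ?inE // => T _ T0 TS.
  have [e eS ce] := cH T0 TS.
  have [aT|aT] := boolP (a e \in T); rewrite ?aT ?(negPf aT) /= in ce.
    exists (a e), (c e); split; rewrite ?inE //.
    by apply/exists_inP; exists e; rewrite // /joins !eqxx.
  have cT : c e \in T by move: ce; case: (c e \in T).
  exists (c e), (a e); split; rewrite ?inE //.
  by apply/exists_inP; exists e; rewrite // /joins !eqxx orbT.
have en x z z' : z != z' -> (forall y, y != z -> y != z' -> vec x y = 0) ->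
    \sum_y vec x y ^+ 2 = vec x z ^+ 2 + vec x z' ^+ 2.
  move=> zz h; rewrite (bigD1 z) //= (bigD1 z') 1?eq_sym //= big1 ?addr0 //.
  by move=> y /andP [yz yz']; rewrite h // expr0n.
have [wB|wB] := boolP (w \in ball adjacent setT u L.+1); last first.
  have [|z zB zN] := grow L.
    apply: contraNneq wB => h; apply: (subsetP (ball_S _ _ _ _)); by rewrite h inE.
  have [x [W [WS cW sx nx [xu xz x0]]]] := trail R rS zB zN.
  apply: (@leq_trans #|W|); last by apply: leq_trans cW _; rewrite leq_pmull.
  apply: critical_card sx _ => //; rewrite nx (en x u z) ?xu ?xz //.
  apply: contraNneq zN => <-; apply: (subsetP (ball_le _ _ _ (leq0n L))); by rewrite inE.
have [l [lL wl wl']] : exists l, [/\ (l <= L)%N, w \in ball adjacent setT u l.+1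
    & w \notin ball adjacent setT u l].
  have h0 : w \notin ball adjacent setT u 0 by rewrite inE eq_sym.
  elim: (L) wB => [|k IH] wB; first by exists 0%N.
  have [h|h] := boolP (w \in ball adjacent setT u k.+1); last by exists k.+1.
  by have [l [h1 h2 h3]] := IH h; exists l; rewrite leqW.
have [x [W [WS cW sx nx [xu xw x0]]]] := trail R rS wl wl'.
have [|x1 [W1 [WS1 cW1 sx1 o1 [e1 n1]]]] := spread rS (w := w) (Y := [set u]) (k := L) WS sx.
  by apply: leq_trans hw; rewrite cards1; move: cW lL; clear; lia.
have [|x2 [W2 [WS2 cW2 sx2 _ [e2 n2]]]] := spread rS (w := u) (Y := set0) (k := L) WS1 sx1.
  by apply: leq_trans hu; rewrite cards0; move: cW cW1 lL; clear; lia.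
apply: (@leq_trans #|W2|); last by move: cW cW1 cW2 lL; clear; lia.
have x1u : vec x1 u ^+ 2 = 1 by rewrite o1 // inE.
apply: critical_card sx2 _ => //.
have e3 : \sum_(z | z != u) vec x1 z ^+ 2 = 1 / L.+1%:R.
  move: e1; rewrite (bigD1 u) //= x1u xw [in RHS](bigD1 u) //= xu.
  rewrite [X in _ = _ + X + _ -> _]big1 => [|z /andP [zw zu]]; first by rewrite addr0 => /addrI.
  by rewrite x0 ?expr0n.
rewrite e2 e3 x1u; apply: lt_le_trans d1 _; rewrite -[leLHS]mulr1 (ler_wpM2l (ltW d0)) //.
by apply: le_trans n2; apply: le_trans n1; rewrite nx ler1n.
Qed.

(** Grounding only drops squares, so the grounded form is not semidefinite on [S] either, and a
    critical subset for it is small. *)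
Lemma grounded_core T D : (forall z, z \notin T -> (#|neighbors z| <= D)%N) ->
  exists W x, [/\ W \subset S, (#|W| <= degree_bound D)%N, supp_in W x & grounded T delta x < 0].
Proof.
move=> hD; have nS : ~ form_psd (fun e f => (gram_off T e f)%:~R - delta *+ (e == f)) S.
  move=> pS; apply: cS.1 => x sx; rewrite (qf_rep _ sA rS) //.
  have := pS x sx; rewrite -groundedE /grounded => h; apply: le_trans h _.
  rewrite [X in _ <= X + _](bigID (fun z => z \notin T)) /=.
  have : 0 <= \sum_(z | ~~ (z \notin T)) vec x z ^+ 2 by apply: sumr_ge0 => z _; exact: sqr_ge0.
  by lra.
have [W WS cW] := form_critical_exists nS.
have [x sx hx] : exists2 x, supp_in W x & grounded T delta x < 0.
  apply: contrapT => nx; apply: cW.1 => x sx; rewrite -groundedE leNgt.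
  by apply/negP => h; apply: nx; exists x.
exists W, x; split=> //; exact: grounded_critical_card cW hD.
Qed.

Lemma no_hub D : (forall z, (#|neighbors z| <= D)%N) -> (#|S| <= degree_bound D)%N.
Proof.
move=> hD; have [|W [x [WS cW sx hx]]] := @grounded_core set0 D; first by move=> z _.
apply: leq_trans cW; apply: critical_card sx _ => //; rewrite -subr_lt0.
by move: hx; rewrite /grounded (eq_bigl xpredT) // => z; rewrite in_set0.
Qed.

(** Flow into [w] is free in the grounded form. The margin of [spectral_gap] pays for it once it is
    shared among fresh edges at [w]. *)
Lemma one_hub w D k : (forall z, z != w -> (#|neighbors z| <= D)%N) ->
  (forall n, (n <= degree_bound D)%N -> exists2 j, (j < k)%N & spectral_gap delta n j) ->
  (degree_bound D + degree_bound D + k <= #|neighbors w|)%N ->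
  (#|S| <= degree_bound D + k)%N.
Proof.
move=> hD hk hw.
have [|W [x [WS cW sx hx]]] := @grounded_core [set w] D; first by move=> z; rewrite inE; exact: hD.
have [j jk gj] := hk _ cW.
have [y sy hy] := grounded_margin sA rS WS gj sx hx.
have [|x1 [W1 [WS1 cW1 sx1 _ [e1 n1]]]] := spread rS (w := w) (Y := set0) (k := j) WS sy.
  by apply: leq_trans hw; rewrite cards0; move: cW jk; clear; lia.
apply: (@leq_trans #|W1|); last by move: cW cW1 jk; clear; lia.
apply: critical_card sx1 _ => //; rewrite e1.
apply: (@lt_le_trans _ _ (delta * \sum_e y e ^+ 2)); last by rewrite ler_wpM2l // ltW.
move: hy; rewrite /grounded (eq_bigl (fun z => z != w)) => [|z]; last by rewrite inE.
by rewrite addrAC subr_lt0.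
Qed.

End BelowTwo.

Theorem critical_bounded_below_two (R : realType) (delta : R) : 0 < delta -> exists N,
  forall (V X : finType) (A : V -> V -> int) (a c : V -> X) (al ga : V -> int) (S : {set V}),
  signed_mx A -> line_rep a c al ga A S -> cut_connected a c S ->
  critical A (2 - delta) S -> (#|S| <= N)%N.
Proof.
move=> d0; pose L := Num.bound (2 / delta).
have hL : 2 < delta * L.+1%:R.
  have := archi_boundP (divr_ge0 (ler0n R 2) (ltW d0)).
  rewrite -/L ltr_pdivrMr // mulrC => h; apply: lt_le_trans h _.
  by rewrite ler_pM2l // ler_nat.
have [g hg] := choice (spectral_gap_exists delta).
(* [D] is the degree that two hubs need, [B] the size of the grounded core if all degrees but one
   are at most [D], and [K] the degree that a single hub needs to disperse the flow of this core. *)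
pose D := (5 * L.+1)%N; pose B := degree_bound L D.
pose k := \max_(n < B.+1) (g n).+1; pose K := (maxn D (B + B + k))%N.
exists (3 * L.+1 + (B + k) + degree_bound L K)%N => V X A a c al ga S sA rS cH cS.
have hk n : (n <= B)%N -> exists2 j, (j < k)%N & spectral_gap delta n j.
  move=> nB; exists (g n) => //.
  exact: (@leq_bigmax _ (fun n : 'I_B.+1 => (g n).+1) (Ordinal (nB : (n < B.+1)%N))).
have [/existsP [w hw]|none] := boolP [exists w, (K < #|neighbors a c S w|)%N]; last first.
  apply: leq_trans (leq_addl _ _); apply: (@no_hub R V X A a c al ga S delta L) => // z.
  by rewrite leqNgt; apply: contra none => h; apply/existsP; exists z.
move: hw; rewrite gtn_max => /andP [hw1 hw2].
have [/existsP [u /andP [uw hu]]|one] := boolP [exists u, (u != w) && (D < #|neighbors a c S u|)%N].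
  apply: (@leq_trans (3 * L.+1)%N); last by rewrite -addnA leq_addr.
  exact: (@two_hubs R V X A a c al ga S delta L sA rS cS cH d0 hL u w uw).
apply: (@leq_trans (B + k)%N); last by rewrite addnAC leq_addl.
apply: (one_hub sA rS cS d0 hL _ hk (ltnW hw2)).
move=> z zw; rewrite leqNgt; apply: contra one => h; apply/existsP; exists z.
by rewrite zw.
Qed.

Lemma cubic_root_gt1 (R : realType) (rho : R) : rho ^+ 3 = rho + 1 -> 1 < rho.
Proof.
move=> h; rewrite ltNge; apply/negP => r1.
have r2 : 0 <= rho ^+ 2 := sqr_ge0 rho.
have r3 : rho ^+ 3 = rho * rho ^+ 2 by ring.
have [r0|r0] := lerP 0 rho; first by nra.
have r30 : rho ^+ 3 <= 0 by rewrite r3; nra.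
have r4 : rho <= -1 by lra.
have r5 : 1 <= rho ^+ 2 by nra.
have : rho * (rho ^+ 2 - 1) = 1 by rewrite mulrBr -r3 h; lra.
by nra.
Qed.

(** [t] is taken slightly below the square root [s] of [rho]: lowering [s] by [h] increases its
    inverse, so [t + t^-1] loses at most [h]. *)
Lemma approximate_parameter (R : realType) (rho lam : R) : rho ^+ 3 = rho + 1 ->
  lam < Num.sqrt rho + (Num.sqrt rho)^-1 ->
  exists t : R, [/\ 1 < t, t ^+ 6 < t ^+ 2 + 1 & lam <= t + t^-1].
Proof.
move=> hrho; have r1 := cubic_root_gt1 hrho.
set s := Num.sqrt rho => hlam.
have s2 : s ^+ 2 = rho by rewrite /s sqr_sqrtr //; lra.
have s0 : 0 <= s by exact: sqrtr_ge0.
have s1 : 1 < s by nra.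
pose h := Num.min ((s - 1) / 2) (s + s^-1 - lam).
have h0 : 0 < h by rewrite /h lt_min; apply/andP; split; lra.
have h1 : h <= (s - 1) / 2 by rewrite /h ge_min lexx.
have h2 : h <= s + s^-1 - lam by rewrite /h ge_min lexx orbT.
have t1 : 1 < s - h by lra.
exists (s - h); split => //.
  have ts : (s - h) ^+ 2 < rho by rewrite -s2; nra.
  have -> : (s - h) ^+ 6 = ((s - h) ^+ 2) ^+ 3 by ring.
  have : 1 < (s - h) ^+ 2 by nra.
  move: ((s - h) ^+ 2) ts => x xr x1.
  have : 0 < (rho - x) * (rho ^+ 2 + rho * x + x ^+ 2 - 1) by apply: mulr_gt0; nra.
  have -> : (rho - x) * (rho ^+ 2 + rho * x + x ^+ 2 - 1) = rho ^+ 3 - rho - x ^+ 3 + x by ring.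
  by rewrite hrho; lra.
have : s^-1 <= (s - h)^-1 by rewrite lef_pV2 ?posrE; lra.
by lra.
Qed.

Theorem critical_bounded (R : realType) (rho lam : R) : rho ^+ 3 = rho + 1 ->
  lam < Num.sqrt rho + (Num.sqrt rho)^-1 ->
  exists N, forall (V : finType) (A : V -> V -> int) (S : {set V}),
    signed_mx A -> critical A lam S -> (#|S| <= N)%N.
Proof.
move=> hrho hlam; have [t [t1 tu lt]] := approximate_parameter hrho hlam.
have [n hn] := large_order_exists t1 tu.
have [N hN] : exists N, lam < 2 -> forall (V X : finType) (A : V -> V -> int)
    (a c : V -> X) (al ga : V -> int) (S : {set V}),
    signed_mx A -> line_rep a c al ga A S -> cut_connected a c S ->
    critical A lam S -> (#|S| <= N)%N.
  have [l2|l2] := ltP lam 2; last by exists 0%N.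
  have [|N hN] := @critical_bounded_below_two R (2 - lam); first by lra.
  exists N => _; have e : 2 - (2 - lam) = lam by ring.
  by rewrite e in hN.
exists (core_bound n + N)%N => V A S sA cS; rewrite leqNgt; apply/negP => hS.
have [|X [a [c [al [ga [rS cH _]]]]]] := critical_line_graph sA cS t1 tu hn lt.
  exact: leq_ltn_trans (leq_addr _ _) hS.
have [l2|l2] := ltP lam 2.
  have := hN l2 V X A a c al ga S sA rS cH cS.
  by rewrite leqNgt => /negP; apply; apply: leq_ltn_trans (leq_addl _ _) hS.
apply: cS.1 => x sx; rewrite (qf_rep _ sA rS sx); apply: addr_ge0.
  by apply: sumr_ge0 => z _; exact: sqr_ge0.
apply: mulr_ge0; first by lra.
by apply: sumr_ge0 => z _; exact: sqr_ge0.
Qed.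

(** * Towers of cliques *)

Record rooted := Rooted {
  rcarrier : finType;
  radj : rcarrier -> rcarrier -> int;
  rroot : pred rcarrier;
  radj_signed : signed_mx radj
}.

Definition bond_adj (o : option bool) (T1 T2 : rooted)
    (u v : rcarrier T1 + rcarrier T2) : int :=
  match u, v with
  | inl x, inl y => radj x y
  | inr x, inr y => radj x y
  | inl x, inr y | inr y, inl x => edge_value int o *+ (rroot x && rroot y)
  end.

Lemma bond_adj_signed o T1 T2 : signed_mx (@bond_adj o T1 T2).
Proof.
have [s1 z1 b1] := radj_signed T1; have [s2 z2 b2] := radj_signed T2.
split.
- by case=> x [y|y] //=; rewrite ?s1 ?s2.
- by case=> x /=; rewrite ?z1 ?z2.
- case=> x [y|y] /=; first exact: b1; last exact: b2.
    by case: o => [[]|]; case: (rroot _); case: (rroot _).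
  by case: o => [[]|]; case: (rroot _); case: (rroot _).
Qed.

Definition bond o (keep : bool) T1 T2 : rooted :=
  @Rooted (rcarrier T1 + rcarrier T2)%type (@bond_adj o T1 T2)
    (fun u => match u with inl x => rroot x | inr y => keep && rroot y end)
    (bond_adj_signed o T1 T2).

Lemma zero_signed (V : finType) : signed_mx (fun _ _ : V => 0).
Proof. by split. Qed.

Definition empty_rooted : rooted := Rooted xpred0 (zero_signed void).
Definition planted T : rooted :=
  bond (Some true) false (Rooted xpredT (zero_signed unit)) T.

(* In [tower m (d :: s)] the root vertices form a negative clique; [d] of them are
   pendant and each of the [m] others is joined positively to the roots of a copy
   of [tower m s]. *)
Fixpoint tower (m : nat) (s : seq nat) : rooted :=
  if s is d :: s' then
    iter d (bond (Some false) true (planted empty_rooted))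
      (iter m (bond (Some false) true (planted (tower m s'))) empty_rooted)
  else empty_rooted.

Definition forest (m : nat) (l : seq (seq nat)) : rooted :=
  foldr (fun s => bond None true (tower m s)) empty_rooted l.

Section RootedForms.
Variables (R : realType) (lam : R).

Definition root_sum T (x : rcarrier T -> R) : R := \sum_v x v *+ rroot v.

Definition rform T (x : rcarrier T -> R) : R := qf (@radj T) lam x.

(* Minimising [rform x - k * root_sum x ^ 2 - 2 b root_sum x] gives [- b ^ 2 s]. *)
Definition lower_value (k : R) T (s : R) n := forall (x : rcarrier T -> R) b,
  (#|[set v | x v != 0%R]| < n)%N ->
  0 <= rform x - k * root_sum x ^+ 2 - 2 * b * root_sum x + b ^+ 2 * s.

Definition attained_value (k : R) T (s : R) := forall b, exists x : rcarrier T -> R,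
  root_sum x = b * s /\ rform x - k * root_sum x ^+ 2 = b ^+ 2 * s.

Definition value k T s := (forall n, lower_value k T s n) /\ attained_value k T s.

Lemma root_sum_bond o keep T1 T2 (x : rcarrier (bond o keep T1 T2) -> R) :
  root_sum x = root_sum (fun v => x (inl v)) + root_sum (fun v => x (inr v)) *+ keep.
Proof.
rewrite /root_sum big_sumType /=; congr (_ + _); rewrite -sumrMnl.
by apply: eq_bigr => v _; rewrite -mulrnA mulnb andbC.
Qed.

Lemma rform_bond o keep T1 T2 (x : rcarrier (bond o keep T1 T2) -> R) :
  rform x = rform (fun v => x (inl v)) + rform (fun v => x (inr v))
    - 2 * edge_value R o * root_sum (fun v => x (inl v)) * root_sum (fun v => x (inr v)).
Proof.
have cross : \sum_u \sum_v (edge_value int o *+ (rroot u && rroot v))%:~R * (x (inl u) * x (inr v))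
  = edge_value R o * root_sum (fun v => x (inl v)) * root_sum (fun v => x (inr v)).
  rewrite /root_sum -mulrA mulr_suml mulr_sumr; apply: eq_bigr => u _.
  rewrite mulr_sumr mulr_sumr; apply: eq_bigr => v _.
  have -> : (edge_value int o *+ (rroot u && rroot v))%:~R = edge_value R o *+ (rroot u && rroot v).
    by case: o x => [[]|] x; case: (_ && _); rewrite /= ?rmorphN.
  by case: (rroot u); case: (rroot v); rewrite /= ?mulr0n ?mulr1n ?(mul0r, mulr0).
have blocks (F : rcarrier T1 + rcarrier T2 -> rcarrier T1 + rcarrier T2 -> R) :
    \sum_u \sum_v F u v = (\sum_u \sum_v F (inl u) (inl v) + \sum_u \sum_v F (inl u) (inr v))
     + (\sum_v \sum_u F (inr v) (inl u) + \sum_u \sum_v F (inr u) (inr v)).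
  rewrite big_sumType /= -!big_split /=.
  by congr (_ + _); apply: eq_bigr => u _; rewrite big_sumType.
rewrite /rform /qf blocks big_sumType /= cross [X in _ + (X + _)]exchange_big /=.
have -> : \sum_j \sum_i (edge_value int o *+ (rroot j && rroot i))%:~R * (x (inr i) * x (inl j))
  = edge_value R o * root_sum (fun v => x (inl v)) * root_sum (fun v => x (inr v)).
  by rewrite -cross; apply: eq_bigr => u _; apply: eq_bigr => v _; rewrite [x (inr _) * _]mulrC.
by ring.
Qed.

Lemma card_supp_inj (V W : finType) (f : V -> W) (x : W -> R) : injective f ->
  (#|[set v | x (f v) != 0%R]| <= #|[set w | x w != 0%R]|)%N.
Proof.
move=> fI; rewrite -(card_imset _ fI); apply: subset_leq_card.
by apply/subsetP => _ /imsetP [v vx ->]; move: vx; rewrite !inE.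
Qed.

Lemma lower_value_le k T s n n' : (n' <= n)%N -> lower_value k T s n -> lower_value k T s n'.
Proof. by move=> nn h x b xn; apply: h; exact: leq_trans nn. Qed.

(** With [k = - edge_value R o] the cross term between the two root sums is absorbed by the square
    of their sum, so the values simply add up. This is why values carry the parameter [k]: it is 1
    inside a negative clique and 0 in a disjoint union. *)
Lemma lower_value_bond o T1 T2 s1 s2 n :
  lower_value (- edge_value R o) T1 s1 n -> lower_value (- edge_value R o) T2 s2 n ->
  lower_value (- edge_value R o) (bond o true T1 T2) (s1 + s2) n.
Proof.
move=> h1 h2 x b xn; rewrite rform_bond root_sum_bond mulr1n.
have /(_ b) := h1 (fun v => x (inl v)); have /(_ b) := h2 (fun v => x (inr v)).
move=> /(_ (leq_ltn_trans (card_supp_inj x (@inr_inj _ _)) xn)) h3.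
move=> /(_ (leq_ltn_trans (card_supp_inj x (@inl_inj _ _)) xn)) h4.
by apply: (le_trans (addr_ge0 h3 h4)); rewrite le_eqVlt; apply/orP; left; apply/eqP; ring.
Qed.

Lemma attained_value_bond o T1 T2 s1 s2 :
  attained_value (- edge_value R o) T1 s1 -> attained_value (- edge_value R o) T2 s2 ->
  attained_value (- edge_value R o) (bond o true T1 T2) (s1 + s2).
Proof.
move=> h1 h2 b; have [x [x1 x2]] := h1 b; have [y [y1 y2]] := h2 b.
exists (fun u => match u with inl v => x v | inr v => y v end).
rewrite rform_bond root_sum_bond /= mulr1n.
rewrite (_ : (fun v => x v) = x) // (_ : (fun v => y v) = y) //.
rewrite x1 y1 in x2 y2 *; split; first by ring.
by rewrite mulrDr -x2 -y2; ring.
Qed.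

Lemma value_empty k : value k empty_rooted 0.
Proof.
have z x : rform (T := empty_rooted) x = 0.
  by rewrite /rform /qf !big1 ?mulr0 ?subr0 // => -[].
have y x : root_sum (T := empty_rooted) x = 0 by rewrite /root_sum big1 // => -[].
split=> [n x b _|b]; first by rewrite z y; lra.
by exists (fun=> 0); rewrite z y; split; ring.
Qed.

Lemma rform_planted T (x : rcarrier (planted T) -> R) :
  rform x = lam * x (inl tt) ^+ 2 - 2 * x (inl tt) * root_sum (fun v => x (inr v))
    + rform (fun v => x (inr v)).
Proof.
rewrite rform_bond /=; set q := rform (fun v => x (inr v)); set y := root_sum (fun v => x (inr v)).
rewrite /rform /root_sum /qf !(big_pred1 tt) /=; try by case.
by rewrite mulr1n; ring.
Qed.

Lemma root_sum_planted T (x : rcarrier (planted T) -> R) : root_sum x = x (inl tt).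
Proof.
by rewrite root_sum_bond mulr0n addr0 /root_sum (big_pred1 tt) //; case.
Qed.

Hypothesis lam2 : 2 < lam.

(** Given the value [z] at the new root, the rest contributes at least [- z ^+ 2 * s], and the
    minimum over [z] gives the formula. A support that avoids the new root gains nothing from [T];
    one that uses it has one vertex less in [T], hence [n.+1]. *)
Lemma lower_value_planted T s s' n : s < 1 -> lower_value 0 T s n ->
  (forall n', lower_value 0 T s' n') -> lower_value 1 (planted T) (lam - 1 - s)^-1 n.+1.
Proof.
move=> s1 h h' x b xn; rewrite rform_planted root_sum_planted.
have hl := lam2; have e0 : 0 < lam - 1 - s by lra.
have [z0|z0] := eqVneq (x (inl tt)) 0.
  have := h' #|rcarrier T|.+1 (fun v => x (inr v)) 0 (max_card _).
  have : 0 <= b ^+ 2 * (lam - 1 - s)^-1 by rewrite mulr_ge0 ?sqr_ge0 ?invr_ge0 ?ltW.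
  by rewrite z0; lra.
have hx : (#|[set v | x (inr v) != 0%R]| < n)%N.
  rewrite -ltnS; apply: leq_trans xn; rewrite ltnS.
  rewrite (cardsD1 (inl tt : rcarrier (planted T)) [set v | x v != 0]) inE z0 add1n ltnS.
  rewrite -(card_imset _ (@inr_inj unit (rcarrier T))); apply: subset_leq_card.
  by apply/subsetP => _ /imsetP [v vx ->]; move: vx; rewrite !inE.
have := h (fun v => x (inr v)) (x (inl tt)) hx.
set z := x (inl tt); set q := rform _; set y := root_sum _ => h1.
have h2 : 0 <= ((lam - 1 - s) * z - b) ^+ 2 / (lam - 1 - s).
  by rewrite mulr_ge0 ?sqr_ge0 ?invr_ge0 ?ltW.
have E : ((lam - 1 - s) * z - b) ^+ 2 / (lam - 1 - s)
   = (lam - 1 - s) * z ^+ 2 - 2 * b * z + b ^+ 2 / (lam - 1 - s).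
  by move: e0; move: (lam - 1 - s) => e e0; field; rewrite gt_eqF.
by move: h2; rewrite E; lra.
Qed.

Lemma value_planted T s : s < 1 -> value 0 T s -> value 1 (planted T) (lam - 1 - s)^-1.
Proof.
move=> s1 [h1 h2]; have hl := lam2; have e0 : 0 < lam - 1 - s by lra.
split=> [n|b].
  by apply: lower_value_le (leqnSn n) _; apply: lower_value_planted (h1 n) h1.
have [x [x1 x2]] := h2 (b / (lam - 1 - s)).
exists (fun u => match u with inl _ => b / (lam - 1 - s) | inr v => x v end).
rewrite rform_planted root_sum_planted /= (_ : (fun v => x v) = x) //.
split=> //; move: x2; rewrite mul0r subr0 => ->; rewrite x1.
by move: e0 => e0; field; rewrite gt_eqF.
Qed.

(** Restores the square of the root sum that had been subtracted inside the clique; completing the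
    square turns [D] into [D / (1 + D)]. *)
Lemma lower_value_clique T D n : 0 <= D -> lower_value 1 T D n -> lower_value 0 T (D / (1 + D)) n.
Proof.
move=> D0 h x a xn; have := h x (a / (1 + D)) xn.
set q := rform _; set y := root_sum _ => h1.
have h2 : 0 <= (y - a + a / (1 + D)) ^+ 2 by exact: sqr_ge0.
have d0 : 1 + D != 0 by rewrite gt_eqF //; lra.
have E : (y - a + a / (1 + D)) ^+ 2 + (q - 1 * y ^+ 2 - 2 * (a / (1 + D)) * y + (a / (1 + D)) ^+ 2 * D)
  = q - 0 * y ^+ 2 - 2 * a * y + a ^+ 2 * (D / (1 + D)) by field.
by rewrite -E; exact: addr_ge0.
Qed.

Lemma value_clique T D : 0 <= D -> value 1 T D -> value 0 T (D / (1 + D)).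
Proof.
move=> D0 [h1 h2]; split=> [n|a]; first exact: lower_value_clique.
have [x [x1 x2]] := h2 (a / (1 + D)); exists x.
have d0 : 1 + D != 0 by rewrite gt_eqF //; lra.
split; first by rewrite x1; field.
have -> : rform x = rform x - 1 * root_sum x ^+ 2 + root_sum x ^+ 2 by ring.
by rewrite x2 x1; field.
Qed.

End RootedForms.

Section Towers.
Variables (R : realType) (lam : R) (m : nat).
Hypothesis lam2 : 2 < lam.

(** The value of [tower m s]; a pendant contributes like a branch whose subtower has the value 0. *)
Fixpoint sigma (s : seq nat) : R :=
  if s is d :: s' then
    let D := d%:R * (lam - 1 - 0)^-1 + m%:R * (lam - 1 - sigma s')^-1 in D / (1 + D)
  else 0.

Lemma ratio_bounds (D : R) : 0 <= D -> 0 <= D / (1 + D) < 1.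
Proof.
by move=> D0; rewrite ltr_pdivrMr ?divr_ge0 //=; lra.
Qed.

Lemma sigma_bounds s : 0 <= sigma s < 1.
Proof.
have hl := lam2; elim: s => [|d s IH]; first by rewrite /= lexx ltr01.
rewrite /=; apply: ratio_bounds; apply: addr_ge0; apply: mulr_ge0 => //.
  by rewrite invr_ge0; lra.
by rewrite invr_ge0; lra.
Qed.

Lemma branch_ge0 (d : nat) s : 0 <= d%:R * (lam - 1 - 0)^-1 + m%:R * (lam - 1 - sigma s)^-1.
Proof.
have hl := lam2; have /andP [s0 s1] := sigma_bounds s.
by apply: addr_ge0; apply: mulr_ge0; rewrite ?ler0n // invr_ge0; lra.
Qed.

Lemma lower_value_iter T B D E n k : lower_value lam 1 T D n -> lower_value lam 1 B E n ->
  lower_value lam 1 (iter k (bond (Some false) true T) B) (k%:R * D + E) n.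
Proof.
move=> hT hB; elim: k => [|k IH]; first by rewrite mul0r add0r.
have -> : k.+1%:R * D + E = D + (k%:R * D + E) by rewrite -natr1; ring.
have := @lower_value_bond R lam (Some false) T (iter k (bond (Some false) true T) B) D (k%:R * D + E) n.
by rewrite /= opprK; apply.
Qed.

Lemma attained_value_iter T B D E k : attained_value lam 1 T D -> attained_value lam 1 B E ->
  attained_value lam 1 (iter k (bond (Some false) true T) B) (k%:R * D + E).
Proof.
move=> hT hB; elim: k => [|k IH]; first by rewrite mul0r add0r.
have -> : k.+1%:R * D + E = D + (k%:R * D + E) by rewrite -natr1; ring.
have := @attained_value_bond R lam (Some false) T (iter k (bond (Some false) true T) B) D (k%:R * D + E).
by rewrite /= opprK; apply.
Qed.

Lemma value_pendant : value lam 1 (planted empty_rooted) (lam - 1 - 0)^-1.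
Proof. by apply: value_planted (value_empty lam 0); rewrite ?ltr01. Qed.

Lemma value_tower s : value lam 0 (tower m s) (sigma s).
Proof.
have hl := lam2; elim: s => [|d s IH]; first exact: value_empty.
have /andP [s0 s1] := sigma_bounds s.
apply: value_clique (branch_ge0 d s) _.
have [p1 p2] := value_pendant; have [q1 q2] := value_planted lam2 s1 IH.
have [e1 e2] := value_empty lam 1.
split=> [n|]; [apply: lower_value_iter => //|apply: attained_value_iter => //].
  by rewrite -[X in lower_value _ _ _ X]addr0; apply: lower_value_iter.
by rewrite -[X in attained_value _ _ _ X]addr0; apply: attained_value_iter.
Qed.

(* A vertex set with fewer than [size s] elements misses the spine at some level in
   every branch, and therefore cannot see [s']. *)
Lemma lower_value_prefix s s' : lower_value lam 0 (tower m (s ++ s')) (sigma s) (size s).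
Proof.
have hl := lam2; elim: s => [|d s IH]; first by move=> x b; rewrite ltn0.
have /andP [s0 s1] := sigma_bounds s.
apply: lower_value_clique (branch_ge0 d s) _.
apply: lower_value_iter; first by have [h _] := value_pendant; exact: h.
rewrite -[X in lower_value _ _ _ X]addr0; apply: lower_value_iter; last first.
  by have [h _] := value_empty lam 1; exact: h.
apply: lower_value_planted => //; exact: (value_tower (s ++ s')).1.
Qed.

Lemma lower_value_forest (l : seq (seq nat * R)) n :
  (forall p, p \in l -> lower_value lam 0 (tower m p.1) p.2 n) ->
  lower_value lam 0 (forest m (unzip1 l)) (\sum_(p <- l) p.2) n.
Proof.
elim: l => [|p l IH] hp.
  by rewrite big_nil; have [h _] := value_empty lam 0; exact: h.
rewrite big_cons /=.
have := @lower_value_bond R lam None (tower m p.1) (forest m (unzip1 l)) p.2 (\sum_(p <- l) p.2) n.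
rewrite /= oppr0; apply; first by apply: hp; rewrite inE eqxx.
by apply: IH => p' hp'; apply: hp; rewrite inE hp' orbT.
Qed.

Lemma attained_value_forest (l : seq (seq nat)) :
  attained_value lam 0 (forest m l) (\sum_(s <- l) sigma s).
Proof.
elim: l => [|s l IH]; first by rewrite big_nil; have [] := value_empty lam 0.
rewrite big_cons /=.
have := @attained_value_bond R lam None (tower m s) (forest m l) (sigma s) (\sum_(s <- l) sigma s).
by rewrite /= oppr0; apply=> //; have [] := value_tower s.
Qed.

(** The locality that a finite forbidden family would imply, with [n0] its largest order. *)
Definition small_witness n0 := forall T : rooted, (exists x, rform lam (T := T) x < 0) ->
  exists2 x : rcarrier T -> R, (#|[set v | x v != 0%R]| <= n0)%N & rform lam x < 0.

(** A root vertex planted on the forest has an indefinite form as soon as the values of the towers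
    exceed [lam] in total. A vector with at most [n0] nonzero entries sees only the prefix [s] of
    each of the [k] towers, so by locality the suffix [s'] cannot matter. *)
Lemma prefix_transfer n0 (l : seq (seq nat)) k s s' : small_witness n0 -> (n0 < size s)%N ->
  \sum_(f <- l) sigma f + k%:R * sigma s <= lam ->
  \sum_(f <- l) sigma f + k%:R * sigma (s ++ s') <= lam.
Proof.
move=> loc ns ok; rewrite leNgt; apply/negP => nok.
have sumE (t : seq nat) (r : R) : \sum_(p <- [seq (f, sigma f) | f <- l] ++ nseq k (t, r)) p.2
    = \sum_(f <- l) sigma f + k%:R * r.
  rewrite big_cat /= big_map big_nseq; congr (_ + _).
  by elim: k {ok nok} => [|k IH]; rewrite ?mul0r //= IH -natr1; ring.
have uzE (t : seq nat) (r : R) : unzip1 ([seq (f, sigma f) | f <- l] ++ nseq k (t, r)) = l ++ nseq k t.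
  by rewrite /unzip1 map_cat -map_comp map_id map_nseq.
have [|x xn] := loc (planted (forest m (l ++ nseq k (s ++ s')))).
  have [x [x1 x2]] := attained_value_forest (l ++ nseq k (s ++ s')) 1.
  exists (fun u => match u with inl _ => 1 | inr v => x v end).
  rewrite rform_planted /= (_ : (fun v => x v) = x) // x1.
  move: x2; rewrite mul0r subr0 => ->.
  have <- : \sum_(f <- l) sigma f + k%:R * sigma (s ++ s') = \sum_(s0 <- l ++ nseq k (s ++ s')) sigma s0.
    by rewrite -(sumE (s ++ s')) !big_cat big_map /= !big_nseq.
  by lra.
rewrite ltNge => /negP; apply.
have := @lower_value_forest ([seq (f, sigma f) | f <- l] ++ nseq k (s ++ s', sigma s)) n0.+1.
rewrite sumE uzE => h; have {}h := h _ (fun v => x (inr v)) (x (inl tt)) _.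
rewrite rform_planted; set z := x (inl tt) in h *.
have : 0 <= (lam - (\sum_(f <- l) sigma f + k%:R * sigma s)) * z ^+ 2.
  by rewrite mulr_ge0 ?sqr_ge0 // subr_ge0.
suff : 0 <= rform lam (fun v => x (inr v)) - 0 * root_sum (fun v => x (inr v)) ^+ 2
   - 2 * z * root_sum (fun v => x (inr v)) + z ^+ 2 * (\sum_(f <- l) sigma f + k%:R * sigma s).
  by rewrite mul0r; lra.
apply: h.
- move=> p; rewrite mem_cat => /orP [/mapP [f _ ->]|/nseqP [-> _]] /=.
    by have [h _] := value_tower f; exact: h.
  by apply: lower_value_le ns _; exact: lower_value_prefix.
- by rewrite ltnS; apply: leq_trans xn; apply: (card_supp_inj x (@inr_inj _ _)).
Qed.

End Towers.

(** * Pendants climbing to the root *)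

Section NoLocality.
Variables (R : realType) (lam x : R) (m k : nat) (l : seq (seq nat)).
(** [x] bounds the value of a tower without pendants, as [hx] says that one more level keeps it
    below [x]. At [x] the planted forest is still within the bound, by [lo]; at 1, the limit for
    many pendants, it is not, by [hi]. [gap] says that branches of value 1 outweigh one pendant
    together with branches of value [x]. *)
Hypotheses (lam2 : 2 < lam) (x1 : x < 1) (hx : m%:R <= x * (m%:R + lam - 1 - x)).
Local Notation sigma := (sigma lam m).
Local Notation fixed := (\sum_(f <- l) sigma f).
Hypotheses (lo : fixed + k%:R * x <= lam) (hi : lam < fixed + k%:R).
Hypothesis gap : (lam - 1)^-1 + m%:R * (lam - 1 - x)^-1 < m%:R * (lam - 2)^-1.

Lemma ratio_le (D D' : R) : 0 <= D -> D <= D' -> D / (1 + D) <= D' / (1 + D').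
Proof.
move=> D0 DD; rewrite ler_pdivrMr; last by lra.
by rewrite mulrAC ler_pdivlMr; nra.
Qed.

Lemma inv_le (u v : R) : u <= v -> v < 1 -> (lam - 1 - u)^-1 <= (lam - 1 - v)^-1.
Proof. by move=> uv v1; have hl := lam2; rewrite lef_pV2 ?posrE; lra. Qed.

Lemma sigma_zeros L : sigma (nseq L 0%N) <= x.
Proof.
have hl := lam2; have h1 := x1; have m0 : (0 : R) <= m%:R by [].
elim: L => [|L IH]; first by rewrite /=; have h := hx; nra.
have := branch_ge0 m lam2 0 (nseq L 0%N).
rewrite /= mul0r add0r => D0.
have DD : m%:R * (lam - 1 - sigma (nseq L 0%N))^-1 <= m%:R * (lam - 1 - x)^-1.
  by rewrite ler_wpM2l // inv_le.
apply: le_trans (ratio_le D0 DD) _.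
have e0 : 0 < lam - 1 - x by lra.
have -> : m%:R * (lam - 1 - x)^-1 / (1 + m%:R * (lam - 1 - x)^-1) = m%:R / (m%:R + lam - 1 - x).
  by field; apply/andP; split; rewrite gt_eqF //; lra.
by rewrite ler_pdivrMr //; lra.
Qed.

Lemma sigma_cons_le d s d' s' :
  d%:R * (lam - 1 - 0)^-1 + m%:R * (lam - 1 - sigma s)^-1
    <= d'%:R * (lam - 1 - 0)^-1 + m%:R * (lam - 1 - sigma s')^-1 ->
  sigma (d :: s) <= sigma (d' :: s').
Proof. by move=> h; exact: (ratio_le (branch_ge0 m lam2 d s)). Qed.

Lemma sigma_prefix_le p s s' : sigma s <= sigma s' -> sigma (p ++ s) <= sigma (p ++ s').
Proof.
move=> h; elim: p => [//|d p IH]; apply: sigma_cons_le.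
rewrite lerD2l ler_wpM2l // inv_le //; by have /andP [] := sigma_bounds m lam2 (p ++ s').
Qed.

Lemma sigma_near_one (eta : R) : 0 < eta -> exists d, forall s, 1 - eta <= sigma (d :: s).
Proof.
move=> e0; have hl := lam2.
exists (Num.bound ((lam - 1) / eta)) => s.
have := archi_boundP (divr_ge0 (_ : 0 <= lam - 1) (ltW e0)); rewrite ltr_pdivrMr //.
set d := Num.bound _ => /(_ ltac:(lra)) hd; rewrite /= subr0.
have m0 : 0 <= m%:R * (lam - 1 - sigma s)^-1.
  have /andP [s0 s1] := sigma_bounds m lam2 s.
  by apply: mulr_ge0 => //; rewrite invr_ge0; lra.
have h1 : 1 <= d%:R * (lam - 1)^-1 * eta.
  by rewrite mulrAC ler_pdivlMr; lra.
move: (m%:R * _) (d%:R * (lam - 1)^-1) m0 h1 => u w u0 h1.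
have w0 : 0 < w by nra.
by rewrite ler_pdivlMr; nra.
Qed.

Theorem no_small_witness n0 : ~ small_witness lam n0.
Proof.
move=> loc; have hl := lam2; have h1 := x1.
pose OK s := fixed + k%:R * sigma s <= lam.
have OKle s s' : sigma s <= sigma s' -> OK s' -> OK s.
  by rewrite /OK => h; apply: le_trans; rewrite lerD2l ler_wpM2l.
(* By [gap] and [sigma_near_one]: with [d1] pendants on the level below, the branches beat one more
   pendant on the present level. *)
have [d1 hd1] : exists d1, forall s,
    (lam - 1)^-1 + m%:R * (lam - 1 - x)^-1 <= m%:R * (lam - 1 - sigma (d1 :: s))^-1.
  pose c := (lam - 1)^-1 + m%:R * (lam - 1 - x)^-1.
  have c0 : 0 < c.
    by apply: ltr_wpDr; rewrite ?invr_gt0 ?mulr_ge0 ?invr_ge0 //; lra.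
  have l20 : 0 < lam - 2 by lra.
  have e0 : 0 < m%:R / c - (lam - 2).
    by move: gap; rewrite -/c subr_gt0 ltr_pdivlMr // ltr_pdivlMr // mulrC.
  have [d hd] := sigma_near_one e0; exists d => s; rewrite -/c.
  have := hd s; have /andP [_ s1] := sigma_bounds m lam2 (d :: s).
  move: (sigma (d :: s)) s1 => y y1 h.
  rewrite ler_pdivlMr; last by lra.
  rewrite mulrC -ler_pdivlMr //; lra.
(* From level [i.+1] to level [i], by induction on the number of pendants: the sequence with [d]
   pendants here and [d1] below is within the bound, and dominates the one with [d.+1] here and none
   below. *)
have step i : (forall s, size s = i.+1 -> (forall L, OK (s ++ nseq L 0%N)) ->
      forall d L, OK (s ++ d :: nseq L 0%N)) ->
    forall s, size s = i -> (forall L, OK (s ++ nseq L 0%N)) -> forall d L, OK (s ++ d :: nseq L 0%N).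
  move=> H s ss h0; elim=> [|d IH] L; first exact: (h0 L.+1).
  have := H (rcons s d) _ _ d1 L; rewrite size_rcons ss => /(_ erefl) h.
  apply: OKle (h _); last by move=> L'; rewrite cat_rcons.
  rewrite cat_rcons; apply: sigma_prefix_le; apply: sigma_cons_le.
  have := hd1 (nseq L 0%N); have := inv_le (sigma_zeros L) x1.
  rewrite !subr0 -natr1; have m0 : (0 : R) <= m%:R by [].
  by move=> h2 h3; have := ler_wpM2l m0 h2; lra.
(* Behind a prefix longer than [n0] everything is invisible, so any number of pendants is
   allowed. *)
have base s : size s = n0.+1 -> (forall L, OK (s ++ nseq L 0%N)) ->
    forall d L, OK (s ++ d :: nseq L 0%N).
  move=> ss h0 d L; have := h0 0%N; rewrite /OK cats0.
  by apply: (@prefix_transfer R lam m lam2 n0 l k s (d :: nseq L 0%N) loc); rewrite ss.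
have all j : (j <= n0.+1)%N -> forall s, size s = (n0.+1 - j)%N -> (forall L, OK (s ++ nseq L 0%N)) ->
    forall d L, OK (s ++ d :: nseq L 0%N).
  elim: j => [|j IH] jn; first by rewrite subn0.
  by apply: step; rewrite -subSn // subSS; apply: IH; exact: ltnW.
have top d L : OK (d :: nseq L 0%N).
  have := all n0.+1 (leqnn _) [::]; rewrite subnn => /(_ erefl); apply => L'.
  apply: le_trans lo; rewrite lerD2l ler_wpM2l //; exact: sigma_zeros.
have e0 : 0 < (fixed + k%:R - lam) / k.+1%:R by rewrite divr_gt0 // subr_gt0.
have [d hd] := sigma_near_one e0.
have := top d 0%N; rewrite /OK; have := hd [::]; rewrite /nseq.
have hh := hi; move: (sigma [:: d]) => y hy; apply/negP; rewrite -ltNge.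
have k0 : (0 : R) <= k%:R by [].
have hA : k%:R * (1 - (fixed + k%:R - lam) / k.+1%:R) <= k%:R * y by rewrite ler_wpM2l.
have hB : k%:R * ((fixed + k%:R - lam) / k.+1%:R) < fixed + k%:R - lam.
  have : 0 < fixed + k%:R - lam by rewrite subr_gt0.
  by rewrite mulrA ltr_pdivrMr ?ltr0n // -natr1; nra.
rewrite mulrBr mulr1 in hA; move: (k%:R * _) (k%:R * y) hA hB => u w hA hB; lra.
Qed.

End NoLocality.

Section Regimes.
Variables (R : realType) (lam : R).
Hypothesis lam2 : 2 < lam.

(** Here only [k] equal towers of width [m] are planted. The chosen [x] drops the nonnegative term
    [x * (1 - x)] from the fixed-point equation, which makes it rational. *)
Lemma regime_large (m k n0 : nat) :
  (lam - 2) * (lam - 1) < m%:R -> k%:R * m%:R <= lam * (m%:R + (lam - 2)) -> lam < k%:R ->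
  ~ small_witness lam n0.
Proof.
move=> h1 h2 h3; have hl := lam2; have y0 : 0 < lam - 2 by lra.
have m0 : (0 : R) < m%:R by nra.
have my0 : m%:R + (lam - 2) != 0 by rewrite gt_eqF //; lra.
set y := lam - 2 in h1 h2 y0 my0 *; have lE : lam = y + 2 by rewrite /y; lra.
pose x := m%:R / (m%:R + y).
have xE : x * (m%:R + y) = m%:R by rewrite /x divfK.
have x0 : 0 < x by rewrite /x divr_gt0 //; lra.
have x1 : x < 1 by rewrite /x ltr_pdivrMr; lra.
apply: (@no_small_witness R lam x m k [::]) => //.
- have -> : x * (m%:R + lam - 1 - x) = x * (m%:R + y) + x * (1 - x) by rewrite lE; ring.
  by rewrite xE lerDl mulr_ge0 //; lra.
- by rewrite big_nil add0r /x mulrA ler_pdivrMr //; lra.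
- by rewrite big_nil add0r.
rewrite -subr_gt0.
have e1 : (lam - 1 - x)^-1 = (m%:R + y) / (y * (m%:R + y + 1)).
  have -> : lam - 1 - x = y * (m%:R + y + 1) / (m%:R + y) by rewrite lE /x; field.
  by rewrite invf_div.
have -> : m%:R / (lam - 2) - ((lam - 1)^-1 + m%:R * (lam - 1 - x)^-1)
   = (m%:R - y * (y + 1)) / (y * (m%:R + y + 1) * (y + 1)).
  rewrite e1 lE; field; do ?[apply/andP; split]; rewrite gt_eqF //; lra.
apply: divr_gt0; first by move: h1; rewrite lE; lra.
by apply: mulr_gt0; [apply: mulr_gt0|]; lra.
Qed.

Lemma sigma0 m : m = 1%N -> sigma lam m [:: 0%N] = lam^-1.
Proof.
move=> ->; have hl := lam2; rewrite /= mul0r add0r mul1r.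
by field; do ?[apply/andP; split]; rewrite gt_eqF //; lra.
Qed.

Lemma sigma00 m : m = 1%N -> sigma lam m [:: 0%N; 0%N] = (lam - lam^-1)^-1.
Proof.
move=> m1; have hl := lam2; have := sigma0 m1.
rewrite /sigma -/(sigma _ _) => ->; rewrite m1 mul0r add0r mul1r.
have l1 : lam^-1 < 1 by rewrite invf_lt1; lra.
have := l1; move: (lam^-1) => w w1.
by field; do ?[apply/andP; split]; rewrite gt_eqF //; lra.
Qed.

Lemma gap_one (x : R) : x < 1 -> (lam - 2) ^+ 2 < 1 - x ->
  (lam - 1)^-1 + 1%:R * (lam - 1 - x)^-1 < 1%:R * (lam - 2)^-1.
Proof.
move=> x1 h; have hl := lam2; rewrite -subr_gt0.
have -> : 1%:R / (lam - 2) - ((lam - 1)^-1 + 1%:R * (lam - 1 - x)^-1)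
   = (1 - x - (lam - 2) ^+ 2) / ((lam - 2) * (lam - 1) * (lam - 1 - x)).
  by field; do ?[apply/andP; split]; rewrite gt_eqF //; lra.
apply: divr_gt0; first by lra.
by apply: mulr_gt0; [apply: mulr_gt0|]; lra.
Qed.

(** Initially a star-like tree with one arm of length 1 and two long arms; 8/10 bounds the value of
    a long arm for all these [lam]. *)
Lemma regime_middle n0 : 209 / 100 <= lam -> lam <= 24 / 10 -> ~ small_witness lam n0.
Proof.
move=> h1 h2; have hl := lam2.
have i1 : lam^-1 <= 1 / 209 * 100.
  by rewrite -[leRHS]invrK lef_pV2 ?posrE; lra.
have i2 : 10 / 24 <= lam^-1.
  by rewrite -[leLHS]invrK lef_pV2 ?posrE; lra.
apply: (@no_small_witness R lam (8 / 10) 1 2 [:: [:: 0%N]]) => //; rewrite ?big_seq1 ?sigma0 //; try lra.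
apply: gap_one; first by lra.
by nra.
Qed.

(** [t^-1] is exactly the value of an infinite arm, and the arms of length 1 and 2 are the fixed
    branches. The three values add up to at most [lam] precisely because [t ^+ 2 + 1 <= t ^+ 6]. *)
Lemma regime_small (t : R) n0 : 1 < t -> lam = t + t^-1 -> t ^+ 2 + 1 <= t ^+ 6 ->
  lam <= 209 / 100 -> ~ small_witness lam n0.
Proof.
move=> t1 lt tu l2; have hl := lam2; have t0 : t != 0 by rewrite gt_eqF //; lra.
have i0 : 0 < t^-1 by rewrite invr_gt0; lra.
have i1 : t^-1 < 1 by rewrite invf_lt1; lra.
apply: (@no_small_witness R lam t^-1 1 1 [:: [:: 0%N]; [:: 0%N; 0%N]]) => //;
  rewrite ?big_cons ?big_nil ?sigma00 ?sigma0 //.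
- have -> : t^-1 * (1%:R + lam - 1 - t^-1) = 1 by rewrite lt; field.
  by [].
- set u := t ^+ 2; have u0 : 0 < u by rewrite exprn_gt0; lra.
  have u3 : u + 1 <= u ^+ 3 by rewrite /u -exprM.
  have lE : lam = (u + 1) / t by rewrite lt /u; field.
  have d1 : u + 1 != 0 by rewrite gt_eqF //; lra.
  have d2 : 0 < u ^+ 2 + u + 1 by have := sqr_ge0 u; lra.
  have d3 : u ^+ 2 + u + 1 != 0 by rewrite gt_eqF.
  have e1 : lam^-1 = t / (u + 1) by rewrite lE invf_div.
  have e2 : (lam - lam^-1)^-1 = t * (u + 1) / (u ^+ 2 + u + 1).
    have -> : lam - lam^-1 = (u ^+ 2 + u + 1) / (t * (u + 1)).
      by rewrite e1 lE /u; field; rewrite t0 -/u d1.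
    by rewrite invf_div.
  have -> : t^-1 = lam - t by rewrite lt; ring.
  rewrite e2 e1 mul1r addr0 -subr_ge0.
  have -> : lam - (t / (u + 1) + t * (u + 1) / (u ^+ 2 + u + 1) + (lam - t))
    = t * (u ^+ 3 - (u + 1)) / ((u + 1) * (u ^+ 2 + u + 1)) by field; rewrite d1 d3.
  by apply: divr_ge0; apply: mulr_ge0; lra.
- have h1 : 478 / 1000 <= lam^-1 by rewrite -[leLHS]invrK lef_pV2 ?posrE; lra.
  have h2 : 620 / 1000 <= (lam - lam^-1)^-1.
    have h3 : lam^-1 < 1 by rewrite invf_lt1; lra.
    by rewrite -[leLHS]invrK lef_pV2 ?posrE; lra.
  by lra.
apply: gap_one => //.
have tl : t < 2.
  have : t * lam = t ^+ 2 + 1 by rewrite lt; field.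
  by nra.
have e1 : lam - 2 = (t - 1) ^+ 2 / t by rewrite lt; field.
rewrite e1 -subr_gt0.
have -> : 1 - t^-1 - ((t - 1) ^+ 2 / t) ^+ 2 = (t - 1) * (t - (t - 1) ^+ 3) / t ^+ 2 by field.
have h3 : (t - 1) ^+ 3 <= 1 by rewrite exprn_ile1 //; lra.
by rewrite divr_gt0 ?exprn_gt0 ?mulr_gt0 //; lra.
Qed.

End Regimes.

Theorem small_witness_fails (R : realType) (rho lam : R) n0 : rho ^+ 3 = rho + 1 ->
  Num.sqrt rho + (Num.sqrt rho)^-1 <= lam -> ~ small_witness lam n0.
Proof.
move=> hrho; have r1 := cubic_root_gt1 hrho.
set s := Num.sqrt rho => hlam.
have s2 : s ^+ 2 = rho by rewrite /s sqr_sqrtr //; lra.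
have s0 : 0 <= s by exact: sqrtr_ge0.
have s1 : 1 < s by nra.
have sl : 1 <= s * (lam - s).
  have : s * (s + s^-1) <= s * lam by rewrite ler_wpM2l.
  by rewrite mulrDr mulfV ?gt_eqF ?(lt_trans _ s1) //; lra.
have lam2 : 2 < lam by nra.
have [l1|l1] := lerP lam (209 / 100).
  (* [t] below is the larger solution of [t + t^-1 = lam]. *)
  pose w := Num.sqrt (lam ^+ 2 - 4).
  have w2 : w ^+ 2 = lam ^+ 2 - 4 by rewrite /w sqr_sqrtr //; nra.
  have w0 : 0 <= w by exact: sqrtr_ge0.
  have w1 : 0 < w by nra.
  pose t := (lam + w) / 2; have t1 : 1 < t by rewrite /t; lra.
  have tt : t * (lam - t) = 1 by rewrite /t; nra.
  have t0 : t != 0 by rewrite gt_eqF //; lra.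
  have ti : t^-1 = lam - t by apply: (mulfI t0); rewrite mulfV.
  have ts : s <= t.
    rewrite leNgt; apply/negP => ts.
    have : 0 < (s - t) * (s + t - lam) by apply: mulr_gt0; rewrite /t in ts *; lra.
    by nra.
  apply: (@regime_small R lam lam2 t) => //; first by rewrite ti; lra.
  have -> : t ^+ 6 = (t ^+ 2) ^+ 3 by ring.
  have : rho <= t ^+ 2 by rewrite -s2; nra.
  move: (t ^+ 2) => u ur.
  have : 0 <= (u - rho) * (u ^+ 2 + u * rho + rho ^+ 2 - 1) by apply: mulr_ge0; nra.
  have -> : (u - rho) * (u ^+ 2 + u * rho + rho ^+ 2 - 1) = u ^+ 3 - u - (rho ^+ 3 - rho) by ring.
  by rewrite hrho; lra.
have [l2|l2] := lerP lam (24 / 10); first by apply: regime_middle => //; exact: ltW.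
have [l3|l3] := lerP lam (25 / 10); first by apply: (@regime_large R lam lam2 1 3) => //; nra.
have [l4|l4] := ltrP lam 3; first by apply: (@regime_large R lam lam2 2 3) => //; nra.
have y0 : 0 <= (lam - 2) * (lam - 1) by nra.
(* [m.+1] and [k.+1] are the least integers above [(lam - 2) * (lam - 1)] and [lam]; the error of
   this rounding is absorbed by [lam >= 3]. *)
have /andP [m1 m2] := truncn_itv y0; move: (Num.truncn _) m1 m2 => m m1 m2.
have lp : 0 <= lam by lra.
have /andP [k1 k2] := truncn_itv lp; move: (Num.truncn _) k1 k2 => k k1 k2.
apply: (@regime_large R lam lam2 m.+1 k.+1) => //.
have m0 : 0 <= m%:R :> R by [].
rewrite -(natr1 m) -(natr1 k); move: m%:R k%:R m0 m1 k1 => x z m0 m1 k1.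
apply: (@le_trans _ _ ((lam + 1) * (x + 1))); first by rewrite ler_wpM2r //; lra.
rewrite -subr_ge0.
have -> : lam * (x + 1 + (lam - 2)) - (lam + 1) * (x + 1)
  = (lam - 3) + ((lam - 2) * (lam - 1) - x) by ring.
by lra.
Qed.

(** * Forbidden subgraphs *)

From mathcomp Require Import sesquilinear spectral complex.
From mathcomp Require Import classical_sets cardinality constructive_ereal ereal.

Section SymmetricMatrix.
Variable R : rcfType.
Import ComplexField.
Local Open Scope sesquilinear_scope.
Local Notation toC := (real_complex R).

(** [A] is diagonalised by a unitary matrix over [R[i]]. Its spectrum there is real, hence consists
    of eigenvalues over [R], and in the new coordinates the bound holds term by term. *)
Lemma symmetric_form_le n (A : 'M[R]_n) (lam : R) :
  A^T = A -> (forall a, eigenvalue A a -> a <= lam) ->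
  forall x : 'rV_n, (x *m A *m x^T) 0 0 <= lam * (x *m x^T) 0 0.
Proof.
move=> symA eigA x.
pose AC : 'M[R[i]]_n := map_mx toC A.
have conjR m p (B : 'M[R]_(m, p)) : (map_mx toC B) ^t* = map_mx toC B^T.
  by apply/matrixP => i j; rewrite !mxE conj_Creal // complex_real.
have hermA : AC \is hermsymmx.
  apply/is_hermitianmxP; rewrite expr0 scale1r.
  by rewrite conjR symA.
have /orthomx_spectralP eqA := hermitian_normalmx hermA.
set P := spectralmx AC in eqA; set d := spectral_diag AC in eqA.
have Pu : P \is unitarymx := spectral_unitarymx AC.
rewrite invmx_unitary // in eqA.
pose c := map_mx toC x *m P ^t*.
have nc : map_mx toC (x *m x^T) = c *m c ^t*.
  have -> : c ^t* = P *m map_mx toC x^T.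
    by rewrite /c trmx_mul map_mxM -conjR trmxCK.
  rewrite /c mulmxA -(mulmxA _ _ P).
  have -> : P ^t* *m P = 1%:M.
    by rewrite -invmx_unitary // mulVmx // spectral_unit.
  by rewrite mulmx1 map_mxM.
have qc : map_mx toC (x *m A *m x^T) = c *m diag_mx d *m c ^t*.
  have -> : c ^t* = P *m map_mx toC x^T.
    by rewrite /c trmx_mul map_mxM -conjR trmxCK.
  by rewrite !map_mxM -/AC {1}eqA /c !mulmxA.
have dle i : d 0 i <= toC lam.
  have dr : d 0 i \is Num.real.
    by have /mxOverP := hermitian_spectral_diag_real hermA; apply.
  have [r rE] : exists r, d 0 i = toC r.
    by exists (complex.Re (d 0 i)); rewrite RRe_real.
  have : eigenvalue AC (d 0 i).
    apply/eigenvalueP; exists (row i P).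
      rewrite {1}eqA !mulmxA -row_mul.
      have /unitarymxP -> := Pu.
      by rewrite row1 -rowE row_diag_mx -scalemxAl -rowE.
    apply/negP => /eqP ri0.
    have /unitarymxP/(congr1 (row i)) := Pu.
    rewrite row_mul ri0 mul0mx => /matrixP /(_ 0 i).
    by rewrite !mxE eqxx => /esym/eqP; rewrite oner_eq0.
  by rewrite rE (eigenvalue_map toC) lecR; apply: eigA.
have : toC ((x *m A *m x^T) 0 0) <= toC (lam * (x *m x^T) 0 0).
  have -> : toC ((x *m A *m x^T) 0 0) = (c *m diag_mx d *m c ^t*) 0 0.
    by rewrite -qc [RHS]mxE.
  have -> : toC (lam * (x *m x^T) 0 0) = toC lam * (c *m c ^t*) 0 0.
    by rewrite -nc rmorphM [X in _ = _ * X]mxE.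
  rewrite mul_mx_diag !mxE mulr_sumr ler_sum // => i _.
  rewrite !mxE mulrAC [leRHS]mulrC ler_wpM2l //.
  by rewrite mul_conjC_ge0.
by rewrite lecR.
Qed.

End SymmetricMatrix.

Lemma big_supp_image (R : zmodType) (V W : finType) (f : W -> V) (F : V -> R) :
  injective f -> (forall v, v \notin [set f w | w : W] -> F v = 0) ->
  \sum_v F v = \sum_w F (f w).
Proof.
move=> fI F0; rewrite (bigID (mem [set f w | w : W])) /= [X in _ + X]big1 ?addr0; last exact: F0.
by rewrite big_imset //=; exact: in2W.
Qed.

Lemma qf_image (R : realType) (V W : finType) (A : V -> V -> int) (B : W -> W -> int)
    (f : W -> V) (lam : R) (x : V -> R) : injective f -> (forall i j, A (f i) (f j) = B i j) ->
  supp_in [set f w | w : W] x -> qf A lam x = qf B lam (fun w => x (f w)).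
Proof.
move=> fI AB sx; rewrite /qf (big_supp_image fI) => [|v vf]; last by rewrite sx // expr0n.
congr (_ - _); rewrite (big_supp_image fI) => [|v vf]; last first.
  by rewrite big1 // => u _; rewrite sx // mul0r mulr0.
apply: eq_bigr => u _; rewrite (big_supp_image fI) => [|v vf]; last by rewrite (sx v) // !mulr0.
by apply: eq_bigr => v _; rewrite AB.
Qed.

Lemma psd_image (R : realType) (V W : finType) (A : V -> V -> int) (B : W -> W -> int)
    (f : W -> V) (lam : R) : injective f -> (forall i j, A (f i) (f j) = B i j) ->
  psd B lam finset.setT <-> psd A lam [set f w | w : W].
Proof.
move=> fI AB; split=> h x sx.
  by rewrite (qf_image _ fI AB sx); apply: h => w; rewrite inE.
pose y v := \sum_w x w *+ (v == f w).
have yE w : y (f w) = x w.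
  rewrite /y (bigD1 w) //= eqxx big1 ?addr0 // => u /negPf uw.
  by rewrite (inj_eq fI) eq_sym uw.
have sy : supp_in [set f w | w : W] y.
  move=> v vf; rewrite /y big1 // => w _; rewrite (_ : (v == f w) = false) //.
  by apply: contraNF vf => /eqP ->; apply/imsetP; exists w.
have := h y sy; rewrite (qf_image _ fI AB sy) (_ : (fun w => y (f w)) = x) //.
exact/funext.
Qed.

Definition int_adjacency (G : sgraph) (i j : 'I_(sg_order G)) : int :=
  edge_value int (sg_edge i j).

Lemma int_adjacency_signed G : signed_mx (@int_adjacency G).
Proof.
split=> [i j|i|i j]; rewrite /int_adjacency; first by rewrite sg_edge_sym.
  by rewrite sg_edge_irr.
by case: (sg_edge i j) => [[]|].
Qed.

Definition signed_graph (V : finType) (A : V -> V -> int) (sA : signed_mx A) : sgraph.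
Proof.
pose e (z : int) := if z == 1 then Some true else if z == -1 then Some false else None.
refine (@SGraph #|V| (fun i j => e (A (enum_val i) (enum_val j))) _ _).
- by move=> i j; case: sA => ->.
- by move=> i; case: sA => _ ->.
Defined.

Lemma signed_graph_adjacency V A (sA : signed_mx A) i j :
  A (enum_val i) (enum_val j) = @int_adjacency (@signed_graph V A sA) i j.
Proof.
rewrite /int_adjacency /=; case: sA => _ _ /(_ (enum_val i) (enum_val j)).
by case/int_small => [->|[->|->]].
Qed.

Definition induced_on (G : sgraph) (S : {set 'I_(sg_order G)}) : sgraph :=
  @SGraph #|S| (fun i j => sg_edge (enum_val i) (enum_val j))
    (fun i j => sg_edge_sym _ _) (fun i => sg_edge_irr _).

Lemma bounded_spectrumE (R : realType) (lam : R) G :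
  bounded_spectrum lam G <-> psd (@int_adjacency G) lam finset.setT.
Proof.
set n := sg_order G; pose A := signed_adjacency R G.
have AE i j : A i j = (int_adjacency i j)%:~R.
  by rewrite mxE /int_adjacency; case: (sg_edge i j) => [[]|]; rewrite /= ?rmorphN.
have formE (r : 'rV_n) : lam * (r *m r^T) 0 0 - (r *m A *m r^T) 0 0
    = qf (@int_adjacency G) lam (fun i => r 0 i).
  rewrite /qf !mxE; congr (lam * _ - _); first by apply: eq_bigr => i _; rewrite mxE expr2.
  rewrite exchange_big /=; apply: eq_bigr => j _; rewrite !mxE mulr_suml.
  by apply: eq_bigr => i _; rewrite AE; ring.
have -> : bounded_spectrum lam G <-> forall a, eigenvalue A a -> a <= lam.
  rewrite /bounded_spectrum /= /largest_eigenvalue; split=> h.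
    move=> a ea; rewrite -lee_fin; apply: le_trans h; apply: ereal_sup_ubound.
    by exists a.
  by apply: ge_ereal_sup => _ [a /h ha <-]; rewrite lee_fin.
split=> [h x _|h a /eigenvalueP [v va v0]].
  have Asym : A^T = A by apply/matrixP => i j; rewrite mxE !AE /int_adjacency sg_edge_sym.
  have := symmetric_form_le Asym h (\row_i x i); rewrite -subr_ge0 formE.
  by rewrite (_ : (fun i => _) = x) //; apply/funext => i; rewrite mxE.
have := h (fun i => v 0 i); rewrite -formE va -scalemxAl [X in _ - X]mxE -mulrBl.
have v2 : 0 < (v *m v^T) 0 0.
  rewrite mxE; have [i vi] : exists i, v 0 i != 0.
    apply: contrapT => nv; case/negP: v0; apply/eqP/rowP => i; rewrite mxE.
    by apply/eqP; apply: contra_notT nv => vi; exists i.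
  rewrite (bigD1 i) //= ltr_wpDr ?mxE -?expr2 ?exprn_even_gt0 //.
  by apply: sumr_ge0 => j _; rewrite mxE -expr2 sqr_ge0.
rewrite pmulr_lge0 // subr_ge0; apply => i; by rewrite inE.
Qed.

Lemma finite_bounded_order N : finite_set (fun H : sgraph => (sg_order H <= N)%N).
Proof.
pose T : finType := {n : 'I_N.+1 & {ffun 'I_n * 'I_n -> option bool}}.
(* Arbitrary finite functions are made symmetric and irreflexive, so that every code gives a signed
   graph and every graph is its own code. *)
pose e (p : T) (i j : 'I_(tag p)) := if i == j then None
  else if tagged p (i, j) == tagged p (j, i) then tagged p (i, j) else None.
have es p i j : e p i j = e p j i.
  by rewrite /e [j == i]eq_sym [tagged p (j, i) == _]eq_sym; case: eqP => // _; case: eqP.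
have ei p i : e p i i = None by rewrite /e eqxx.
apply: (@sub_finite_set _ _ (range (fun p => SGraph (es p) (ei p)))); last first.
  by apply: finite_image; exact: finite_finset.
move=> [n f fs fi] /= nN.
exists (@Tagged _ (Ordinal (nN : (n < N.+1)%N)) (fun n : 'I_N.+1 => {ffun 'I_n * 'I_n -> option bool})
  [ffun ij => f ij.1 ij.2]) => //.
set p := Tagged _ _.
have ef : e p = f.
  apply/funext => i; apply/funext => j; rewrite /e /= !ffunE /= [f j i]fs eqxx.
  by case: eqP => [->|//].
move: (es p) (ei p); rewrite ef => s' i'; congr SGraph; exact: Prop_irrelevance.
Qed.

Lemma finite_order_bound (F : set sgraph) : finite_set F ->
  exists n, forall H, F H -> (sg_order H <= n)%N.
Proof.
move=> /(finite_image sg_order) /finite_seqP [s Es]; exists (\max_(i <- s) i)%N => H FH.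
have : (sg_order @` F)%classic (sg_order H) by exists H.
by rewrite Es /= => Hs; apply: (@leq_bigmax_seq _ s xpredT id).
Qed.

(** Some forbidden [H] embeds into the graph of [T]. As [H] itself violates the bound, a vector of
    negative form lives on its image, which has at most [n0] vertices. *)
Lemma small_witness_of_characterization (R : realType) (lam : R) :
  has_finite_forbidden_characterization (bounded_spectrum lam) ->
  exists n0, small_witness lam n0.
Proof.
move=> [F finF charF]; have [n0 hn0] := finite_order_bound finF.
exists n0 => T [x hx]; have sT := radj_signed T.
pose G := signed_graph sT.
have nG : ~ bounded_spectrum lam G.
  move=> /bounded_spectrumE /(psd_image lam enum_val_inj (signed_graph_adjacency sT)) /(_ x) h.
  move: hx; rewrite /rform ltNge => /negP; apply; apply: h => v /negP [].
  by apply/imsetP; exists (enum_rank v); rewrite ?enum_rankK.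
have [H FH [f fI fE]] : exists2 H, F H & induced_subgraph H G.
  apply: contrapT => nex; apply: nG; apply/(charF G).2 => H FH HG.
  by apply: nex; exists H.
have nH : ~ bounded_spectrum lam H.
  by move=> /(charF H) /(_ H FH); apply; exists id.
have gI : injective (fun i => enum_val (f i) : rcarrier T).
  by move=> i j /enum_val_inj /fI.
have gE i j : radj (enum_val (f i) : rcarrier T) (enum_val (f j)) = int_adjacency i j.
  by rewrite (signed_graph_adjacency sT) /int_adjacency fE.
apply: contrapT => nex; apply: nH; apply/bounded_spectrumE/(psd_image lam gI gE) => y sy.
rewrite leNgt; apply/negP => hy; apply: nex; exists y => //.
apply: leq_trans (hn0 H FH); rewrite -[leqRHS]card_ord -(card_imset _ gI).
apply: subset_leq_card; apply/fintype.subsetP => v; rewrite inE; apply: contraNT => vN.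
by rewrite sy.
Qed.

(** All graphs with at most [N] vertices outside the class are forbidden; a graph outside the class
    contains one of them, induced on a critical set. *)
Lemma characterization_of_critical_bounded (R : realType) (lam : R) N :
  (forall (V : finType) (A : V -> V -> int) (S : {set V}),
     signed_mx A -> critical A lam S -> (#|S| <= N)%N) ->
  has_finite_forbidden_characterization (bounded_spectrum lam).
Proof.
move=> hN; exists (fun H => (sg_order H <= N)%N /\ ~ bounded_spectrum lam H).
  by apply: sub_finite_set (finite_bounded_order N) => H [].
move=> G; split=> [bG H [_ nH] [f fI fE]|h].
  apply: nH; apply/bounded_spectrumE/(psd_image lam fI (A := @int_adjacency G)).
    by move=> i j; rewrite /int_adjacency fE.
  by apply: psd_sub (finset.subsetT _) _; apply/bounded_spectrumE.
apply: contrapT => nG.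
have [|S _ cS] := @critical_exists R _ (@int_adjacency G) lam finset.setT.
  by move=> pG; apply: nG; apply/bounded_spectrumE.
apply: (h (induced_on S)); last by exists enum_val; [exact: enum_val_inj|].
split; first exact: hN (int_adjacency_signed G) cS.
move=> /bounded_spectrumE /(psd_image lam enum_val_inj (A := @int_adjacency G)) pS.
apply: cS.1; have {}pS := pS (fun i j => erefl).
apply: psd_sub pS; apply/fintype.subsetP => v vS; apply/imsetP; exists (enum_rank_in vS v) => //.
by rewrite enum_rankK_in.
Qed.

Theorem corollary1p6 (R : realType) (rho : R) (hrho : rho ^+ 3 = rho + 1)
    (lambda : R) :
  has_finite_forbidden_characterization (bounded_spectrum lambda) <->
  lambda < Num.sqrt rho + (Num.sqrt rho)^-1.
Proof.
split=> [/small_witness_of_characterization [n0 hn0]|hlam].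
  by rewrite ltNge; apply/negP => hlam; exact: small_witness_fails hrho hlam hn0.
have [N hN] := critical_bounded hrho hlam.
exact: characterization_of_critical_bounded hN.
Qed.
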